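(* Fix $z_0>0$ and $C>0$, and let $t=t(\varepsilon)>0$ be times with $t(\varepsilon)\le C\,\varepsilon^{-1}$ for all small $\varepsilon>0$. For $\varepsilon>0$ let $u$ be the solution of the cubic nonlinear Schr\''odinger equation on the circle $\mathbb{T}=[0,2\pi]$ (periodic boundary conditions) $$i\partial_t u+\Delta u=\varepsilon^2|u|^2u,\qquad u(0,x)=\sum_{k\in\mathbb{Z}}c_k\eta_k e^{ikx},$$ with the random initial data described in the context. Then $$\lim_{\varepsilon\to0^+}\varepsilon\,\log\mathbb{P}\Big(\sup_{x\in\mathbb{T}}|u(t,x)|>z_0\,\varepsilon^{-1/2}\Big)=-\frac{z_0^2}{\sum_{k\in\mathbb{Z}}c_k^2}.$$
   Context: Random initial data: the coefficients are $c_k=a\,e^{-b|k|}$ for all $k\in\mathbb{Z}$, or $c_k=a\,e^{-b|k|^2}$ for all $k\in\mathbb{Z}$, where $a,b>0$ are fixed. The $\{\eta_k\}_{k\in\mathbb{Z}}$ are independent, identically distributed complex Gaussian random variables with $\mathbb{E}\eta_k=0$, $\mathbb{E}[\eta_k\eta_j]=0$ and $\mathbb{E}[\eta_k\overline{\eta_j}]=\delta_{kj}$ for $k,j\in\mathbb{Z}$. Almost surely the initial datum lies in $\bigcap_{s\ge0}H^s(\mathbb{T})$, and $u$ denotes the (almost surely defined) unique global solution, which stays in $\bigcap_{s\geq 0} H^s(\mathbb{T})$. The parameter $\varepsilon$ enters both through the nonlinearity and the height $z_0\varepsilon^{-1/2}$; the time $t$ may depend on $\varepsilon$. *)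

(* Defs.v *)
From HB Require Import structures.
From mathcomp Require Import all_boot all_order all_algebra.
From mathcomp Require Import all_classical all_reals all_analysis.
From mathcomp Require Export complex.
Set Implicit Arguments.
Unset Strict Implicit.
Unset Printing Implicit Defensive.
Import Order.TTheory GRing.Theory Num.Theory.
Import numFieldNormedType.Exports.
Local Open Scope classical_set_scope.
Local Open Scope ring_scope.
Local Open Scope complex_scope.

Section Complex_valued_calculus.
Context {R : realType}.
Implicit Types (f : R -> R[i]) (z : R[i]).

Definition modulus z : R := ComplexField.Normc.normc z.

Definition cexp (theta : R) : R[i] := cos theta +i* sin theta.

Definition cderivable f (x : R) : Prop :=
  derivable (fun y => complex.Re (f y)) x 1 /\
  derivable (fun y => complex.Im (f y)) x 1.

Definition cderive f (x : R) : R[i] :=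
  derive1 (fun y => complex.Re (f y)) x +i* derive1 (fun y => complex.Im (f y)) x.

Definition cintegral (D : set R) f : R[i] :=
  (\int[lebesgue_measure]_(x in D) complex.Re (f x)) +i*
  (\int[lebesgue_measure]_(x in D) complex.Im (f x)).

(* Sums over Z are limits of the symmetric partial sums over |k| <= N. *)
Definition zpartial (F : int -> R[i]) (N : nat) : R[i] :=
  \sum_(j < N.*2.+1) F (j%:Z - N%:Z).

Definition zsum_to (F : int -> R[i]) z : Prop :=
  modulus (zpartial F N - z) @[N --> \oo] --> (0 : R).

End Complex_valued_calculus.

(* Functions on the circle T = R / 2 pi Z are 2 pi-periodic functions on R. *)
Section Circle.
Context {R : realType}.
Implicit Types (f : R -> R[i]) (s : R).

Definition periodic2pi f : Prop := forall x, f (x + pi *+ 2) = f x.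

Definition circle : set R := `[0, pi *+ 2].

Definition fourier_coef f (k : int) : R[i] :=
  ((pi *+ 2)^-1)%:C *
  cintegral circle (fun x => f x * cexp (- (k%:~R * x))).

(* The square of the H^s(T) norm. *)
Definition sobolev_norm2 s f : \bar R :=
  \esum_(k in [set: int])
    ((1 + k%:~R ^+ 2) `^ s * modulus (fourier_coef f k) ^+ 2)%:E.

Definition square_integrable f : Prop :=
  [/\ measurable_fun circle (fun x => complex.Re (f x)),
      measurable_fun circle (fun x => complex.Im (f x)) &
      (\int[lebesgue_measure]_(x in circle) (modulus (f x) ^+ 2)%:E < +oo)%E].

Definition in_sobolev s f : Prop :=
  [/\ periodic2pi f, square_integrable f & (sobolev_norm2 s f < +oo)%E].

(* Global solutions u(t, x) of  i u_t + u_xx = eps^2 |u|^2 u  that lie in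
   C(R; H^s(T)) for every s >= 0.  At this regularity all the derivatives
   exist in the classical sense. *)
Definition nls_solution (eps : R) (u : R -> R -> R[i]) : Prop :=
  [/\ forall s, 0 <= s -> forall t, in_sobolev s (u t),
      forall s, 0 <= s -> forall t0,
        sobolev_norm2 s (fun x => u t x - u t0 x) @[t --> t0] --> (0%E : \bar R),
      forall t x, [/\ cderivable (u^~ x) t, cderivable (u t) x &
                      cderivable (cderive (u t)) x] &
      forall t x,
        Complex 0 1 * cderive (u^~ x) t + cderive (cderive (u t)) x =
        (eps ^+ 2 * modulus (u t x) ^+ 2)%:C * u t x].

Definition sup_circle f : \bar R := ereal_sup [set (modulus (f x))%:E | x in circle].

End Circle.

Section Random_data.
Context {R : realType} {d : measure_display} {Om : measurableType d}.
Variable P : probability Om R.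
Local Notation mR := (measurableTypeR R).

(* The Gaussian law of mean m and standard deviation s; it is the Dirac mass
   at m when s = 0, a case that [normal_prob] fills with a junk value. *)
Definition gaussian_law (m s : R) (A : set mR) : \bar R :=
  if s == 0 then \d_m A else normal_prob m s A.

Definition gaussian_rv (X : Om -> R) : Prop :=
  measurable_fun setT (X : Om -> mR) /\
  exists m s : R, 0 <= s /\
    forall A : set mR, measurable A -> P (X @^-1` A) = gaussian_law m s A.

Definition cpair (Z : Om -> R[i]) (w : Om) : mR * mR :=
  (complex.Re (Z w), complex.Im (Z w)).

(* Real and imaginary parts are jointly Gaussian: all their real linear
   combinations are Gaussian. *)
Definition complex_gaussian (Z : Om -> R[i]) : Prop :=
  forall al be : R,
    gaussian_rv (fun w => al * complex.Re (Z w) + be * complex.Im (Z w)).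

Definition cexpectation (Z : Om -> R[i]) : R[i] :=
  fine 'E_P[(fun w => complex.Re (Z w))] +i*
  fine 'E_P[(fun w => complex.Im (Z w))].

Definition identically_distributed (Z : int -> Om -> R[i]) : Prop :=
  forall (k j : int) (A : set (mR * mR)), measurable A ->
    P (cpair (Z k) @^-1` A) = P (cpair (Z j) @^-1` A).

Definition mutually_independent (Z : int -> Om -> R[i]) : Prop :=
  forall (s : seq int) (A : int -> set (mR * mR)),
    uniq s -> (forall k, measurable (A k)) ->
    P (\big[setI/setT]_(k <- s) (cpair (Z k) @^-1` A k)) =
    (\prod_(k <- s) P (cpair (Z k) @^-1` A k))%E.

Definition iid_complex_gaussians (eta : int -> Om -> R[i]) : Prop :=
  [/\ forall k, complex_gaussian (eta k),
      mutually_independent eta &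
      identically_distributed eta] /\
  [/\ forall k, cexpectation (eta k) = 0,
      forall k j, cexpectation (fun w => eta k w * eta j w) = 0 &
      forall k j,
        cexpectation (fun w => eta k w * conjc (eta j w)) = (k == j)%:R].

(* The solution is only defined almost surely, so events about it are
   measurable only up to null sets.  The outer measure of P agrees with P on
   measurable sets and with its completion on such events, whereas the value
   of P itself outside of the sigma-algebra is unspecified. *)
Definition prob (A : set Om) : \bar R := mu_ext P A.

End Random_data.

Definition admissible_coef {R : realType} (a b : R) (c : int -> R) : Prop :=
  (forall k, c k = a * expR (- (b * `|k%:~R|))) \/
  (forall k, c k = a * expR (- (b * `|k%:~R| ^+ 2))).

Definition coef_sum2 {R : realType} (c : int -> R) : R :=
  fine (\esum_(k in [set: int]) (c k ^+ 2)%:E).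

(* Main.v *)
(** Write [g k = c k * eta k] and [kap = eps^(-1/2)], so that on the relevant
    event the mode sums of the datum are of size [kap] and the nonlinearity
    [eps^2 |u|^2 u] acts with strength [O(1)] on times [t <= C / eps].

    The resonant triples of the cubic term only rotate phases: the resonant
    flow sends mode [k] to [g k * cexp (- (freq k) * t)], which preserves every
    modulus.  The non-resonant triples oscillate with a frequency bounded away
    from [0] and integrate explicitly, with a gain that makes their total
    contribution [O(eps^2 kap^3) = o(kap)].  A bootstrap in the Wiener
    algebra [l^1] over the Fourier coefficients shows that [u t] stays within
    [o(kap)] of the resonant flow in the supremum norm, up to times [C / eps].

    Upper bound: [sup |u t|] is at most [\sum_k c k |eta k|] up to [o(kap)].
    Finitely many moduli matter, they are covered by boxes of mesh proportional
    to [kap], and Cauchy-Schwarz bounds the exponential rate of each box below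
    by [z0^2 / \sum_k c k^2].  Lower bound: force [eta k] to be near
    [kap * lam * c k] times the phase which the resonant flow undoes at time
    [t], so that all modes are aligned at [x = 0]; the choice of [lam]
    realises the equality case of Cauchy-Schwarz.

    Only one-dimensional Gaussian tails are used: the law of [eta k] enters
    through its real linear functionals along a fine grid of directions. *)

Require Import Defs.
From HB Require Import structures.
From mathcomp Require Import all_boot all_order all_algebra.
From mathcomp Require Import all_classical all_reals all_analysis.
From mathcomp Require Import measurable_realfun ring lra zify.
Set Implicit Arguments.
Unset Strict Implicit.
Unset Printing Implicit Defensive.
Import Order.TTheory GRing.Theory Num.Theory.
Import numFieldNormedType.Exports.
Local Open Scope classical_set_scope.
Local Open Scope ring_scope.
Local Open Scope complex_scope.

(** * Complex exponentials and averages over the circle *)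

Section Modulus.
Context {R : realType}.
Implicit Types (z w : R[i]) (x y : R).

Lemma modulusE z : modulus z = Num.sqrt (complex.Re z ^+ 2 + complex.Im z ^+ 2).
Proof. by case: z. Qed.

Lemma modulus_sqr z : modulus z ^+ 2 = complex.Re z ^+ 2 + complex.Im z ^+ 2.
Proof. by rewrite modulusE sqr_sqrtr// addr_ge0// sqr_ge0. Qed.

Lemma modulus_ge0 z : 0 <= modulus z.
Proof. by rewrite modulusE sqrtr_ge0. Qed.

Lemma modulus0 : modulus (0 : R[i]) = 0.
Proof. by rewrite modulusE /= expr0n addr0 sqrtr0. Qed.

Lemma modulus1 : modulus (1 : R[i]) = 1.
Proof. by rewrite modulusE /= expr0n addr0 expr1n sqrtr1. Qed.

Lemma modulus_eq0 z : modulus z = 0 -> z = 0.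
Proof. exact: ComplexField.Normc.eq0_normc. Qed.

Lemma modulusM z w : modulus (z * w) = modulus z * modulus w.
Proof. exact: ComplexField.Normc.normcM. Qed.

Lemma modulusV z : modulus z^-1 = (modulus z)^-1.
Proof. exact: ComplexField.Normc.normcV. Qed.

Lemma modulusN z : modulus (- z) = modulus z.
Proof. by case: z => a b; rewrite !modulusE/= !sqrrN. Qed.

Lemma modulusJ z : modulus (conjc z) = modulus z.
Proof. by case: z => a b; rewrite !modulusE/= !sqrrN. Qed.

Lemma modulusR x : modulus x%:C = `|x|.
Proof. by rewrite modulusE/= expr0n addr0 sqrtr_sqr. Qed.

Lemma ler_modulusD z w : modulus (z + w) <= modulus z + modulus w.
Proof. exact: le_normcD. Qed.

Lemma modulusBC z w : modulus (z - w) = modulus (w - z).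
Proof. by rewrite -opprB modulusN. Qed.

Lemma ler_modulusB z w : modulus (z - w) <= modulus z + modulus w.
Proof. by rewrite -(modulusN w) ler_modulusD. Qed.

Lemma ler_dist_modulus z w : modulus z - modulus w <= modulus (z - w).
Proof. by rewrite lerBlDr (le_trans _ (ler_modulusD _ _))// subrK. Qed.

Lemma ler_modulus_sum I (r : seq I) (P : pred I) (F : I -> R[i]) :
  modulus (\sum_(i <- r | P i) F i) <= \sum_(i <- r | P i) modulus (F i).
Proof.
elim/big_rec2: _ => [|i y z _ le]; first by rewrite modulus0.
by rewrite (le_trans (ler_modulusD _ _))// lerD2l.
Qed.

Lemma ler_Re_modulus z : `|complex.Re z| <= modulus z.
Proof.
rewrite modulusE -sqrtr_sqr ler_sqrt ?addr_ge0 ?sqr_ge0//.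
by rewrite lerDl sqr_ge0.
Qed.

Lemma ler_Im_modulus z : `|complex.Im z| <= modulus z.
Proof.
rewrite modulusE -sqrtr_sqr ler_sqrt ?addr_ge0 ?sqr_ge0//.
by rewrite lerDr sqr_ge0.
Qed.

Lemma ler_modulus_ReIm z : modulus z <= `|complex.Re z| + `|complex.Im z|.
Proof.
rewrite -ler_sqr ?nnegrE ?modulus_ge0 ?addr_ge0// modulus_sqr sqrrD.
rewrite !real_normK ?num_real// lerD2r lerDl mulrn_wge0// mulr_ge0//.
Qed.

Lemma cReD z w : complex.Re (z + w) = complex.Re z + complex.Re w.
Proof. by case: z w => ? ? []. Qed.
Lemma cImD z w : complex.Im (z + w) = complex.Im z + complex.Im w.
Proof. by case: z w => ? ? []. Qed.
Lemma cReN z : complex.Re (- z) = - complex.Re z.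
Proof. by case: z. Qed.
Lemma cImN z : complex.Im (- z) = - complex.Im z.
Proof. by case: z. Qed.
Lemma cReM z w :
  complex.Re (z * w) = complex.Re z * complex.Re w - complex.Im z * complex.Im w.
Proof. by case: z w => ? ? []. Qed.
Lemma cImM z w :
  complex.Im (z * w) = complex.Re z * complex.Im w + complex.Im z * complex.Re w.
Proof. by case: z w => ? ? []. Qed.
Lemma cReJ z : complex.Re (conjc z) = complex.Re z.
Proof. by case: z. Qed.
Lemma cImJ z : complex.Im (conjc z) = - complex.Im z.
Proof. by case: z. Qed.

Lemma cRe_sum I (r : seq I) (P : pred I) (F : I -> R[i]) :
  complex.Re (\sum_(i <- r | P i) F i) = \sum_(i <- r | P i) complex.Re (F i).
Proof. by elim/big_rec2: _ => [|i y z _ le]//; rewrite cReD le. Qed.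
Lemma complex_ext z w : complex.Re z = complex.Re w ->
  complex.Im z = complex.Im w -> z = w.
Proof. by case: z w => ? ? [? ?]/= -> ->. Qed.

Lemma conjcM z w : conjc (z * w) = conjc z * conjc w.
Proof. exact: rmorphM. Qed.
Lemma conjcD z w : conjc (z + w) = conjc z + conjc w.
Proof. exact: rmorphD. Qed.
Lemma conjc_sum I (r : seq I) (F : I -> R[i]) :
  conjc (\sum_(i <- r) F i) = \sum_(i <- r) conjc (F i).
Proof. exact: rmorph_sum. Qed.

Lemma mul_conjc z : z * conjc z = (modulus z ^+ 2)%:C.
Proof.
rewrite modulus_sqr; apply: complex_ext; rewrite ?cReM ?cImM cReJ cImJ/=; ring.
Qed.

Lemma exists_phase z : exists2 w, modulus w = 1 & w * z = (modulus z)%:C.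
Proof.
have [->|z0] := eqVneq z 0; first by exists 1; rewrite ?modulus1// mulr0 modulus0.
have m0 : modulus z != 0 by apply: contraNneq z0 => /modulus_eq0 ->.
exists (conjc z * ((modulus z)^-1)%:C).
  by rewrite modulusM modulusJ modulusR ger0_norm ?invr_ge0 ?modulus_ge0// divff.
rewrite mulrAC [conjc z * z]mulrC mul_conjc -rmorphM/= expr2 -mulrA divff// mulr1.
by [].
Qed.

Lemma cexp0 : cexp (0 : R) = 1.
Proof. by rewrite /cexp cos0 sin0. Qed.

Lemma cexpD x y : cexp (x + y) = cexp x * cexp y.
Proof.
apply: complex_ext; rewrite ?cReM ?cImM/= ?cosD ?sinD; first by [].
by rewrite addrC.
Qed.

Lemma cexpN x : cexp (- x) = conjc (cexp x).
Proof. by rewrite /cexp cosN sinN. Qed.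

Lemma modulus_cexp x : modulus (cexp x) = 1.
Proof. by rewrite modulusE/= cos2Dsin2 sqrtr1. Qed.

Lemma cexpNK x : cexp (- x) * cexp x = 1.
Proof. by rewrite -cexpD addNr cexp0. Qed.

Lemma cexp2pi x : cexp (x + pi *+ 2) = cexp x.
Proof. by rewrite /cexp cosD2pi sinD2pi. Qed.

Lemma cexp_int2pi (k : int) x : cexp (k%:~R * (x + pi *+ 2)) = cexp (k%:~R * x).
Proof.
have H (n : nat) y : cexp (y + (pi *+ 2) *+ n) = cexp y.
  elim: n => [|n IH]; first by rewrite mulr0n addr0.
  by rewrite mulrS (addrC (pi *+ 2)) addrA cexp2pi IH.
have H' (n : nat) y : cexp (n%:R * (y + pi *+ 2)) = cexp (n%:R * y).
  by rewrite mulrDr [_ * (pi *+ 2)]mulr_natl H.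
case: k => n; first by rewrite -pmulrn H'.
by rewrite NegzE mulrNz !mulNr !cexpN -!pmulrn H'.
Qed.

Lemma mvt_bound (f f' : R -> R) (M x y : R) :
  (forall u : R, is_derive u (1 : R) f (f' u)) -> (forall u, `|f' u| <= M) ->
  `|f x - f y| <= M * `|x - y|.
Proof.
move=> df bf; wlog xy : x y / x <= y.
  move=> H; have [/H//|/ltW/H] := leP x y.
  by rewrite distrC (distrC x).
have cf : {within `[x, y], continuous f}.
  apply: continuous_subspaceT => u; apply: differentiable_continuous.
  by apply/derivable1_diffP; case: (df u).
have [c _ e] := MVT_segment xy (fun u _ => df u) cf.
by rewrite distrC e normrM (distrC x) ler_wpM2r.
Qed.

Lemma cexp_lip x y : modulus (cexp x - cexp y) <= `|x - y| *+ 2.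
Proof.
apply: (le_trans (ler_modulus_ReIm _)); rewrite cReD cImD cReN cImN /= mulr2n.
rewrite -[X in X + X]mul1r lerD//.
  apply: (@mvt_bound _ (fun u => - sin u)) => u.
  by rewrite normrN ler_norml sin_geN1 sin_le1.
apply: (@mvt_bound _ cos) => u.
by rewrite ler_norml cos_geN1 cos_le1.
Qed.

End Modulus.

#[global] Arguments modulus : simpl never.
#[global] Arguments cexp : simpl never.
#[global] Arguments conjc : simpl never.

Section RealAverage.
Context {R : realType}.
Implicit Types (f g : R -> R) (F G : R -> R[i]).
Local Notation mu := (@lebesgue_measure R).
Local Notation circle := (@circle R).

Definition bounded_meas f :=
  measurable_fun circle f /\ exists M : R, forall x, circle x -> `|f x| <= M.

Definition ravg f : R := (pi *+ 2)^-1 * \int[mu]_(x in circle) f x.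

Lemma pi2_gt0 : 0 < pi *+ 2 :> R.
Proof. by rewrite mulrn_wgt0// pi_gt0. Qed.

Lemma measurable_circle : measurable (circle : set R).
Proof. exact: measurable_itv. Qed.

Lemma lebesgue_circle : mu circle = (pi *+ 2)%:E.
Proof.
by rewrite /circle lebesgue_measure_itv/= lte_fin pi2_gt0 oppr0 adde0.
Qed.

Lemma bounded_meas_integrable f : bounded_meas f -> mu.-integrable circle (EFin \o f).
Proof.
move=> [mf [M fM]]; apply: measurable_bounded_integrable => //.
- exact: measurable_circle.
- have e := lebesgue_circle; rewrite /= in e *; by rewrite [ltLHS]e ltry.
- exists M; split; first exact: num_real.
  by move=> N MN x cx /=; rewrite (le_trans (fM _ cx))// ltW.
Qed.

Lemma bounded_measD f g : bounded_meas f -> bounded_meas g ->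
  bounded_meas (fun x => f x + g x).
Proof.
move=> [mf [M fM]] [mg [N gN]]; split; first exact: measurable_funD.
exists (M + N) => x cx; rewrite (le_trans (ler_normD _ _))// lerD ?fM ?gN//.
Qed.

Lemma bounded_measM f g : bounded_meas f -> bounded_meas g ->
  bounded_meas (fun x => f x * g x).
Proof.
move=> [mf [M fM]] [mg [N gN]]; split; first exact: measurable_funM.
by exists (M * N) => x cx; rewrite normrM ler_pM ?fM ?gN.
Qed.

Lemma bounded_meas_cst (c : R) : bounded_meas (fun=> c).
Proof. by split; [exact: measurable_cst|exists `|c|]. Qed.

Lemma bounded_measN f : bounded_meas f -> bounded_meas (fun x => - f x).
Proof.
move=> bf; rewrite (_ : (fun x => - f x) = fun x => (-1) * f x).
  by apply: bounded_measM => //; exact: bounded_meas_cst.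
by apply/funext => x; rewrite mulN1r.
Qed.

Lemma bounded_meas_continuous f : continuous f -> bounded_meas f.
Proof.
move=> cf; split.
  apply: (measurable_funS measurableT) => //; exact: continuous_measurable_fun.
have cwf : {within circle, continuous f} by exact: continuous_subspaceT.
have c01 : 0 <= pi *+ 2 :> R by exact: ltW pi2_gt0.
have [a _ fa] := EVT_max c01 cwf; have [b _ fb] := EVT_min c01 cwf.
exists (`|f a| + `|f b|) => x cx.
have := fa x cx; have := fb x cx; have := ler_norm (f a).
have := ler_norm (- f b); rewrite normrN; rewrite ler_norml.
have := normr_ge0 (f a); have := normr_ge0 (f b); lra.
Qed.

Lemma ravgD f g : bounded_meas f -> bounded_meas g ->
  ravg (fun x => f x + g x) = ravg f + ravg g.
Proof.
move=> bf bg; rewrite /ravg -mulrDr; congr (_ * _).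
apply: RintegralD; first exact: measurable_circle.
- exact: bounded_meas_integrable.
- exact: bounded_meas_integrable.
Qed.

Lemma ravgZ (c : R) f : bounded_meas f -> ravg (fun x => c * f x) = c * ravg f.
Proof.
move=> bf; rewrite /ravg mulrCA; congr (_ * _).
apply: RintegralZl; first exact: measurable_circle.
exact: bounded_meas_integrable.
Qed.

Lemma ravgN f : bounded_meas f -> ravg (fun x => - f x) = - ravg f.
Proof.
move=> bf; rewrite -mulN1r -ravgZ//; congr ravg; apply/funext => x.
by rewrite mulN1r.
Qed.

Lemma ravg_cst (c : R) : ravg (fun=> c) = c.
Proof.
rewrite /ravg Rintegral_cst; last exact: measurable_circle.
rewrite [fine _](_ : _ = pi *+ 2); last by rewrite -[RHS]/(fine _%:E) -lebesgue_circle.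
by rewrite mulrCA mulVf ?mulr1// gt_eqF ?pi2_gt0.
Qed.

Lemma le_ravg f g : bounded_meas f -> bounded_meas g ->
  (forall x, circle x -> f x <= g x) -> ravg f <= ravg g.
Proof.
move=> bf bg fg; rewrite /ravg ler_wpM2l ?invr_ge0 ?(ltW pi2_gt0)//.
apply: le_Rintegral => //.
- exact: measurable_circle.
- exact: bounded_meas_integrable.
- exact: bounded_meas_integrable.
Qed.

Lemma eq_ravg f g : (forall x, circle x -> f x = g x) -> ravg f = ravg g.
Proof.
by move=> fg; rewrite /ravg; congr (_ * _); apply: eq_Rintegral => x; rewrite inE => /fg.
Qed.

End RealAverage.

Section ComplexAverage.
Context {R : realType}.
Implicit Types (f g : R -> R[i]).
Local Notation circle := (@circle R).

Definition cbm f := bounded_meas (fun x => complex.Re (f x)) /\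
                    bounded_meas (fun x => complex.Im (f x)).

Definition avg f : R[i] := ((pi *+ 2)^-1)%:C * cintegral circle f.

Lemma avgE f : avg f = ravg (fun x => complex.Re (f x)) +i* ravg (fun x => complex.Im (f x)).
Proof.
apply: complex_ext; rewrite ?cReM ?cImM /= /ravg; ring.
Qed.

Lemma cbmD f g : cbm f -> cbm g -> cbm (fun x => f x + g x).
Proof.
move=> [? ?] [? ?]; split.
  by under eq_fun do rewrite cReD; exact: bounded_measD.
by under eq_fun do rewrite cImD; exact: bounded_measD.
Qed.

Lemma cbmM f g : cbm f -> cbm g -> cbm (fun x => f x * g x).
Proof.
move=> [? ?] [? ?]; split.
  under eq_fun do rewrite cReM; apply: bounded_measD; first exact: bounded_measM.
  by apply: bounded_measN; exact: bounded_measM.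
under eq_fun do rewrite cImM; apply: bounded_measD; exact: bounded_measM.
Qed.

Lemma cbm_cst (c : R[i]) : cbm (fun=> c).
Proof. by split; exact: bounded_meas_cst. Qed.

Lemma cbmN f : cbm f -> cbm (fun x => - f x).
Proof.
move=> [? ?]; split.
  by under eq_fun do rewrite cReN; exact: bounded_measN.
by under eq_fun do rewrite cImN; exact: bounded_measN.
Qed.

Lemma cbmB f g : cbm f -> cbm g -> cbm (fun x => f x - g x).
Proof. by move=> bf bg; apply: cbmD => //; exact: cbmN. Qed.

Lemma cbmJ f : cbm f -> cbm (fun x => conjc (f x)).
Proof.
move=> [? ?]; split; first by under eq_fun do rewrite cReJ.
by under eq_fun do rewrite cImJ; exact: bounded_measN.
Qed.

Lemma cbm_sum I (r : seq I) (F : I -> R -> R[i]) : (forall i, cbm (F i)) ->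
  cbm (fun x => \sum_(i <- r) F i x).
Proof.
move=> bF; elim: r => [|i r IH].
  by under eq_fun do rewrite big_nil; exact: cbm_cst.
by under eq_fun do rewrite big_cons; exact: cbmD.
Qed.

Lemma cbm_cexp (a : R) : cbm (fun x => cexp (a * x)).
Proof.
split; apply: bounded_meas_continuous => x /=; apply: continuous_comp.
- exact: mulrl_continuous.
- exact: continuous_cos.
- exact: mulrl_continuous.
- exact: continuous_sin.
Qed.

Lemma cbm_bound f : cbm f -> exists M : R, forall x, circle x -> modulus (f x) <= M.
Proof.
move=> [[_ [M fM]] [_ [N fN]]]; exists (M + N) => x cx.
by rewrite (le_trans (ler_modulus_ReIm _))// lerD ?fM ?fN.
Qed.

Lemma cbm_modulus f : cbm f -> bounded_meas (fun x => modulus (f x) ^+ 2).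
Proof.
move=> [bf1 bf2]; under eq_fun do rewrite modulus_sqr 2!expr2.
by apply: bounded_measD; exact: bounded_measM.
Qed.

Lemma avgD f g : cbm f -> cbm g -> avg (fun x => f x + g x) = avg f + avg g.
Proof.
move=> [? ?] [? ?]; rewrite !avgE; apply: complex_ext => /=.
  by rewrite -ravgD//; apply: eq_ravg => x _; rewrite cReD.
by rewrite -ravgD//; apply: eq_ravg => x _; rewrite cImD.
Qed.

Lemma avgZ (c : R[i]) f : cbm f -> avg (fun x => c * f x) = c * avg f.
Proof.
move=> [bf1 bf2]; have bZ (r : R) h : bounded_meas h -> bounded_meas (fun x => r * h x).
  by move=> bh; apply: bounded_measM => //; exact: bounded_meas_cst.
rewrite !avgE; apply: complex_ext; rewrite ?cReM ?cImM/= -!ravgZ// -?ravgN -?ravgD//;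
  do ?[apply: bZ|apply: bounded_measN|by []].
  by apply: eq_ravg => x _; rewrite cReM.
by apply: eq_ravg => x _; rewrite cImM.
Qed.

Lemma avgN f : cbm f -> avg (fun x => - f x) = - avg f.
Proof.
move=> bf; rewrite -mulN1r -avgZ//; congr avg; apply/funext => x.
by rewrite mulN1r.
Qed.

Lemma avgB f g : cbm f -> cbm g -> avg (fun x => f x - g x) = avg f - avg g.
Proof. by move=> bf bg; rewrite avgD ?avgN//; exact: cbmN. Qed.

Lemma avg_cst (c : R[i]) : avg (fun=> c) = c.
Proof. by rewrite avgE !ravg_cst; case: c. Qed.

Lemma avg_sum I (r : seq I) (F : I -> R -> R[i]) : (forall i, cbm (F i)) ->
  avg (fun x => \sum_(i <- r) F i x) = \sum_(i <- r) avg (F i).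
Proof.
move=> bF; elim: r => [|i r IH].
  by under eq_fun do rewrite big_nil; rewrite avg_cst big_nil.
under eq_fun do rewrite big_cons; rewrite big_cons avgD ?IH//; exact: cbm_sum.
Qed.

Lemma avgJ f : cbm f -> avg (fun x => conjc (f x)) = conjc (avg f).
Proof.
move=> [bf1 bf2]; rewrite !avgE; apply: complex_ext => /=.
  by apply: eq_ravg => x _; rewrite cReJ.
by rewrite -ravgN//; apply: eq_ravg => x _; rewrite cImJ.
Qed.

Lemma eq_avg f g : (forall x, circle x -> f x = g x) -> avg f = avg g.
Proof.
by move=> fg; rewrite !avgE; congr (_ +i* _); apply: eq_ravg => x /fg ->.
Qed.

Lemma avg_bound f (M : R) : cbm f -> (forall x, circle x -> modulus (f x) <= M) ->
  modulus (avg f) <= M.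
Proof.
move=> bf fM; have [w w1 e] := exists_phase (avg f).
suff : complex.Re (w * avg f) <= M by rewrite e.
rewrite -avgZ// avgE/= -[leRHS]ravg_cst; apply: le_ravg => //.
- by case: (cbmM (cbm_cst w) bf).
- exact: bounded_meas_cst.
- move=> x cx; apply: (le_trans (ler_norm _)); apply: (le_trans (ler_Re_modulus _)).
  by rewrite modulusM w1 mul1r fM.
Qed.

(* [cexp (k x)] is the derivative of a periodic function. *)
Lemma avg_cexp (k : int) : k != 0 -> avg (fun x => cexp (k%:~R * x)) = 0.
Proof.
move=> k0; have kR0 : k%:~R != 0 :> R by rewrite intr_eq0.
suff H (f f' : R -> R) : (forall x, is_derive x (1 : R) f (f' x)) -> continuous f' ->
    f (pi *+ 2) = f 0 -> ravg f' = 0.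
  rewrite avgE/=; congr (_ +i* _).
    apply: (H (fun x => k%:~R^-1 * sin (k%:~R * x))).
    - move=> x; apply: is_derive_eq; rewrite /GRing.scale/=; field; exact: kR0.
    - move=> x; apply: continuous_comp; first exact: mulrl_continuous.
      exact: continuous_cos.
    - have := cexp_int2pi k (0 : R); rewrite add0r mulr0 => /(congr1 (@complex.Im R))/= ->.
      by [].
  apply: (H (fun x => - k%:~R^-1 * cos (k%:~R * x))).
  - move=> x; apply: is_derive_eq; rewrite /GRing.scale/=; field; exact: kR0.
  - move=> x; apply: continuous_comp; first exact: mulrl_continuous.
    exact: continuous_sin.
  - have := cexp_int2pi k (0 : R); rewrite add0r mulr0 => /(congr1 (@complex.Re R))/= ->.
    by [].
move=> df cf' ff; rewrite /ravg /Rintegral (@continuous_FTC2 _ _ f).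
- by rewrite ff subee// mulr0.
- exact: pi2_gt0.
- exact: continuous_subspaceT.
- have cf : continuous f.
    by move=> u; apply/differentiable_continuous/derivable1_diffP; case: (df u).
  split.
  + by move=> x _; case: (df x).
  + exact/cvg_at_right_filter/cf.
  + exact/cvg_at_left_filter/cf.
- by move=> x _; rewrite derive1E; case: (df x).
Qed.

End ComplexAverage.

(** * Fourier series and the Wiener algebra *)

Section FourierCoefficients.
Context {R : realType}.
Implicit Types (f g : R -> R[i]) (j k : int) (x : R).
Local Notation circle := (@circle R).

Definition ek k x : R[i] := cexp (k%:~R * x).

Local Arguments ek : simpl never.
Lemma cbm_ek k : cbm (ek k).
Proof. exact: cbm_cexp. Qed.

Lemma modulus_ek k x : modulus (ek k x) = 1.
Proof. exact: modulus_cexp. Qed.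

Lemma ekD j k x : ek (j + k) x = ek j x * ek k x.
Proof. by rewrite /ek rmorphD/= mulrDl cexpD. Qed.

Lemma ekN k x : ek (- k) x = cexp (- (k%:~R * x)).
Proof. by rewrite /ek mulrNz mulNr. Qed.

Lemma ekJ k x : conjc (ek k x) = ek (- k) x.
Proof. by rewrite ekN cexpN. Qed.

Lemma ek0 x : ek 0 x = 1.
Proof. by rewrite /ek mul0r cexp0. Qed.

Lemma ek_at0 k : ek k 0 = 1.
Proof. by rewrite /ek mulr0 cexp0. Qed.

Lemma ek_periodic k x : ek k (x + pi *+ 2) = ek k x.
Proof. exact: cexp_int2pi. Qed.

Lemma fourier_coefE f k : fourier_coef f k = avg (fun x => f x * ek (- k) x).
Proof. by rewrite /fourier_coef /avg; under eq_fun do rewrite -ekN. Qed.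

Lemma eq_fourier_coef f g k : (forall x, circle x -> f x = g x) ->
  fourier_coef f k = fourier_coef g k.
Proof. by move=> fg; rewrite !fourier_coefE; apply: eq_avg => x /fg ->. Qed.

Lemma fourier_coefD f g k : cbm f -> cbm g ->
  fourier_coef (fun x => f x + g x) k = fourier_coef f k + fourier_coef g k.
Proof.
move=> bf bg; rewrite !fourier_coefE -avgD; last 2 first.
- by apply: cbmM => //; exact: cbm_ek.
- by apply: cbmM => //; exact: cbm_ek.
by apply: eq_avg => x _; rewrite mulrDl.
Qed.

Lemma fourier_coefZ (c : R[i]) f k : cbm f ->
  fourier_coef (fun x => c * f x) k = c * fourier_coef f k.
Proof.
move=> bf; rewrite !fourier_coefE -avgZ; last exact/cbmM/cbm_ek.
by apply: eq_avg => x _; rewrite mulrA.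
Qed.

Lemma fourier_coefB f g k : cbm f -> cbm g ->
  fourier_coef (fun x => f x - g x) k = fourier_coef f k - fourier_coef g k.
Proof.
move=> bf bg; rewrite !fourier_coefE -avgB; last 2 first.
- by apply: cbmM => //; exact: cbm_ek.
- by apply: cbmM => //; exact: cbm_ek.
by apply: eq_avg => x _; rewrite mulrBl.
Qed.

Lemma fourier_coef_sum I (r : seq I) (F : I -> R -> R[i]) k : (forall i, cbm (F i)) ->
  fourier_coef (fun x => \sum_(i <- r) F i x) k = \sum_(i <- r) fourier_coef (F i) k.
Proof.
move=> bF; rewrite fourier_coefE (eq_bigr _ (fun i _ => fourier_coefE _ _)) -avg_sum.
  by apply: eq_avg => x _; rewrite mulr_suml.
by move=> i; exact/cbmM/cbm_ek.
Qed.

Lemma fourier_coefJ f k : cbm f ->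
  fourier_coef (fun x => conjc (f x)) k = conjc (fourier_coef f (- k)).
Proof.
move=> bf; rewrite !fourier_coefE -avgJ; last exact/cbmM/cbm_ek.
by apply: eq_avg => x _; rewrite conjcM ekJ opprK.
Qed.

Lemma fourier_coef_bound f (M : R) k : cbm f ->
  (forall x, circle x -> modulus (f x) <= M) -> modulus (fourier_coef f k) <= M.
Proof.
move=> bf fM; rewrite fourier_coefE; apply: avg_bound; first exact/cbmM/cbm_ek.
by move=> x cx; rewrite modulusM modulus_ek mulr1 fM.
Qed.

Lemma fourier_coef_ekM f j k : cbm f ->
  fourier_coef (fun x => ek j x * f x) k = fourier_coef f (k - j).
Proof.
move=> bf; rewrite !fourier_coefE; apply: eq_avg => x _.
by rewrite mulrAC mulrC -ekD opprB.
Qed.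

Lemma avg_ek k : avg (ek k) = (k == 0)%:R :> R[i].
Proof.
have [->|k0] := eqVneq k 0; last exact: avg_cexp.
by rewrite -[RHS](avg_cst 1); apply: eq_avg => x _; rewrite ek0.
Qed.

Lemma fourier_coef_ek j k : fourier_coef (ek j) k = (j == k)%:R :> R[i].
Proof.
rewrite fourier_coefE -[j == k]subr_eq0 -avg_ek; apply: eq_avg => x _.
by rewrite -ekD.
Qed.

Lemma fourier_coef_trig (s : seq int) (a : int -> R[i]) k : uniq s ->
  fourier_coef (fun x => \sum_(j <- s) a j * ek j x) k = if k \in s then a k else 0.
Proof.
move=> us; rewrite fourier_coef_sum => [|j]; last first.
  by apply: cbmM; [exact: cbm_cst|exact: cbm_ek].
rewrite (eq_bigr (fun j => if j == k then a j else 0)) => [|j _]; last first.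
  rewrite fourier_coefZ; last exact: cbm_ek.
  by rewrite fourier_coef_ek; case: ifP => _; rewrite ?mulr1 ?mulr0.
rewrite -big_mkcond -big_filter; case: ifPn => ks.
  by rewrite filter_pred1_uniq// big_seq1.
by rewrite (@eq_in_filter _ _ pred0) ?filter_pred0 ?big_nil// => j js; apply: contraNF ks => /eqP <-.
Qed.

Lemma bessel g (M : R) (s : seq int) : uniq s -> cbm g ->
  (forall x, circle x -> modulus (g x) <= M) ->
  \sum_(k <- s) modulus (fourier_coef g k) ^+ 2 <= M ^+ 2.
Proof.
move=> us bg gM; set a := fourier_coef g; set B := \sum_(k <- s) _.
pose h x := \sum_(k <- s) a k * ek k x.
have bh : cbm h by apply: cbm_sum => k; exact/cbmM/cbm_ek/cbm_cst.
have avgh f : cbm f -> avg (fun x => conjc (h x) * f x) =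
    \sum_(k <- s) conjc (a k) * fourier_coef f k.
  move=> bf; rewrite (eq_bigr (fun k => avg (fun x => conjc (a k) * (f x * ek (- k) x)))).
    rewrite -avg_sum => [|k]; last by apply: cbmM; [exact: cbm_cst|exact/cbmM/cbm_ek].
    apply: eq_avg => x _; rewrite conjc_sum mulr_suml; apply: eq_bigr => k _.
    by rewrite conjcM ekJ -mulrA; congr (_ * _); rewrite mulrC.
  by move=> k _; rewrite avgZ ?fourier_coefE//; exact/cbmM/cbm_ek.
have sumB : \sum_(k <- s) conjc (a k) * a k = B%:C.
  by rewrite rmorph_sum/=; apply: eq_bigr => k _; rewrite mulrC mul_conjc.
have e1 : avg (fun x => conjc (h x) * g x) = B%:C by rewrite avgh.
have e2 : avg (fun x => conjc (h x) * h x) = B%:C.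
  rewrite avgh// -sumB [LHS]big_seq [RHS]big_seq; apply: eq_bigr => k ks.
  by rewrite fourier_coef_trig// ks.
have bJh := cbmJ bh.
have bb : cbm (fun x => 2%:R * (conjc (h x) * g x) - conjc (h x) * h x).
  by apply: cbmB; [apply: cbmM; [exact: cbm_cst|exact: cbmM]|exact: cbmM].
have : complex.Re (avg (fun x => 2%:R * (conjc (h x) * g x) - conjc (h x) * h x)) <= M ^+ 2.
  rewrite avgE/= -[leRHS]ravg_cst; apply: le_ravg; first by case: bb.
    exact: bounded_meas_cst.
  move=> x cx; have : complex.Re (g x) ^+ 2 + complex.Im (g x) ^+ 2 <= M ^+ 2.
    by rewrite -modulus_sqr lerXn2r ?nnegrE ?gM// ?(le_trans _ (gM _ cx))// modulus_ge0.
  rewrite mulrDl mul1r cReD cReN cReD !cReM !cReJ !cImJ.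
  have := sqr_ge0 (complex.Re (g x) - complex.Re (h x)).
  have := sqr_ge0 (complex.Im (g x) - complex.Im (h x)).
  rewrite !expr2; set a1 := complex.Re _; set a2 := complex.Im _; nra.
rewrite avgB; last 2 first.
- by apply: cbmM; [exact: cbm_cst|exact: cbmM].
- exact: cbmM.
rewrite avgZ ?e1 ?e2; last exact: cbmM.
by rewrite mulrDl mul1r cReD cReN cReD/= addrK.
Qed.

Lemma fourier_coef_cvg0 g : cbm g -> forall e : R, 0 < e ->
  \forall n \near \oo, modulus (fourier_coef g (Posz n)) < e /\
                       modulus (fourier_coef g (Negz n)) < e.
Proof.
move=> bg e e0; have [M gM] := cbm_bound bg.
have key (c : nat -> int) : injective c ->
    \forall n \near \oo, modulus (fourier_coef g (c n)) < e.
  move=> ic; pose u n : R := modulus (fourier_coef g (c n)) ^+ 2.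
  have cu : cvgn (series u).
    apply: nondecreasing_is_cvgn.
      by apply: nondecreasing_series => n _ _; rewrite sqr_ge0.
    exists (M ^+ 2) => _ [n _ <-]; rewrite /series/= /u.
    rewrite -(big_map c xpredT (fun k => modulus (fourier_coef g k) ^+ 2)).
    by apply: bessel => //; rewrite map_inj_uniq// iota_uniq.
  have /cvgrPdist_lt /(_ (e ^+ 2) (exprn_gt0 2 e0)) := cvg_series_cvg_0 cu.
  apply: filterS => n; rewrite sub0r normrN ger0_norm ?sqr_ge0//.
  by rewrite /u ltr_pXn2r// nnegrE ?modulus_ge0 ?ltW.
near=> n; split.
  by near: n; apply: key => m n [].
by near: n; apply: key => m n [].
Unshelve. all: by end_near. Qed.

End FourierCoefficients.
#[global] Arguments ek {R} k x : simpl never.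

Section SymmetricRange.
Implicit Types (N : nat) (k : int).

Definition zrange N : seq int := [seq (Posz j - Posz N)%R | j <- iota 0 N.*2.+1].

Lemma zrange_uniq N : uniq (zrange N).
Proof. by rewrite map_inj_uniq ?iota_uniq// => i j /addIr[]. Qed.

Lemma mem_zrange N k : (k \in zrange N) = (`|k| <= N)%N.
Proof.
apply/mapP/idP => [[j]|kN]; first by rewrite mem_iota => jN ->; lia.
exists (absz (k + Posz N)%R); last by lia.
by rewrite mem_iota; lia.
Qed.

Lemma big_zrangeS (V : nmodType) (F : int -> V) N :
  \sum_(k <- zrange N.+1) F k = F (Posz N.+1) + (F (- Posz N.+1) + \sum_(k <- zrange N) F k).
Proof.
have pe : perm_eq (zrange N.+1) (Posz N.+1 :: - Posz N.+1 :: zrange N).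
  apply: uniq_perm; first exact: zrange_uniq.
    rewrite cons_uniq cons_uniq zrange_uniq in_cons !mem_zrange andbT; apply/andP; split; lia.
  move=> k; rewrite mem_zrange in_cons in_cons mem_zrange; lia.
by rewrite (perm_big _ pe) big_cons big_cons.
Qed.

Lemma zpartialE (R : realType) (F : int -> R[i]) N :
  zpartial F N = \sum_(k <- zrange N) F k.
Proof. by rewrite /zpartial big_map -(big_mkord xpredT (fun j : nat => F (j%:Z - N%:Z))) /index_iota subn0. Qed.

Lemma sum_zrange_telescope (V : zmodType) (G : int -> V) N :
  \sum_(k <- zrange N) (G (k - 1) - G k) = G (- (Posz N) - 1) - G (Posz N).
Proof.
rewrite big_map -[iota _ _]/(iota 0 (N.*2.+1 - 0)).
pose f j := - G (Posz j - 1 - Posz N).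
rewrite (eq_bigr (fun j => f j.+1 - f j)) => [|j _]; last first.
  by rewrite /f opprK [RHS]addrC; congr (G _ - G _); lia.
rewrite -/(index_iota 0 N.*2.+1) telescope_sumr// /f opprK [LHS]addrC; congr (G _ - G _); lia.
Qed.

End SymmetricRange.

Section Inversion.
Context {R : realType}.
Implicit Types (f g : R -> R[i]) (j k : int) (x : R).
Local Notation circle := (@circle R).

Lemma derivable_lip_near (h : R -> R) x : derivable h x 1 ->
  exists2 L : R, 0 <= L & \forall t \near (0 : R), `|h (x + t) - h x| <= L * `|t|.
Proof.
move=> /cvg_ex[l /=]; rewrite -[_ --> _]/(_ @ _ --> l) => hl.
exists (`|l| + 1); first by rewrite addr_ge0.
have /cvgrPdist_lt /(_ 1 ltr01) := hl.
rewrite /dnbhs => /nbhs_ballP[d /= d0 H].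
apply/nbhs_ballP; exists d => //= t td.
have [->|t0] := eqVneq t 0; first by rewrite addr0 subrr !normr0 mulr0.
have := H t td t0; rewrite [t *: 1](mulr1 t) [t + x]addrC => lt1.
have : `|t^-1 *: (h (x + t) - h x)| <= `|l| + 1.
  rewrite -lerBlDl; apply: le_trans (ltW lt1).
  by rewrite distrC; exact: lerB_dist.
rewrite normrZ normfV mulrC ler_pdivrMr ?normr_gt0//.
Qed.

Lemma sin_lower : exists2 d : R, 0 < d < pi & forall t, `|t| <= d -> `|t| / 2 <= `|sin t|.
Proof.
have : derivable (@sin R) 0 1 by [].
have /cvgrPdist_lt /(_ 2^-1) : (fun h : R => h^-1 *: ((@sin R \o shift 0) (h *: 1) - sin 0)) @ 0^' --> (1 : R).
  have d0 : is_derive (0 : R) (1 : R) (@sin R) (cos 0) by exact: is_derive_sin.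
  rewrite cos0 in d0; have [dd e] := d0; rewrite -[X in _ --> X]e; exact: dd.
rewrite invr_gt0 ltr0n => /(_ isT); rewrite /dnbhs => /nbhs_ballP[d /= d0 H] _.
exists (Num.min (d / 2) (pi / 2)).
  rewrite lt_min !divr_gt0 ?pi_gt0//= gt_min; apply/orP; right.
  by rewrite ltr_pdivrMr// ltr_pMr ?pi_gt0// ltr1n.
move=> t td; have [->|t0] := eqVneq t 0; first by rewrite normr0 mul0r.
have td' : ball (0 : R) d t.
  rewrite /ball/= sub0r normrN (le_lt_trans td)// gt_min; apply/orP; left.
  by rewrite ltr_pdivrMr// ltr_pMr// ltr1n.
have := H t td' t0; rewrite /= addr0 sin0 subr0 [t *: 1](mulr1 t) => lt1.
have : 2^-1 <= `|t^-1 * sin t|.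
  have := ler_norm (1 - t^-1 * sin t); have := ler_norm (t^-1 * sin t).
  have : `|1 - t^-1 * sin t| < 2^-1 by exact: lt1.
  lra.
rewrite normrM normfV mulrC ler_pdivlMr ?normr_gt0//.
by rewrite mulrC.
Qed.

Lemma difference_quotient_bounded f x : periodic2pi f -> cbm f -> cderivable f x ->
  circle x -> exists2 B : R, 0 <= B &
    forall y, circle y -> modulus (f y - f x) <= B * modulus (cexp (y - x) - 1).
Proof.
move=> pf bf [dr di] cx.
have [L1 L10 near1] := derivable_lip_near dr; have [L2 L20 near2] := derivable_lip_near di.
have [d1 /andP[d10 d1pi] sinb] := sin_lower.
have : \forall t \near (0 : R), modulus (f (x + t) - f x) <= (L1 + L2) * `|t|.
  near=> t; apply: (le_trans (ler_modulus_ReIm _)).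
  by rewrite cReD cReN cImD cImN mulrDl lerD//; near: t.
move=> /nbhs_ballP[d2 /= d20 lip]; pose d := Num.min d1 (d2 / 2).
have d0 : 0 < d by rewrite lt_min d10 divr_gt0.
have dpi : d < pi by rewrite gt_min d1pi.
have [M fM] := cbm_bound bf.
have M0 : 0 <= M by apply: le_trans (fM _ cx); exact: modulus_ge0.
have cd0 : 0 < 1 - cos d.
  rewrite subr_gt0 -[ltRHS]cos0 ltr_cos// in_itv/= ?lexx ?ltW ?pi_gt0//.
pose B := (L1 + L2) * 2 + (M *+ 2) / (1 - cos d).
have M2 : 0 <= (M *+ 2) / (1 - cos d) by rewrite divr_ge0 ?mulrn_wge0// ltW.
have B0 : 0 <= B by rewrite /B addr_ge0// mulr_ge0// addr_ge0.
have key t : `|t| <= pi -> modulus (f (x + t) - f x) <= M *+ 2 ->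
    modulus (f (x + t) - f x) <= B * modulus (cexp t - 1).
  move=> tpi fM2; have [td|td] := leP `|t| d.
    have tb : ball (0 : R) d2 t.
      rewrite /ball/= sub0r normrN (le_lt_trans td)// gt_min; apply/orP; right.
      by rewrite ltr_pdivrMr// ltr_pMr// ltr1n.
    apply: (le_trans (lip t tb)).
    have s1 : `|t| / 2 <= modulus (cexp t - 1).
      apply: le_trans (ler_Im_modulus _); rewrite cImD cImN/= oppr0 addr0.
      by apply: sinb; rewrite (le_trans td)// ge_min lexx.
    apply: (@le_trans _ _ ((L1 + L2) * 2 * modulus (cexp t - 1))).
      by rewrite -mulrA ler_wpM2l ?addr_ge0// mulrC -ler_pdivrMr.
    by rewrite ler_wpM2r ?modulus_ge0// lerDl.
  have c1 : 1 - cos d <= modulus (cexp t - 1).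
    rewrite modulusBC; apply: le_trans (ler_Re_modulus _); rewrite cReD cReN/=.
    apply: le_trans (ler_norm _); rewrite lerD2l lerN2 -(cos_norm t) leNgt.
    by rewrite ltr_cos ?in_itv/= ?normr_ge0 ?tpi ?(ltW d0) ?(ltW dpi)// -leNgt ltW.
  apply: (le_trans fM2).
  apply: (@le_trans _ _ ((M *+ 2) / (1 - cos d) * modulus (cexp t - 1))).
    rewrite -mulrA ler_peMr ?mulrn_wge0//.
    by rewrite mulrC ler_pdivlMr// mul1r.
  by rewrite ler_wpM2r ?modulus_ge0// lerDr mulr_ge0// addr_ge0.
exists B => // y cy.
have fxy : modulus (f y - f x) <= M *+ 2.
  by rewrite (le_trans (ler_modulusB _ _))// mulr2n lerD ?fM.
move: (cx) (cy); rewrite /circle/= !in_itv/= => /andP[x0 x2] /andP[y0 y2].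
rewrite mulr2n in x2 y2.
have [h1|h1] := leP `|y - x| pi.
  have ef : f (x + (y - x)) = f y by congr f; ring.
  by rewrite -ef; apply: key; rewrite ?ef.
have [xy|yx] := leP x y.
  have ef : f (x + (y - x - pi *+ 2)) = f y by rewrite -pf; congr f; ring.
  have -> : cexp (y - x) = cexp (y - x - pi *+ 2) by rewrite -[RHS]cexp2pi subrK.
  rewrite -ef; apply: key; last by rewrite ef.
  have : pi < y - x by rewrite -[ltRHS]ger0_norm// subr_ge0.
  rewrite ler_norml mulr2n => ?; apply/andP; split; lra.
have ef : f (x + (y - x + pi *+ 2)) = f y by rewrite -(pf y); congr f; ring.
rewrite -(cexp2pi (y - x)) -ef; apply: key; last by rewrite ef.
have : pi < x - y by rewrite -[ltRHS]ger0_norm ?subr_ge0 ?ltW// distrC.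
rewrite ler_norml mulr2n => ?; apply/andP; split; lra.
Unshelve. all: by end_near. Qed.

Lemma cbm_inv_cexpB1 f x (B : R) : cbm f ->
  (forall y, circle y -> modulus (f y) <= B * modulus (cexp (y - x) - 1)) -> 0 <= B ->
  cbm (fun y => f y / (cexp (y - x) - 1)).
Proof.
move=> bf fB B0; pose den y := cexp (y - x) - 1.
have bd : cbm den.
  apply: cbmB; last exact: cbm_cst.
  rewrite (_ : (fun y => _) = fun y => cexp (1 * y) * cexp (- x)).
    by apply: cbmM; [exact: cbm_cexp|exact: cbm_cst].
  by apply/funext => y; rewrite mul1r cexpD.
have bN y : circle y -> modulus (f y / den y) <= B.
  move=> cy; have [d0|d0] := eqVneq (den y) 0.
    by rewrite d0 invr0 mulr0 modulus0.
  have m0 : 0 < modulus (den y).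
    by rewrite lt_neqAle modulus_ge0 andbT eq_sym; apply: contra_neq d0; exact: modulus_eq0.
  by rewrite modulusM modulusV ler_pdivrMr// fB.
have inv_den y : (den y)^-1 = ((modulus (den y) ^+ 2) `^ (-1))%:C * conjc (den y).
  rewrite powR_inv1 ?sqr_ge0//; have [->|d0] := eqVneq (den y) 0.
    by rewrite invr0 conjc0 mulr0.
  apply: (mulfI d0); rewrite mulfV// mulrCA mul_conjc -rmorphM/= mulVf//.
  by rewrite sqrf_eq0; apply: contra_neq d0; exact: modulus_eq0.
have mpow : measurable_fun circle (fun y => (modulus (den y) ^+ 2) `^ (-1)).
  apply: (measurableT_comp (measurable_powR _)).
  by case: (cbm_modulus bd).
have mre h : cbm h -> measurable_fun circle (fun y => complex.Re (h y)) by move=> [[]].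
have mim h : cbm h -> measurable_fun circle (fun y => complex.Im (h y)) by move=> [_ []].
have bfd : cbm (fun y => f y * conjc (den y)) by apply: cbmM => //; exact: cbmJ.
have e y : f y / den y = ((modulus (den y) ^+ 2) `^ (-1))%:C * (f y * conjc (den y)).
  by rewrite inv_den mulrCA.
split; split.
- under eq_fun do rewrite e cReM/= mul0r subr0.
  apply: measurable_funM => //; exact: mre.
- by exists B => y cy; rewrite (le_trans (ler_Re_modulus _))// bN.
- under eq_fun do rewrite e cImM/= mul0r addr0.
  apply: measurable_funM => //; exact: mim.
- by exists B => y cy; rewrite (le_trans (ler_Im_modulus _))// bN.
Qed.

(* Chernoff's argument: [f - f x = g * (e^(i(y-x)) - 1)] with [g] bounded, so
   that the Fourier series of [f - f x] at [x] telescopes. *)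
Lemma fourier_inversion_circle f x : periodic2pi f -> cbm f -> cderivable f x ->
  circle x -> zsum_to (fun k => fourier_coef f k * ek k x) (f x).
Proof.
move=> pf bf df cx; have [B B0 fB] := difference_quotient_bounded pf bf df cx.
have bh : cbm (fun y => f y - f x) by apply: cbmB => //; exact: cbm_cst.
have bg := cbm_inv_cexpB1 bh fB B0; set g := (fun y => _ / _) in bg.
have fg y : circle y -> f y - f x = g y * (ek 1 y * ek (- 1) x - 1).
  move=> cy; rewrite /g; have -> : ek 1 y * ek (- 1) x = cexp (y - x).
    by rewrite ekN /ek !mul1r -cexpD.
  have [d0|d0] := eqVneq (cexp (y - x) - 1) 0; last by rewrite divfK.
  rewrite d0 mulr0; apply: modulus_eq0; apply/eqP; rewrite eq_le modulus_ge0 andbT.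
  by have := fB y cy; rewrite d0 modulus0 mulr0.
pose G k := fourier_coef g k * ek k x.
have step k : fourier_coef f k * ek k x = (k == 0)%:R * f x + (G (k - 1) - G k).
  have e1 : fourier_coef (fun y => f y - f x) k = fourier_coef f k - (k == 0)%:R * f x.
    rewrite fourier_coefB//; last exact: cbm_cst; congr (_ - _).
    rewrite (@eq_fourier_coef _ _ (fun y => f x * ek 0 y)) => [|y _].
      by rewrite fourier_coefZ; [rewrite fourier_coef_ek mulrC eq_sym|exact: cbm_ek].
    by rewrite ek0 mulr1.
  have e2 : fourier_coef (fun y => f y - f x) k =
      ek (- 1) x * fourier_coef g (k - 1) - fourier_coef g k.
    rewrite (@eq_fourier_coef _ _ (fun y => ek (- 1) x * (ek 1 y * g y) - g y)) => [|y cy].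
      rewrite fourier_coefB//; last first.
        by apply: cbmM; [exact: cbm_cst|apply: cbmM => //; exact: cbm_ek].
      rewrite fourier_coefZ; last by apply: cbmM => //; exact: cbm_ek.
      by rewrite fourier_coef_ekM.
    by rewrite fg//; ring.
  have e3 : ek k x = ek (k - 1) x * ek 1 x by rewrite -ekD subrK.
  have e4 : ek (- 1) x * ek 1 x = 1 by rewrite -ekD addNr ek0.
  have -> : fourier_coef f k = ek (- 1) x * fourier_coef g (k - 1) - fourier_coef g k
      + (k == 0)%:R * f x.
    by rewrite -e2 e1 subrK.
  rewrite mulrDl mulrBl addrC /G; congr (_ + (_ - _)).
    by have [->|] := eqVneq k 0; rewrite ?ek0 ?mulr1 ?mul0r.
  by rewrite e3 -[RHS]mulr1 -e4; ring.
have part N : zpartial (fun k => fourier_coef f k * ek k x) N - f x =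
    G (- Posz N - 1) - G (Posz N).
  rewrite zpartialE (eq_bigr _ (fun k _ => step k)) big_split/= sum_zrange_telescope.
  rewrite -mulr_suml (_ : \sum_(k <- zrange N) _ = 1) ?mul1r; first by rewrite addrAC subrr add0r.
  rewrite (bigD1_seq 0) ?zrange_uniq ?mem_zrange//= big1 ?addr0// => k /negPf -> //.
rewrite /zsum_to; apply/cvgrPdist_lt => e e0.
have e20 : 0 < e / 2 by rewrite divr_gt0.
have nearE := fourier_coef_cvg0 bg e20.
near=> N; rewrite sub0r normrN ger0_norm ?modulus_ge0// part.
apply: (le_lt_trans (ler_modulusB _ _)); rewrite /G !(modulusM (fourier_coef _ _)) !modulus_ek !mulr1.
have -> : - Posz N - 1 = Negz N :> int by lia.
have [h1 h2] : modulus (fourier_coef g (Posz N)) < e / 2 /\ modulus (fourier_coef g (Negz N)) < e / 2.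
  by near: N.
by rewrite [ltRHS]splitr ltrD.
Unshelve. all: by end_near. Qed.

Lemma circle_representative x : exists2 y, circle y &
  forall h : R -> R[i], periodic2pi h -> h x = h y.
Proof.
have p0 := @pi2_gt0 R; pose m := Num.floor (x / (pi *+ 2)).
exists (x - m%:~R * (pi *+ 2)).
  have /andP[m1 m2] := floor_itv (x / (pi *+ 2)).
  rewrite /circle/= in_itv/= subr_ge0 -ler_pdivlMr// m1/= lerBlDr.
  rewrite -{1}[pi *+ 2]mul1r -mulrDl -ler_pdivrMr//.
  by rewrite addrC ltW// -intrD1.
move=> h ph; have H (n : nat) z : h (z + n%:R * (pi *+ 2)) = h z.
  elim: n => [|n IH]; first by rewrite mul0r addr0.
  by rewrite -addn1 natrD mulrDl mul1r addrA ph IH.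
case: m => n; first by rewrite -[in RHS](H n) subrK.
by rewrite NegzE mulrNz mulNr opprK H.
Qed.

Lemma fourier_inversion f : periodic2pi f -> cbm f -> (forall x, cderivable f x) ->
  forall x, zsum_to (fun k => fourier_coef f k * ek k x) (f x).
Proof.
move=> pf bf df x; have [y cy xy] := circle_representative x.
rewrite (xy f pf) (_ : (fun k => _) = fun k => fourier_coef f k * ek k y).
  exact: fourier_inversion_circle.
apply/funext => k; rewrite (xy (ek k))// => z; exact: ek_periodic.
Qed.

End Inversion.

Section FiniteSums.
Context {R : realType}.
Implicit Types (s : seq int) (k : int).

Lemma sum_uniq_subset (V : nmodType) s1 s2 (F : int -> V) : uniq s1 -> uniq s2 ->
  {subset s1 <= s2} ->
  \sum_(k <- s2) F k = \sum_(k <- s1) F k + \sum_(k <- s2 | k \notin s1) F k.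
Proof.
move=> u1 u2 s12; rewrite (bigID (mem s1))/=; congr (_ + _).
rewrite -big_filter; apply/perm_big/uniq_perm => //; first exact: filter_uniq.
by move=> k; rewrite mem_filter; apply/andP/idP => [[]//|k1]; split; rewrite ?s12.
Qed.

Lemma le_sum_uniq_subset s1 s2 (F : int -> R) : uniq s1 -> uniq s2 ->
  {subset s1 <= s2} -> (forall k, 0 <= F k) ->
  \sum_(k <- s1) F k <= \sum_(k <- s2) F k.
Proof.
by move=> u1 u2 s12 F0; rewrite (sum_uniq_subset _ u1 u2 s12) lerDl sumr_ge0.
Qed.

Lemma seq_int_bounded s : exists N : nat, {subset s <= zrange N}.
Proof.
exists (\max_(k <- s) `|k|)%N => k ks; rewrite mem_zrange.
by rewrite (big_rem k)//= leq_maxl.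
Qed.

Definition l1le (h : int -> R[i]) (B : R) :=
  forall s, uniq s -> \sum_(k <- s) modulus (h k) <= B.

Lemma l1le_ge0 h B : l1le h B -> 0 <= B.
Proof. by move=> /(_ [::] isT); rewrite big_nil. Qed.

Lemma l1le_trans h (A B : R) : A <= B -> l1le h A -> l1le h B.
Proof. by move=> AB hA s us; exact: le_trans (hA s us) AB. Qed.

Lemma l1le_le h g B : (forall k, modulus (h k) <= modulus (g k)) -> l1le g B -> l1le h B.
Proof. by move=> hg gB s us; apply: le_trans (gB s us); exact: ler_sum. Qed.

Lemma l1leD h g (A B : R) : l1le h A -> l1le g B -> l1le (fun k => h k + g k) (A + B).
Proof.
move=> hA gB s us; apply: le_trans (lerD (hA s us) (gB s us)).
by rewrite -big_split/=; apply: ler_sum => k _; exact: ler_modulusD.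
Qed.

Lemma l1le_tail h B : l1le h B -> forall e : R, 0 < e ->
  exists N : nat, forall s, uniq s -> (forall k, k \in s -> k \notin zrange N) ->
    \sum_(k <- s) modulus (h k) <= e.
Proof.
move=> hB e e0; pose A := [set x : R | exists2 s, uniq s & x = \sum_(k <- s) modulus (h k)].
have hA : has_sup A.
  split; first by exists 0, [::]; rewrite ?big_nil.
  by exists B => _ [s us ->]; exact: hB.
have [_ [s0 us0 ->] As0] := sup_adherent e0 hA.
have [N sN] := seq_int_bounded s0; exists N => s us sdisj.
have ucat : uniq (s0 ++ s).
  rewrite cat_uniq us0 us andbT; apply/hasPn => k ks; apply/negP => ks0.
  by have := sdisj k ks; rewrite sN.
have : \sum_(k <- s0 ++ s) modulus (h k) <= sup A by apply: ub_le_sup; [case: hA|exists (s0 ++ s)].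
rewrite big_cat/=; lra.
Qed.

Lemma zsum_to_tail (F : int -> R[i]) (G : int -> R) z (N n : nat) (e : R) :
  (forall s, uniq s -> (forall k, k \in s -> k \notin zrange N) ->
    \sum_(k <- s) G k <= e) ->
  (forall k, modulus (F k) <= G k) ->
  zsum_to F z -> (N <= n)%N ->
  modulus (z - \sum_(k <- zrange n) F k) <= e.
Proof.
move=> Gtail FG Fz Nn; apply/ler_addgt0Pr => d d0.
have /cvgrPdist_lt /(_ d d0) := Fz.
move=> [M0 _ /(_ (maxn M0 n))]; rewrite /= leq_maxl => /(_ isT).
set M := maxn _ _; rewrite sub0r normrN ger0_norm ?modulus_ge0// zpartialE => hM.
have nM : {subset zrange n <= zrange M}.
  by move=> k; rewrite !mem_zrange => kn; rewrite (leq_trans kn)// leq_maxr.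
rewrite (sum_uniq_subset _ (zrange_uniq n) (zrange_uniq M) nM) in hM.
set r := \sum_(_ <- _ | _ \notin _) _ in hM.
have -> : z - \sum_(k <- zrange n) F k = r - (\sum_(k <- zrange n) F k + r - z) by ring.
apply: (le_trans (ler_modulusB _ _)); rewrite lerD// ?(ltW hM)//.
rewrite /r -big_filter; apply: (le_trans (ler_modulus_sum _ _ _)).
apply: (le_trans (ler_sum _ (fun k _ => FG k))).
apply: Gtail; first by rewrite filter_uniq// zrange_uniq.
move=> k; rewrite mem_filter; case/andP => /= kn _; apply: contra kn.
by rewrite !mem_zrange => kN; rewrite (leq_trans kN).
Qed.

Lemma zsum_toB (F G : int -> R[i]) z w : zsum_to F z -> zsum_to G w ->
  zsum_to (fun k => F k - G k) (z - w).
Proof.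
move=> Fz Gw; apply/cvgrPdist_lt => e e0; have e20 : 0 < e / 2 by rewrite divr_gt0.
have /cvgrPdist_lt /(_ _ e20) Fn := Fz; have /cvgrPdist_lt /(_ _ e20) Gn := Gw.
near=> N; rewrite sub0r normrN ger0_norm ?modulus_ge0//.
have FN : modulus (zpartial F N - z) < e / 2.
  rewrite -[ltLHS]ger0_norm ?modulus_ge0// -normrN -sub0r; near: N; exact: Fn.
have GN : modulus (zpartial G N - w) < e / 2.
  rewrite -[ltLHS]ger0_norm ?modulus_ge0// -normrN -sub0r; near: N; exact: Gn.
rewrite !zpartialE in FN GN *; rewrite sumrB.
have -> : \sum_(i <- zrange N) F i - \sum_(i <- zrange N) G i - (z - w) =
  (\sum_(i <- zrange N) F i - z) - (\sum_(i <- zrange N) G i - w) by ring.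
by rewrite (le_lt_trans (ler_modulusB _ _))// [ltRHS]splitr ltrD.
Unshelve. all: by end_near. Qed.

Lemma modulus_mul_unit (z w : R[i]) : modulus w = 1 -> modulus (z * w) = modulus z.
Proof. by rewrite modulusM => ->; rewrite mulr1. Qed.

Lemma zsum_to_bound h (c : int -> R[i]) z (B : R) : l1le h B ->
  (forall k, modulus (c k) = 1) -> zsum_to (fun k => h k * c k) z -> modulus z <= B.
Proof.
move=> hB c1 hz; apply/ler_addgt0Pr => e e0; have [N hN] := l1le_tail hB e0.
have hc k : modulus (h k * c k) <= modulus (h k) by rewrite modulus_mul_unit.
have := zsum_to_tail hN hc hz (leqnn N) => le1.
rewrite -[z](subrK (\sum_(k <- zrange N) h k * c k)) addrC.
apply: (le_trans (ler_modulusD _ _)); rewrite lerD//.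
apply: (le_trans (ler_modulus_sum _ _ _)).
rewrite (eq_bigr (fun k => modulus (h k))) => [|k _]; last by rewrite modulusM c1 mulr1.
by apply: hB; exact: zrange_uniq.
Qed.

End FiniteSums.

Section WienerAlgebra.
Context {R : realType}.
Implicit Types (f g : R -> R[i]) (j k : int) (x : R) (A B : R).
Local Notation circle := (@circle R).

Definition smooth f := periodic2pi f /\ forall x, cderivable f x.

Lemma smooth_cbm f : smooth f -> cbm f.
Proof.
move=> [_ df]; split; apply: bounded_meas_continuous => x.
  by apply/differentiable_continuous/derivable1_diffP; case: (df x).
by apply/differentiable_continuous/derivable1_diffP; case: (df x).
Qed.

Lemma smoothJ f : smooth f -> smooth (fun x => conjc (f x)).
Proof.
move=> [pf df]; split=> [x|x]; first by rewrite pf.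
have [dr di] := df x; split.
  by rewrite (_ : (fun y => _) = (fun y => complex.Re (f y)))//; apply/funext => y; rewrite cReJ.
rewrite (_ : (fun y => _) = - (fun y => complex.Im (f y))); first exact: derivableN.
by apply/funext => y; rewrite cImJ.
Qed.

Lemma smoothB f g : smooth f -> smooth g -> smooth (fun x => f x - g x).
Proof.
move=> [pf df] [pg dg]; split=> [x|x]; first by rewrite pf pg.
have [dr di] := df x; have [er ei] := dg x; split.
  rewrite (_ : (fun y => _) = (fun y => complex.Re (f y)) - (fun y => complex.Re (g y))).
    exact: derivableB.
  by apply/funext => y; rewrite cReD cReN.
rewrite (_ : (fun y => _) = (fun y => complex.Im (f y)) - (fun y => complex.Im (g y))).
  exact: derivableB.
by apply/funext => y; rewrite cImD cImN.
Qed.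

Definition wiener f B := smooth f /\ l1le (fourier_coef f) B.

Lemma wiener_zsum f B x : wiener f B -> zsum_to (fun k => fourier_coef f k * ek k x) (f x).
Proof. by move=> [sf _]; apply: fourier_inversion; [case: sf|exact: smooth_cbm|case: sf]. Qed.

Lemma wiener_sup f B x : wiener f B -> modulus (f x) <= B.
Proof.
move=> wf; apply: (zsum_to_bound (proj2 wf) _ (wiener_zsum x wf)) => k.
exact: modulus_ek.
Qed.

Lemma wienerJ f B : wiener f B -> wiener (fun x => conjc (f x)) B.
Proof.
move=> [sf fB]; split; first exact: smoothJ.
move=> s us; rewrite (eq_bigr (fun k => modulus (fourier_coef f (- k)))) => [|k _].
  rewrite -(big_map (fun k => - k) xpredT (fun k => modulus (fourier_coef f k))).
  by apply: fB; rewrite map_inj_uniq//; exact: oppr_inj.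
by rewrite fourier_coefJ ?modulusJ//; exact: smooth_cbm.
Qed.

Lemma l1le_fourier_coefM f g A B : wiener f A -> cbm g -> l1le (fourier_coef g) B ->
  l1le (fourier_coef (fun x => f x * g x)) (A * B).
Proof.
move=> wf bg gB s us; have [[pf df] fA] := wf; have bf := smooth_cbm (proj1 wf).
have [M gM] := cbm_bound bg.
have M0 : 0 <= M by apply: le_trans (gM 0 _); rewrite ?modulus_ge0// /circle/= in_itv/= lexx ltW ?pi2_gt0.
apply/ler_addgt0Pr => e e0; pose e' := e / ((size s)%:R * M + 1).
have d0 : 0 < (size s)%:R * M + 1 by rewrite ltr_wpDl// mulr_ge0.
have e'0 : 0 < e' by rewrite divr_gt0.
have [N fN] := l1le_tail fA e'0.
pose fn x := \sum_(j <- zrange N) fourier_coef f j * ek j x.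
have bfn : cbm fn by apply: cbm_sum => j; exact/cbmM/cbm_ek/cbm_cst.
have close k : modulus (fourier_coef (fun x => f x * g x) k -
    fourier_coef (fun x => fn x * g x) k) <= e' * M.
  rewrite -fourier_coefB; [|exact: cbmM|exact: cbmM].
  apply: fourier_coef_bound; first by apply: cbmB; exact: cbmM.
  move=> x cx; rewrite -mulrBl modulusM ler_pM ?modulus_ge0// ?gM//.
  apply: (zsum_to_tail fN _ (wiener_zsum x wf) (leqnn N)) => k'.
  by rewrite modulus_mul_unit// modulus_ek.
have coefn k : fourier_coef (fun x => fn x * g x) k =
    \sum_(j <- zrange N) fourier_coef f j * fourier_coef g (k - j).
  rewrite (@eq_fourier_coef _ _ (fun x => \sum_(j <- zrange N) fourier_coef f j * (ek j x * g x))).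
    rewrite fourier_coef_sum => [|j]; last by apply: cbmM; [exact: cbm_cst|apply: cbmM => //; exact: cbm_ek].
    apply: eq_bigr => j _; rewrite fourier_coefZ ?fourier_coef_ekM//.
    by apply: cbmM => //; exact: cbm_ek.
  by move=> x _; rewrite mulr_suml; apply: eq_bigr => j _; rewrite mulrA.
have main : \sum_(k <- s) modulus (fourier_coef (fun x => fn x * g x) k) <= A * B.
  apply: (@le_trans _ _ (\sum_(k <- s) \sum_(j <- zrange N)
      modulus (fourier_coef f j) * modulus (fourier_coef g (k - j)))).
    apply: ler_sum => k _; rewrite coefn; apply: (le_trans (ler_modulus_sum _ _ _)).
    by apply: ler_sum => j _; rewrite -modulusM.
  rewrite exchange_big/=; apply: (@le_trans _ _ (\sum_(j <- zrange N) modulus (fourier_coef f j) * B)).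
    apply: ler_sum => j _; rewrite -mulr_sumr ler_wpM2l ?modulus_ge0//.
    rewrite -(big_map (fun k => k - j) xpredT (fun k => modulus (fourier_coef g k))).
    by apply: gB; rewrite map_inj_uniq// => i i' /addIr.
  rewrite -mulr_suml ler_wpM2r ?(l1le_ge0 gB)//.
  by apply: fA; exact: zrange_uniq.
apply: (@le_trans _ _ (\sum_(k <- s) (modulus (fourier_coef (fun x => fn x * g x) k) + e' * M))).
  apply: ler_sum => k _; rewrite -lerBlDl (le_trans _ (close k))//.
  exact: ler_dist_modulus.
rewrite big_split/= lerD// big_const_seq count_predT iter_addr_0 -mulr_natl mulrCA /e'.
rewrite mulrAC ler_pdivrMr// ler_wpM2l ?(ltW e0)// lerDl//.
Qed.

Lemma fourier_coef_of_zsum f (h : int -> R[i]) B k : cbm f -> l1le h B ->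
  (forall x, circle x -> zsum_to (fun k => h k * ek k x) (f x)) -> fourier_coef f k = h k.
Proof.
move=> bf hB hf; apply/eqP; rewrite -subr_eq0; apply/eqP/modulus_eq0/eqP.
rewrite eq_le modulus_ge0 andbT; apply/ler_addgt0Pr => e e0; rewrite add0r.
have [N hN] := l1le_tail hB e0; pose n := maxn N `|k|%N.
have -> : h k = fourier_coef (fun x => \sum_(j <- zrange n) h j * ek j x) k.
  by rewrite fourier_coef_trig ?zrange_uniq// mem_zrange leq_maxr.
have bn : cbm (fun x => \sum_(j <- zrange n) h j * ek j x).
  by apply: cbm_sum => j; exact/cbmM/cbm_ek/cbm_cst.
rewrite -fourier_coefB//; apply: fourier_coef_bound; first exact: cbmB.
move=> x cx; apply: (zsum_to_tail hN _ (hf x cx)); last exact: leq_maxl.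
by move=> j; rewrite modulus_mul_unit// modulus_ek.
Qed.

End WienerAlgebra.

Section ComplexDerivative.
Context {R : realType}.
Implicit Types (f g : R -> R[i]) (x : R) (l : R[i]).

Definition is_cderive f x l :=
  is_derive x (1 : R) (fun y => complex.Re (f y)) (complex.Re l) /\
  is_derive x (1 : R) (fun y => complex.Im (f y)) (complex.Im l).

Lemma cderivable_is_cderive f x : cderivable f x -> is_cderive f x (cderive f x).
Proof.
by move=> [dr di]; split; rewrite /cderive /= derive1E; exact: derivableP.
Qed.

Lemma is_cderive_cderivable f x l : is_cderive f x l -> cderivable f x.
Proof. by move=> [[? _] [? _]]. Qed.

Lemma is_cderive_eq f x l l' : is_cderive f x l -> l = l' -> is_cderive f x l'.
Proof. by move=> ? <-. Qed.

Lemma is_cderive_ext f g x l : (forall y, f y = g y) -> is_cderive f x l -> is_cderive g x l.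
Proof. by move=> /funext ->. Qed.

Lemma is_cderive_cst (c : R[i]) x : is_cderive (fun=> c) x 0.
Proof. by split; exact: is_derive_cst. Qed.

Lemma is_cderiveD f g x l m : is_cderive f x l -> is_cderive g x m ->
  is_cderive (fun y => f y + g y) x (l + m).
Proof.
move=> [fr fi] [gr gi]; split; rewrite ?cReD ?cImD.
  by under eq_fun do rewrite cReD; exact: is_deriveD.
by under eq_fun do rewrite cImD; exact: is_deriveD.
Qed.

Lemma is_cderiveM f g x l m : is_cderive f x l -> is_cderive g x m ->
  is_cderive (fun y => f y * g y) x (f x * m + l * g x).
Proof.
move=> [fr fi] [gr gi]; split.
  under eq_fun do rewrite cReM.
  by apply: is_derive_eq; rewrite cReD !cReM /GRing.scale/=; ring.
under eq_fun do rewrite cImM.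
by apply: is_derive_eq; rewrite cImD !cImM /GRing.scale/=; ring.
Qed.

Lemma is_cderiveZ (c : R[i]) f x l : is_cderive f x l -> is_cderive (fun y => c * f y) x (c * l).
Proof.
move=> df; apply: (is_cderive_eq (is_cderiveM (is_cderive_cst c x) df)).
by rewrite mul0r addr0.
Qed.

Lemma is_cderiveB f g x l m : is_cderive f x l -> is_cderive g x m ->
  is_cderive (fun y => f y - g y) x (l - m).
Proof.
move=> df dg; apply: (@is_cderive_ext (fun y => f y + (-1) * g y)) => [y|].
  by rewrite mulN1r.
by apply: (is_cderive_eq (is_cderiveD df (is_cderiveZ (-1) dg))); rewrite mulN1r.
Qed.

Lemma is_cderive_sum I (r : seq I) (F : I -> R -> R[i]) (L : I -> R[i]) x :
  (forall i, is_cderive (F i) x (L i)) ->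
  is_cderive (fun y => \sum_(i <- r) F i y) x (\sum_(i <- r) L i).
Proof.
move=> dF; elim: r => [|i r IH].
  by rewrite big_nil; apply: (is_cderive_ext _ (is_cderive_cst 0 x)) => y; rewrite big_nil.
rewrite big_cons; apply: (is_cderive_ext _ (is_cderiveD (dF i) IH)) => y.
by rewrite big_cons.
Qed.

Lemma is_cderive_cexp (a x : R) :
  is_cderive (fun y => cexp (a * y)) x (Complex 0 a * cexp (a * x)).
Proof.
split; rewrite /cexp /=; apply: is_derive_eq; rewrite /GRing.scale/=; ring.
Qed.

Lemma is_derive_bound (g : R -> R) x (l L : R) : is_derive x (1 : R) g l ->
  (forall a, `|g (x + a) - g x| <= L * `|a|) -> `|l| <= L.
Proof.
move=> [dg e] gL; apply/ler_addgt0Pr => d d0.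
have := dg; rewrite /derivable -/(derive g x 1) e => /cvgrPdist_lt /(_ d d0).
rewrite /dnbhs => /nbhs_ballP[r /= r0 H].
have r20 : r / 2 != 0 by rewrite gt_eqF// divr_gt0.
have br : ball (0 : R) r (r / 2).
  by rewrite /ball/= sub0r normrN ger0_norm ?divr_ge0 ?ltW// ltr_pdivrMr// ltr_pMr// ltr1n.
have := H _ br r20; rewrite [(r / 2) *: 1](mulr1 (r / 2)) [r / 2 + x]addrC => lt1.
have q : `|(r / 2)^-1 *: (g (x + r / 2) - g x)| <= L.
  by rewrite normrZ normfV mulrC ler_pdivrMr ?normr_gt0.
rewrite -[l](subrK ((r / 2)^-1 *: (g (x + r / 2) - g x))).
by rewrite (le_trans (ler_normD _ _))// addrC lerD// ltW.
Qed.

Lemma is_derive_shift (g : R -> R) x y (l : R) : is_derive (x + y) (1 : R) g l ->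
  is_derive y (1 : R) (fun z => g (x + z)) l.
Proof.
move=> dg; have d1 : is_derive y (1 : R) (fun z : R => x + z) 1.
  have := is_deriveD (is_derive_cst (x : R) y 1) (is_derive_id y (1 : R)).
  by rewrite add0r.
have := @is_derive1_comp _ g (fun z : R => x + z) y l 1 dg d1.
by rewrite mulr1.
Qed.

Lemma second_derivative_bound (h h1 : R -> R) x (h2 L : R) :
  (forall y, is_derive y (1 : R) h (h1 y)) -> is_derive x (1 : R) h1 h2 ->
  (forall y z a, `|h (y + a) - h y - (h (z + a) - h z)| <= L * `|y - z| * `|a|) ->
  `|h2| <= L.
Proof.
move=> dh dh1 hL; apply: (is_derive_bound dh1) => a.
have := hL (x + a) x; rewrite addrAC subrr add0r => H.
pose phi z := h (x + a + z) - h (x + z).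
apply: (@is_derive_bound phi 0).
  apply: is_deriveB; apply: is_derive_shift; rewrite addr0; exact: dh.
move=> b; rewrite /phi add0r !addr0; apply: le_trans (H b).
by rewrite le_eqVlt; apply/orP; left; apply/eqP; congr (`|_|); ring.
Qed.

End ComplexDerivative.

Section SecondDerivative.
Context {R : realType}.
Implicit Types (f : R -> R[i]) (x y a : R) (k : int).

Lemma is_cderive_ek k x : is_cderive (ek k) x (Complex 0 k%:~R * ek k x).
Proof. exact: is_cderive_cexp. Qed.

Lemma second_difference_ek k x y a :
  modulus (ek k (x + a) - ek k x - (ek k (y + a) - ek k y)) <=
  (k%:~R ^+ 2 *+ 4) * `|x - y| * `|a|.
Proof.
have eD (u v : R) : ek k (u + v) = ek k u * ek k v by rewrite /ek mulrDr cexpD.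
have -> : ek k (x + a) - ek k x - (ek k (y + a) - ek k y) =
    (ek k a - ek k 0) * (ek k x - ek k y).
  by rewrite !eD ek_at0; ring.
have lip (u v : R) : modulus (ek k u - ek k v) <= `|k%:~R| * `|u - v| *+ 2.
  by rewrite (le_trans (cexp_lip _ _))// -mulrBr normrM.
have := lip a 0; rewrite subr0 => la; have := lip x y => lxy.
rewrite modulusM (le_trans (ler_pM (modulus_ge0 _) (modulus_ge0 _) la lxy))//.
rewrite -(real_normK (num_real (k%:~R : R))) le_eqVlt; apply/orP; left; apply/eqP; ring.
Qed.

Variables (f f1 f2 : R -> R[i]) (B : R).
Hypothesis wf : smooth f.
Hypothesis df : forall x, is_cderive f x (f1 x).
Hypothesis df1 : forall x, is_cderive f1 x (f2 x).
Hypothesis fB : l1le (fun k => (k%:~R ^+ 2)%:C * fourier_coef f k) B.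

Lemma second_derivative_tail (N : nat) (e : R) x :
  (forall s, uniq s -> (forall k, k \in s -> k \notin zrange N) ->
    \sum_(k <- s) modulus ((k%:~R ^+ 2)%:C * fourier_coef f k) <= e) ->
  modulus (f2 x + \sum_(k <- zrange N) (k%:~R ^+ 2)%:C * fourier_coef f k * ek k x) <= e *+ 8.
Proof.
move=> tailN; pose a k := fourier_coef f k.
pose h y := f y - \sum_(k <- zrange N) a k * ek k y.
pose h1 y := f1 y - \sum_(k <- zrange N) a k * (Complex 0 k%:~R * ek k y).
pose h2 := f2 x - \sum_(k <- zrange N) a k * (Complex 0 k%:~R * (Complex 0 k%:~R * ek k x)).
have dh y : is_cderive h y (h1 y).
  by apply: is_cderiveB => //; apply: is_cderive_sum => k; apply/is_cderiveZ/is_cderive_ek.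
have dh1 : is_cderive h1 x h2.
  by apply: is_cderiveB => //; apply: is_cderive_sum => k; apply/is_cderiveZ/is_cderiveZ/is_cderive_ek.
have -> : f2 x + \sum_(k <- zrange N) (k%:~R ^+ 2)%:C * fourier_coef f k * ek k x = h2.
  rewrite /h2 -sumrN; congr (_ + _); apply: eq_bigr => k _.
  have -> : (k%:~R ^+ 2)%:C = - (Complex 0 k%:~R * Complex 0 k%:~R) :> R[i].
    by apply: complex_ext; rewrite ?cReN ?cImN ?cReM ?cImM/=; ring.
  rewrite /a; ring.
have key y z b : modulus (h (y + b) - h y - (h (z + b) - h z)) <= (e *+ 4) * `|y - z| * `|b|.
  pose E k := ek k (y + b) - ek k y - (ek k (z + b) - ek k z).
  have zs u := fourier_inversion (proj1 wf) (smooth_cbm wf) (proj2 wf) u.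
  have zE := zsum_toB (zsum_toB (zs (y + b)) (zs y)) (zsum_toB (zs (z + b)) (zs z)).
  have -> : h (y + b) - h y - (h (z + b) - h z) =
      (f (y + b) - f y - (f (z + b) - f z)) - \sum_(k <- zrange N) a k * E k.
    have -> : \sum_(k <- zrange N) a k * E k =
      \sum_(k <- zrange N) a k * ek k (y + b) - \sum_(k <- zrange N) a k * ek k y -
      (\sum_(k <- zrange N) a k * ek k (z + b) - \sum_(k <- zrange N) a k * ek k z).
      by rewrite -!sumrB; apply: eq_bigr => k _; rewrite /E; ring.
    rewrite /h; ring.
  rewrite (eq_bigr (fun k => fourier_coef f k * ek k (y + b) - fourier_coef f k * ek k y -
    (fourier_coef f k * ek k (z + b) - fourier_coef f k * ek k z))) => [|k _]; last first.
    by rewrite /E /a; ring.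
  have c0 : 0 <= `|y - z| * `|b| *+ 4 by rewrite mulrn_wge0// mulr_ge0.
  apply: (@zsum_to_tail _ _ (fun k =>
    modulus ((k%:~R ^+ 2)%:C * fourier_coef f k) * (`|y - z| * `|b| *+ 4)) _ N N) => //.
    move=> s us sN; rewrite -mulr_suml.
    apply: (le_trans (ler_wpM2r c0 (tailN s us sN))).
    by rewrite le_eqVlt; apply/orP; left; apply/eqP; ring.
  move=> k; have -> : fourier_coef f k * ek k (y + b) - fourier_coef f k * ek k y -
    (fourier_coef f k * ek k (z + b) - fourier_coef f k * ek k z) = fourier_coef f k * E k.
    by rewrite /E; ring.
  rewrite (modulusM _ (E k)) (modulusM _ (fourier_coef f k)) modulusR (ger0_norm (sqr_ge0 _)).
  apply: (le_trans (ler_wpM2l (modulus_ge0 _) (second_difference_ek k y z b))).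
  by rewrite le_eqVlt; apply/orP; left; apply/eqP; ring.
have bRe : `|complex.Re h2| <= e *+ 4.
  apply: (@second_derivative_bound _ (fun y => complex.Re (h y)) (fun y => complex.Re (h1 y)) x).
  - by move=> y; case: (dh y).
  - by case: dh1.
  - move=> y z b; apply: le_trans (key y z b); apply: le_trans (ler_Re_modulus _).
    by rewrite !(cReD, cReN).
have bIm : `|complex.Im h2| <= e *+ 4.
  apply: (@second_derivative_bound _ (fun y => complex.Im (h y)) (fun y => complex.Im (h1 y)) x).
  - by move=> y; case: (dh y).
  - by case: dh1.
  - move=> y z b; apply: le_trans (key y z b); apply: le_trans (ler_Im_modulus _).
    by rewrite !(cImD, cImN).
apply: (le_trans (ler_modulus_ReIm _)); rewrite (_ : e *+ 8 = e *+ 4 + e *+ 4) ?lerD//.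
by rewrite -mulrnDr.
Qed.

Lemma second_derivative_sup x : modulus (f2 x) <= B *+ 8.
Proof.

have tail s : uniq s -> (forall k, k \in s -> k \notin zrange 0) ->
    \sum_(k <- s) modulus ((k%:~R ^+ 2)%:C * fourier_coef f k) <= B.
  by move=> us _; exact: fB.
have := second_derivative_tail x tail.
rewrite /zrange/= big_seq1 subrr expr0n/= !mul0r addr0.
by [].  
Qed.

Lemma cbm_second_derivative : cbm f2.
Proof.
pose p N x := - \sum_(k <- zrange N) (k%:~R ^+ 2)%:C * fourier_coef f k * ek k x.
have bp N : cbm (p N).
  apply: cbmN; apply: cbm_sum => k; apply: cbmM; last exact: cbm_ek.
  by apply: cbmM; exact: cbm_cst.
have close x (e : R) : 0 < e -> \forall N \near \oo, modulus (f2 x - p N x) <= e.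
  move=> e0; have e80 : 0 < e / 8%:R by rewrite divr_gt0.
  have [N HN] := l1le_tail fB e80; exists N => // M /= NM.
  rewrite /p opprK (_ : e = (e / 8%:R) *+ 8); last by rewrite -mulr_natr divfK.
  apply: second_derivative_tail => s us sM; apply: HN => // k /sM.
  by apply: contra; rewrite !mem_zrange => /leq_trans; exact.
have cvgRe x : complex.Re (p N x) @[N --> \oo] --> complex.Re (f2 x).
  apply/cvgrPdist_le => e e0; have := close x e e0; apply: filterS => N.
  by apply: le_trans; rewrite -cReN -cReD ler_Re_modulus.
have cvgIm x : complex.Im (p N x) @[N --> \oo] --> complex.Im (f2 x).
  apply/cvgrPdist_le => e e0; have := close x e e0; apply: filterS => N.
  by apply: le_trans; rewrite -cImN -cImD ler_Im_modulus.
split; split.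
- apply: (@measurable_fun_cvg _ _ _ _ (fun N x => complex.Re (p N x))).
    by move=> N; case: (bp N) => [[]].
  by move=> x _; exact: cvgRe.
- by exists (B *+ 8) => x _; rewrite (le_trans (ler_Re_modulus _))// second_derivative_sup.
- apply: (@measurable_fun_cvg _ _ _ _ (fun N x => complex.Im (p N x))).
    by move=> N; case: (bp N) => [_ []].
  by move=> x _; exact: cvgIm.
- by exists (B *+ 8) => x _; rewrite (le_trans (ler_Im_modulus _))// second_derivative_sup.
Qed.

Lemma fourier_coef_second_derivative k :
  fourier_coef f2 k = - ((k%:~R ^+ 2)%:C * fourier_coef f k).
Proof.
apply/eqP; rewrite -subr_eq0 opprK; apply/eqP/modulus_eq0/eqP.
rewrite eq_le modulus_ge0 andbT; apply/ler_addgt0Pr => e e0; rewrite add0r.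
have e80 : 0 < e / 8%:R by rewrite divr_gt0.
have [N HN] := l1le_tail fB e80; pose M := maxn N `|k|%N.
pose q x := \sum_(j <- zrange M) (j%:~R ^+ 2)%:C * fourier_coef f j * ek j x.
have bq : cbm q.
  apply: cbm_sum => j; apply: cbmM; last exact: cbm_ek.
  by apply: cbmM; exact: cbm_cst.
have -> : (k%:~R ^+ 2)%:C * fourier_coef f k = fourier_coef q k.
  rewrite (@fourier_coef_trig _ _ (fun j => (j%:~R ^+ 2)%:C * fourier_coef f j)) ?zrange_uniq//.
  by rewrite mem_zrange leq_maxr.
rewrite -fourier_coefD//; last exact: cbm_second_derivative.
apply: fourier_coef_bound; first by apply: cbmD => //; exact: cbm_second_derivative.
move=> x _; rewrite (_ : e = (e / 8%:R) *+ 8); last by rewrite -mulr_natr divfK.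
apply: second_derivative_tail => s us sM; apply: HN => // j /sM.
by apply: contra; rewrite !mem_zrange => /leq_trans; apply; rewrite leq_maxl.
Qed.

End SecondDerivative.

(** * The Schroedinger equation in Fourier modes *)

Section Sobolev.
Context {R : realType}.
Implicit Types (f : R -> R[i]) (k : int) (x B : R).

Definition jap k : R := 1 + k%:~R ^+ 2.

Lemma jap_ge1 k : 1 <= jap k.
Proof. by rewrite /jap lerDl sqr_ge0. Qed.

Lemma jap_gt0 k : 0 < jap k.
Proof. exact: lt_le_trans ltr01 (jap_ge1 k). Qed.

Lemma sum_jap_inv2 (s : seq int) : uniq s -> \sum_(k <- s) (jap k)^-1 ^+ 2 <= 3.
Proof.
move=> us; have [N sN] := seq_int_bounded s.
apply: (@le_trans _ _ (\sum_(k <- zrange N) (jap k)^-1 ^+ 2)).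
  apply: le_sum_uniq_subset => // [|k]; [exact: zrange_uniq|exact: sqr_ge0].
suff : \sum_(k <- zrange N) (jap k)^-1 ^+ 2 <= 3 - 2 / N.+1%:R :> R.
  move=> /le_trans; apply; by rewrite lerBlDr lerDl divr_ge0.
elim: N {sN} => [|N IH].
  rewrite /zrange/= big_seq1 subrr /jap expr0n/= addr0 invr1 expr1n; lra.
rewrite big_zrangeS.
have e : jap (- Posz N.+1) = jap (Posz N.+1) by rewrite /jap mulrNz sqrrN.
rewrite e; have n1 : 1 <= N.+1%:R :> R by rewrite ler1n.
have -> : N.+2%:R = N.+1%:R + 1 :> R by rewrite -(natr1 N.+1).
have -> : jap (Posz N.+1) = 1 + N.+1%:R ^+ 2 by [].
move: IH n1; set n : R := N.+1%:R; move=> IH n1.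
suff : (1 + n ^+ 2)^-1 ^+ 2 <= n^-1 - (n + 1)^-1.
  move: IH; set X := \sum_(_ <- _) _; set Y := _^-1 ^+ 2; set a := n^-1; set b := (n + 1)^-1.
  lra.
have -> : n^-1 - (n + 1)^-1 = (n * (n + 1))^-1 by field; apply/andP; split; lra.
rewrite exprVn lef_pV2 ?posrE; nra.
Qed.

Lemma l1le_of_sobolev f B (lam : R) : 0 < lam -> (sobolev_norm2 4 f <= B%:E)%E ->
  l1le (fun k => (jap k)%:C * fourier_coef f k) ((lam * B + 3 / lam) / 2).
Proof.
move=> l0 fB s us.
have sB : \sum_(k <- s) (jap k ^+ 2 * modulus (fourier_coef f k)) ^+ 2 <= B.
  rewrite -lee_fin; apply: le_trans fB; apply: esum_ge; exists [set` s].
    by split => //; exact: finite_seq.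
  rewrite -fsbig_seq// sumEFin lee_fin; apply: ler_sum => k _.
  by rewrite (powR_mulrn 4) ?(ltW (jap_gt0 k))// exprMn -exprM.
apply: (@le_trans _ _ (\sum_(k <- s) (lam / 2 * (jap k ^+ 2 * modulus (fourier_coef f k)) ^+ 2
   + (lam * 2)^-1 * (jap k)^-1 ^+ 2))).
  apply: ler_sum => k _; rewrite (modulusM _ (fourier_coef f k)) modulusR (gtr0_norm (jap_gt0 k)).
  set w := jap k; set m := modulus _; have w0 : 0 < w := jap_gt0 k.
  have := sqr_ge0 (lam * (w ^+ 2 * m) - w^-1) => H.
  have -> : w * m = (w ^+ 2 * m) * w^-1 by field; lra.
  have -> : lam / 2 * (w ^+ 2 * m) ^+ 2 + (lam * 2)^-1 * w^-1 ^+ 2 =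
    (w ^+ 2 * m) * w^-1 + (lam * 2)^-1 * (lam * (w ^+ 2 * m) - w^-1) ^+ 2.
    by field; apply/andP; split; lra.
  by rewrite lerDl mulr_ge0// invr_ge0 mulr_ge0// ltW.
rewrite big_split/= -!mulr_sumr.
have := sum_jap_inv2 us; move: sB; set X := \sum_(_ <- _) _; set Y := \sum_(_ <- _) _ => XB Y3.
have -> : (lam * B + 3 / lam) / 2 = lam / 2 * B + (lam * 2)^-1 * 3 by field; lra.
rewrite lerD// ler_wpM2l//; first by rewrite divr_ge0// ltW.
by rewrite invr_ge0 mulr_ge0// ltW.
Qed.

Lemma l1le_jap (h : int -> R[i]) B : l1le (fun k => (jap k)%:C * h k) B -> l1le h B.
Proof.
apply: l1le_le => k; rewrite modulusM modulusR (gtr0_norm (jap_gt0 k)).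
by rewrite ler_peMl ?modulus_ge0// jap_ge1.
Qed.

Lemma l1le_jap_sqr (h : int -> R[i]) B :
  l1le (fun k => (jap k)%:C * h k) B -> l1le (fun k => (k%:~R ^+ 2)%:C * h k) B.
Proof.
apply: l1le_le => k; rewrite !modulusM !modulusR (gtr0_norm (jap_gt0 k)).
by rewrite ger0_norm ?sqr_ge0// ler_wpM2r ?modulus_ge0// /jap lerDr.
Qed.

End Sobolev.

Section NLSModes.
Context {R : realType}.
Variables (eps : R) (u : R -> R -> R[i]).
Hypothesis sol : nls_solution eps u.
Implicit Types (t x : R) (k : int).

Definition cubic (f : R -> R[i]) x : R[i] := f x * (conjc (f x) * f x).

Lemma nls_smooth t : smooth (u t).
Proof.
have [H _ dd _] := sol; split; first by case: (H 0 (lexx _) t).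
by move=> x; case: (dd t x).
Qed.

Lemma nls_jap t : exists B, l1le (fun k => (jap k)%:C * fourier_coef (u t) k) B.
Proof.
have [H _ _ _] := sol; have [_ _] := H 4 (ler0n _ _) t.
case E : (sobolev_norm2 4 (u t)) => [B| |]// _.
  by eexists; apply: (l1le_of_sobolev ltr01 (B := B)); rewrite E.
exists ((1 * 0 + 3 / 1) / 2); apply: (l1le_of_sobolev ltr01); by rewrite E leNye.
Qed.

Lemma nls_jap_continuous t0 (e : R) : 0 < e -> \forall t \near t0,
  l1le (fun k => (jap k)%:C * fourier_coef (fun x => u t x - u t0 x) k) e.
Proof.
move=> e0; have [_ cts _ _] := sol; have := cts 4 (ler0n _ _) t0.
pose lam := 3 / e; pose B := e ^+ 2 / 3.
have l0 : 0 < lam by rewrite divr_gt0.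
have B0 : 0 < B by rewrite divr_gt0// exprn_gt0.
move=> /(_ [set z | (z <= B%:E)%E]); have nb : nbhs (0%E : \bar R) [set z | (z <= B%:E)%E].
  exists B => // y /=; rewrite sub0r normrN => /ltW yB.
  by rewrite lee_fin (le_trans (ler_norm _)).
move=> /(_ nb) near_le.
have {near_le} : \forall t \near t0, (sobolev_norm2 4 (fun x => u t x - u t0 x)%R <= B%:E)%E.
  exact: near_le.
apply: filterS => t /(l1le_of_sobolev l0); apply: l1le_trans.
rewrite le_eqVlt; apply/orP; left; apply/eqP; rewrite /lam /B; field; lra.
Qed.

Lemma fourier_coef_nlsB t t0 k :
  fourier_coef (fun x => u t x - u t0 x) k = fourier_coef (u t) k - fourier_coef (u t0) k.
Proof. by rewrite fourier_coefB//; apply: smooth_cbm; exact: nls_smooth. Qed.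

Lemma nls_jap_near t0 : exists B, \forall t \near t0,
  l1le (fun k => (jap k)%:C * fourier_coef (u t) k) B.
Proof.
have [B uB] := nls_jap t0; exists (B + 1).
have := nls_jap_continuous t0 ltr01; apply: filterS => t.
move=> /(l1leD uB); apply: l1le_le => k.
by rewrite fourier_coef_nlsB -mulrDr addrC subrK.
Qed.

Lemma cbm_cubic f : cbm f -> cbm (cubic f).
Proof. by move=> bf; apply: cbmM => //; apply: cbmM => //; exact: cbmJ. Qed.

Lemma modulus_cubic f x : modulus (cubic f x) = modulus (f x) ^+ 3.
Proof. by rewrite /cubic !modulusM modulusJ !exprS expr0 mulr1. Qed.

Lemma nls_time_derivative t x : cderive (u^~ x) t =
  Complex 0 1 * cderive (cderive (u t)) x - Complex 0 (eps ^+ 2) * cubic (u t) x.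
Proof.
have [_ _ _ /(_ t x) e] := sol.
have i2 : Complex 0 1 * Complex 0 1 = -1 :> R[i].
  by apply: complex_ext; rewrite ?cReN ?cImN ?cReM ?cImM/=; ring.
have e2 : (eps ^+ 2 * modulus (u t x) ^+ 2)%:C * u t x = (eps ^+ 2)%:C * cubic (u t) x.
  by rewrite rmorphM/= -mul_conjc /cubic -!mulrA; congr (_ * _); rewrite mulrCA.
have e3 : Complex 0 (eps ^+ 2) = Complex 0 1 * (eps ^+ 2)%:C :> R[i].
  by apply: complex_ext; rewrite ?cReM ?cImM/=; ring.
rewrite e2 in e; rewrite e3 -mulrA -e mulrDr opprD mulrA i2; ring.
Qed.

Lemma nls_second_derivative t : cbm (cderive (cderive (u t))) /\
  forall k, fourier_coef (cderive (cderive (u t))) k =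
    - ((k%:~R ^+ 2)%:C * fourier_coef (u t) k).
Proof.
have [_ _ dd _] := sol; have [B /l1le_jap_sqr uB] := nls_jap t.
have d1 x : is_cderive (u t) x (cderive (u t) x).
  by apply: cderivable_is_cderive; case: (dd t x).
have d2 x : is_cderive (cderive (u t)) x (cderive (cderive (u t)) x).
  by apply: cderivable_is_cderive; case: (dd t x).
split; first exact: (cbm_second_derivative (nls_smooth t) d1 d2 uB).
by move=> k; exact: (fourier_coef_second_derivative (nls_smooth t) d1 d2 uB).
Qed.

Lemma nls_time_derivative_bound t0 : exists2 G : R, 0 <= G & \forall t \near t0,
  forall x, modulus (cderive (u^~ x) t) <= G.
Proof.
have [_ _ dd _] := sol; have [B uB] := nls_jap_near t0.
have B0 : 0 <= B by have /nbhs_singleton/l1le_ge0 := uB.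
exists (B *+ 8 + eps ^+ 2 * B ^+ 3).
  by rewrite addr_ge0// ?mulrn_wge0// mulr_ge0 ?sqr_ge0// exprn_ge0.
apply: filterS uB => t uB x; rewrite nls_time_derivative.
have d1 y : is_cderive (u t) y (cderive (u t) y).
  by apply: cderivable_is_cderive; case: (dd t y).
have d2 y : is_cderive (cderive (u t)) y (cderive (cderive (u t)) y).
  by apply: cderivable_is_cderive; case: (dd t y).
have mi (r : R) : modulus (Complex 0 r) = `|r|.
  by rewrite modulusE/= expr0n/= add0r sqrtr_sqr.
apply: (le_trans (ler_modulusB _ _)).
rewrite (modulusM _ (cderive (cderive (u t)) x)) (modulusM _ (cubic (u t) x)) !mi.
rewrite normr1 mul1r (ger0_norm (sqr_ge0 _)) modulus_cubic lerD//.
  exact: (second_derivative_sup (nls_smooth t) d1 d2 (l1le_jap_sqr uB)).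
rewrite ler_wpM2l ?sqr_ge0// lerXn2r// ?nnegrE ?modulus_ge0//.
by apply: (@wiener_sup _ (u t)); split; [exact: nls_smooth|exact: l1le_jap].
Qed.

Local Notation circle := (@circle R).

Lemma is_derive_ravg (F : R -> R -> R) (t0 r G : R) : 0 < r ->
  (forall t, bounded_meas (F t)) ->
  (forall t x, derivable (F^~ x) t 1) ->
  (forall t x, `|t - t0| < r -> `|derive1 (F^~ x) t| <= G) -> 0 <= G ->
  is_derive t0 (1 : R) (fun t => ravg (F t)) (ravg (fun x => derive1 (F^~ x) t0)).
Proof.
move=> r0 bF dF FG G0.
have Ia : `]t0 - r, t0 + r[%classic t0.
  by rewrite /= in_itv/= ltrBlDr ltrDl r0.
have intF t : `]t0 - r, t0 + r[%classic t ->
    (@lebesgue_measure R).-integrable circle (EFin \o F t).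
  by move=> _; exact: bounded_meas_integrable.
have dF' t x : `]t0 - r, t0 + r[%classic t -> circle x -> derivable (F^~ x) t 1 by [].
have intG : (@lebesgue_measure R).-integrable circle (EFin \o (fun=> G)).
  exact/bounded_meas_integrable/bounded_meas_cst.
have ub t x : `]t0 - r, t0 + r[%classic t -> circle x -> `|partial1of2 F t x| <= G.
  rewrite /= in_itv/= => /andP[h1 h2] _; apply: FG; rewrite ltr_norml; lra.
have mc : measurable (circle : set (measurableTypeR R)) by exact: measurable_itv.
have d := derivable_under_integral mc Ia intF dF' (fun=> G0) intG ub.
have e := differentiation_under_integral mc Ia intF dF' (fun=> G0) intG ub.
have := @is_deriveZ _ _ _ _ ((pi *+ 2)^-1 : R) t0 1 _ (derivableP d).
by rewrite -derive1E e.
Qed.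

Lemma nls_mode_derivative k t0 : is_cderive (fun t => fourier_coef (u t) k) t0
  (- (Complex 0 (k%:~R ^+ 2) * fourier_coef (u t0) k
      + Complex 0 (eps ^+ 2) * fourier_coef (cubic (u t0)) k)).
Proof.
have [_ _ dd _] := sol; have [G G0 /nbhs_ballP[r /= r0 bG]] := nls_time_derivative_bound t0.
have du x t : is_cderive (u^~ x) t (cderive (u^~ x) t).
  by apply: cderivable_is_cderive; case: (dd t x).
have dF x t : is_cderive (fun t => u t x * ek (- k) x) t (cderive (u^~ x) t * ek (- k) x).
  apply: (is_cderive_eq (is_cderiveM (du x t) (is_cderive_cst (ek (- k) x) t))).
  by rewrite mulr0 add0r.
have bound t x : `|t - t0| < r -> modulus (cderive (u^~ x) t * ek (- k) x) <= G.
  by move=> tr; rewrite modulus_mul_unit ?modulus_ek//; apply: bG; rewrite /ball/= distrC.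
have bu t : cbm (fun x => u t x * ek (- k) x).
  by apply: cbmM; [exact/smooth_cbm/nls_smooth|exact: cbm_ek].
have [b2 f2] := nls_second_derivative t0.
have bt : cbm (fun x => cderive (u^~ x) t0).
  rewrite (_ : (fun x => _) = fun x => Complex 0 1 * cderive (cderive (u t0)) x
     - Complex 0 (eps ^+ 2) * cubic (u t0) x); last by apply/funext => x; exact: nls_time_derivative.
  apply: cbmB; apply: cbmM => //; try exact: cbm_cst.
  by apply: cbm_cubic; exact/smooth_cbm/nls_smooth.
have -> : - (Complex 0 (k%:~R ^+ 2) * fourier_coef (u t0) k
      + Complex 0 (eps ^+ 2) * fourier_coef (cubic (u t0)) k) =
      avg (fun x => cderive (u^~ x) t0 * ek (- k) x).
  rewrite -fourier_coefE (@eq_fourier_coef _ (fun x => cderive (u^~ x) t0) (fun x => Complex 0 1 * cderive (cderive (u t0)) x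
     - Complex 0 (eps ^+ 2) * cubic (u t0) x)); last by move=> x _; exact: nls_time_derivative.
  have bc : cbm (cubic (u t0)) by apply: cbm_cubic; exact/smooth_cbm/nls_smooth.
  rewrite fourier_coefB; [|by apply: cbmM => //; exact: cbm_cst|by apply: cbmM => //; exact: cbm_cst].
  rewrite !fourier_coefZ// f2 opprD; congr (_ - _).
  have -> : Complex 0 (k%:~R ^+ 2) = Complex 0 1 * (k%:~R ^+ 2)%:C :> R[i].
    by apply: complex_ext; rewrite ?cReM ?cImM/=; ring.
  by rewrite mulrN -(mulrA _ _ (fourier_coef (u t0) k)).
apply: (@is_cderive_ext _ (fun t => avg (fun x => u t x * ek (- k) x))).
  by move=> t; rewrite fourier_coefE.
have eR h : complex.Re (avg h) = ravg (fun x => complex.Re (h x)) by rewrite avgE.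
have eI h : complex.Im (avg h) = ravg (fun x => complex.Im (h x)) by rewrite avgE.
split; rewrite ?eR ?eI.
  under eq_fun do rewrite eR.
  have der t x : derive1 (fun t => complex.Re (u t x * ek (- k) x)) t =
      complex.Re (cderive (u^~ x) t * ek (- k) x).
    by rewrite derive1E; case: (dF x t) => [[_ ->]].
  have -> : (fun x => complex.Re (cderive (u^~ x) t0 * ek (- k) x)) =
      (fun x => derive1 (fun t => complex.Re (u t x * ek (- k) x)) t0).
    by apply/funext => x; rewrite der.
  apply: (@is_derive_ravg (fun t x => complex.Re (u t x * ek (- k) x)) t0 r G) => //.
  - by move=> t; case: (bu t).
  - by move=> t x; case: (dF x t) => [[]].
  - by move=> t x tr; rewrite der (le_trans (ler_Re_modulus _))// bound.
under eq_fun do rewrite eI.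
have der t x : derive1 (fun t => complex.Im (u t x * ek (- k) x)) t =
    complex.Im (cderive (u^~ x) t * ek (- k) x).
  by rewrite derive1E; case: (dF x t) => [_ [_ ->]].
have -> : (fun x => complex.Im (cderive (u^~ x) t0 * ek (- k) x)) =
    (fun x => derive1 (fun t => complex.Im (u t x * ek (- k) x)) t0).
  by apply/funext => x; rewrite der.
apply: (@is_derive_ravg (fun t x => complex.Im (u t x * ek (- k) x)) t0 r G) => //.
- by move=> t; case: (bu t).
- by move=> t x; case: (dF x t) => [_ []].
- by move=> t x tr; rewrite der (le_trans (ler_Im_modulus _))// bound.
Qed.

End NLSModes.

(** * The resonant approximation *)

Section VectorMeanValue.
Context {R : realType}.

Lemma sum_modulus_mean_value (s : seq int) (F F' : int -> R -> R[i]) (phi phi' : R -> R)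
    (a b : R) : a <= b ->
  (forall k t, is_cderive (F k) t (F' k t)) ->
  (forall t : R, is_derive t (1 : R) phi (phi' t)) ->
  (forall t, a < t < b -> \sum_(k <- s) modulus (F' k t) <= phi' t) ->
  \sum_(k <- s) modulus (F k b - F k a) <= phi b - phi a.
Proof.
move=> ab dF dphi F'phi.
have ex k : {w | modulus w = 1 /\ w * (F k b - F k a) = (modulus (F k b - F k a))%:C}.
  by apply: cid; have [w ? ?] := exists_phase (F k b - F k a); exists w.
pose w k := sval (ex k).
have w1 k : modulus (w k) = 1 by rewrite /w; case: (ex k) => ? [].
have wF k : w k * (F k b - F k a) = (modulus (F k b - F k a))%:C.
  by rewrite /w; case: (ex k) => ? [].
pose G t := \sum_(k <- s) w k * F k t.
pose G' t := \sum_(k <- s) w k * F' k t.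
have dG t : is_cderive G t (G' t) by apply: is_cderive_sum => k; exact: is_cderiveZ.
pose H t := phi t - complex.Re (G t).
have dH t : is_derive t (1 : R) H (phi' t - complex.Re (G' t)).
  by apply: is_deriveB; case: (dG t).
have cH : {within `[a, b], continuous H}.
  apply: continuous_subspaceT => x; apply: differentiable_continuous.
  by apply/derivable1_diffP; case: (dH x).
have [<-|ab'] := eqVneq a b; first by rewrite subrr big1// => k _; rewrite subrr modulus0.
have {ab ab'} ab : a < b by rewrite lt_neqAle ab'.
have [c cab Hc] := MVT ab (fun t _ => dH t) cH.
have : 0 <= H b - H a.
  rewrite Hc mulr_ge0 ?subr_ge0 ?(ltW ab)//.
  apply: le_trans (F'phi c _); last by rewrite in_itv/= in cab.
  rewrite (le_trans (ler_norm _))// (le_trans (ler_Re_modulus _))//.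
  rewrite (le_trans (ler_modulus_sum _ _ _))//.
  by apply: ler_sum => k _; rewrite modulusM w1 mul1r.
rewrite /H; have -> : complex.Re (G b) = complex.Re (G a) + \sum_(k <- s) modulus (F k b - F k a).
  have -> : \sum_(k <- s) modulus (F k b - F k a) = complex.Re (G b - G a).
    rewrite /G -sumrB cRe_sum; apply: eq_bigr => k _.
    by rewrite -mulrBr wF.
  by rewrite cReD cReN addrC subrK.
lra.
Qed.

End VectorMeanValue.

Section ResonantTriples.
Context {R : realType}.
Variable N : nat.
Implicit Types (k : int).

Local Notation s := (zrange N).

Definition triples : seq (int * int * int) :=
  [seq (p, k) | p <- [seq (j, k) | j <- s, k <- s], k <- s].

Lemma sum_triples (V : nmodType) (F : int * int * int -> V) :
  \sum_(q <- triples) F q =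
  \sum_(k1 <- s) \sum_(k2 <- s) \sum_(k3 <- s) F (k1, k2, k3).
Proof. by rewrite /triples !big_allpairs. Qed.

Definition tmode (q : int * int * int) : int := q.1.1 - q.1.2 + q.2.
Definition tprod (h : int -> R[i]) (q : int * int * int) : R[i] :=
  h q.1.1 * conjc (h q.1.2) * h q.2.
Definition tres k (q : int * int * int) : bool := (q.1.1 == k) || (q.2 == k).

Lemma mem_triples q : q \in triples -> [/\ q.1.1 \in s, q.1.2 \in s & q.2 \in s].
Proof.
move=> /allpairsP[[p j3] [ps s3 ->]].
have /allpairsP[[i1 i2] [s1 s2 ep]] : p \in [seq (j, k) | j <- s, k <- s] := ps.
by move: s3; rewrite [(p, j3).2]/= [(p, j3).1]/= ep.
Qed.

Lemma sum_pred1_zrange (F : int -> R[i]) k :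
  \sum_(j <- s) (j == k)%:R * F j = if k \in s then F k else 0.
Proof.
rewrite (eq_bigr (fun j => if j == k then F j else 0)) => [|j _]; last first.
  by case: ifP => _; rewrite ?mul1r ?mul0r.
rewrite -big_mkcond -big_filter; case: ifPn => ks.
  by rewrite filter_pred1_uniq ?zrange_uniq// big_seq1.
by rewrite (@eq_in_filter _ _ pred0) ?filter_pred0 ?big_nil// => j js; apply: contraNF ks => /eqP <-.
Qed.

Lemma sum_resonant_triples (h : int -> R[i]) k :
  \sum_(q <- triples | (tmode q == k) && tres k q) tprod h q =
  if k \in s then (((\sum_(j <- s) modulus (h j) ^+ 2) *+ 2 - modulus (h k) ^+ 2))%:C * h k
  else 0.
Proof.
set M := \sum_(j <- s) _.
have MC : \sum_(j <- s) conjc (h j) * h j = M%:C.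
  by rewrite rmorph_sum; apply: eq_bigr => j _; rewrite mulrC mul_conjc.
pose I (b : bool) : R[i] := b%:R.
have ind (q : int * int * int) : (if (tmode q == k) && tres k q then tprod h q else 0) =
    I (q.1.1 == k) * (I (q.2 == q.1.2) * tprod h q) +
    I (q.2 == k) * (I (q.1.2 == q.1.1) * tprod h q) -
    I (q.2 == k) * (I (q.1.2 == k) * (I (q.1.1 == k) * tprod h q)).
  rewrite /I /tres /tmode; case: q => [[k1 k2] k3] /=.
  have [->|n1] := eqVneq k1 k; have [->|n3] := eqVneq k3 k; rewrite ?andbF ?andbT/=.
  - rewrite (_ : k - k2 + k == k = (k2 == k)) 1?(eq_sym k k2); last by lia.
    by case: (k2 == k); rewrite /=; ring.
  - rewrite (_ : k - k2 + k3 == k = (k3 == k2)); last by lia.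
    by case: (k3 == k2); rewrite /=; ring.
  - rewrite (_ : k1 - k2 + k == k = (k2 == k1)); last by lia.
    by case: (k2 == k1); case: (k2 == k); rewrite /=; ring.
  - ring.
rewrite big_mkcond (eq_bigr _ (fun q _ => ind q)) sumrB big_split/= !sum_triples /=.
have inner (F : int -> R[i]) j : j \in s -> \sum_(i <- s) I (i == j) * F i = F j.
  by move=> js; rewrite sum_pred1_zrange js.
have T1 : \sum_(k1 <- s) \sum_(k2 <- s) \sum_(k3 <- s)
    I (k1 == k) * (I (k3 == k2) * tprod h (k1, k2, k3)) = if k \in s then M%:C * h k else 0.
  rewrite (eq_bigr (fun k1 => I (k1 == k) * (M%:C * h k1))) ?sum_pred1_zrange// => k1 _.
  rewrite -MC mulr_suml mulr_sumr big_seq [RHS]big_seq; apply: eq_bigr => k2 k2s.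
  rewrite -mulr_sumr inner// /tprod /=; ring.
have T2 : \sum_(k1 <- s) \sum_(k2 <- s) \sum_(k3 <- s)
    I (k3 == k) * (I (k2 == k1) * tprod h (k1, k2, k3)) = if k \in s then M%:C * h k else 0.
  case: ifPn => ks; last first.
    rewrite big1// => k1 _; rewrite big1// => k2 _.
    by rewrite sum_pred1_zrange (negbTE ks).
  rewrite -MC mulr_suml big_seq [RHS]big_seq; apply: eq_bigr => k1 k1s.
  rewrite (eq_bigr (fun k2 => I (k2 == k1) * tprod h (k1, k2, k))) => [|k2 _]; last first.
    by rewrite inner.
  by rewrite inner// /tprod /=; ring.
have T3 : \sum_(k1 <- s) \sum_(k2 <- s) \sum_(k3 <- s)
    I (k3 == k) * (I (k2 == k) * (I (k1 == k) * tprod h (k1, k2, k3))) =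
    if k \in s then (modulus (h k) ^+ 2)%:C * h k else 0.
  case: ifPn => ks; last first.
    rewrite big1// => k1 _; rewrite big1// => k2 _.
    by rewrite sum_pred1_zrange (negbTE ks).
  rewrite (eq_bigr (fun k1 => I (k1 == k) * tprod h (k1, k, k))) => [|k1 _]; last first.
    rewrite (eq_bigr (fun k2 => I (k2 == k) * (I (k1 == k) * tprod h (k1, k2, k)))) => [|k2 _].
      by rewrite inner.
    by rewrite inner.
  by rewrite inner// /tprod /= -mul_conjc.
rewrite T1 T2 T3; case: ifP => _; last by rewrite subr0 addr0.
by rewrite rmorphB/= rmorphMn/=; ring.
Qed.

End ResonantTriples.

Section ResonantApproximation.
Context {R : realType}.
Variables (g : int -> R[i]) (N : nat) (eps S : R).
Hypothesis gS : \sum_(k <- zrange N) modulus (g k) <= S.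
Hypothesis small : eps ^+ 2 * S ^+ 2 *+ 4 <= 1.
Implicit Types (k : int) (t x : R).

Local Notation s := (zrange N).
Local Notation triples := (triples N).

Definition mass : R := \sum_(j <- s) modulus (g j) ^+ 2.

(* The resonant part of the cubic nonlinearity only rotates the phases: mode
   [k] of the resonant flow is [g k * cexp (- (freq k * t))]. *)
Definition shift_freq k : R := eps ^+ 2 * (mass *+ 2 - modulus (g k) ^+ 2).
Definition freq k : R := k%:~R ^+ 2 + shift_freq k.
Definition amp t k : R[i] := g k * cexp (- (freq k) * t).
Definition resonant t x : R[i] := \sum_(k <- s) amp t k * ek k x.

Lemma smooth_resonant t : smooth (resonant t).
Proof.
split=> x; first by apply: eq_bigr => k _; rewrite ek_periodic.
apply: (@is_cderive_cderivable _ _ _ (\sum_(k <- s) amp t k * (Complex 0 k%:~R * ek k x))).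
by apply: is_cderive_sum => k; apply/is_cderiveZ/is_cderive_ek.
Qed.

Lemma fourier_coef_resonant t k :
  fourier_coef (resonant t) k = if k \in s then amp t k else 0.
Proof. by rewrite fourier_coef_trig// zrange_uniq. Qed.

Lemma modulus_amp t k : modulus (amp t k) = modulus (g k).
Proof. by rewrite modulus_mul_unit// modulus_cexp. Qed.

Lemma wiener_resonant t : wiener (resonant t) S.
Proof.
split; first exact: smooth_resonant.
move=> s' us'; apply: le_trans gS.
rewrite (eq_bigr (fun k => if k \in s then modulus (g k) else 0)) => [|k _]; last first.
  by rewrite fourier_coef_resonant; case: ifP; rewrite ?modulus_amp ?modulus0.
rewrite -big_mkcond -big_filter; apply: le_sum_uniq_subset.
- exact: filter_uniq.
- exact: zrange_uniq.
- by move=> k; rewrite mem_filter => /andP[].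
- by move=> k; exact: modulus_ge0.
Qed.

Lemma fourier_coef_cubic_resonant t k : fourier_coef (cubic (resonant t)) k =
  \sum_(q <- triples | tmode q == k) tprod (amp t) q.
Proof.
rewrite (@eq_fourier_coef _ _ (fun x => \sum_(q <- triples) tprod (amp t) q * ek (tmode q) x)).
  rewrite fourier_coef_sum => [|q]; last by apply: cbmM; [exact: cbm_cst|exact: cbm_ek].
  rewrite [RHS]big_mkcond; apply: eq_bigr => q _.
  rewrite fourier_coefZ; last exact: cbm_ek.
  by rewrite fourier_coef_ek; case: ifP => _; rewrite ?mulr1 ?mulr0.
move=> x _; rewrite sum_triples /cubic /resonant conjc_sum.
rewrite mulr_suml; apply: eq_bigr => k1 _.
rewrite mulr_suml mulr_sumr; apply: eq_bigr => k2 _.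
rewrite !mulr_sumr; apply: eq_bigr => k3 _.
by rewrite /tprod /tmode /= !ekD conjcM ekJ; ring.
Qed.

(* The phase defect of a non-resonant triple: [tphase k q] is twice a nonzero
   product of integers, up to a small perturbation by the shifted frequencies. *)
Definition tphase k (q : int * int * int) : R :=
  freq q.1.1 - freq q.1.2 + freq q.2 - k%:~R ^+ 2.

Lemma tprod_amp t q : tprod (amp t) q =
  tprod g q * cexp (- (freq q.1.1 - freq q.1.2 + freq q.2) * t).
Proof.
rewrite /tprod /amp !conjcM -cexpN.
have -> : - (freq q.1.1 - freq q.1.2 + freq q.2) * t =
   - freq q.1.1 * t + - (- freq q.1.2 * t) + - freq q.2 * t by ring.
by rewrite !cexpD; ring.
Qed.

Lemma eps2_mass : eps ^+ 2 * mass *+ 4 <= 1.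
Proof.
apply: le_trans small; rewrite lerMn2r/= ler_wpM2l ?sqr_ge0//.
have S0 : 0 <= S by apply: le_trans gS; apply: sumr_ge0 => k _; exact: modulus_ge0.
apply: (@le_trans _ _ (\sum_(j <- s) modulus (g j) * S)).
  rewrite /mass big_seq [leRHS]big_seq; apply: ler_sum => j js.
  rewrite expr2 ler_wpM2l ?modulus_ge0//; apply: le_trans gS.
  rewrite (big_rem j)//= lerDl; apply: sumr_ge0 => i _; exact: modulus_ge0.
by rewrite -mulr_suml expr2 ler_wpM2r.
Qed.

Lemma ge_mass k : k \in s -> modulus (g k) ^+ 2 <= mass.
Proof.
move=> ks; rewrite /mass (big_rem k)//= lerDl.
by apply: sumr_ge0 => i _; exact: sqr_ge0.
Qed.

Lemma tphase_lower k q : q \in triples -> tmode q == k -> ~~ tres k q -> 1 <= `|tphase k q|.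
Proof.
case: q => [[i1 i2] j3] /mem_triples[/= s1 s2 s3].
rewrite /tmode /tres/= => /eqP e; rewrite negb_or => /andP[n1 n3].
have {}e : i2 = i1 + j3 - k by rewrite -e; ring.
rewrite /tphase /freq /=; set w := shift_freq i1 - shift_freq i2 + shift_freq j3.
have -> : i1%:~R ^+ 2 + shift_freq i1 - (i2%:~R ^+ 2 + shift_freq i2) +
    (j3%:~R ^+ 2 + shift_freq j3) - k%:~R ^+ 2 = w - ((k - i1) * (k - j3))%:~R *+ 2.
  by rewrite /w {1}e !(rmorphM, rmorphB, rmorphD)/=; ring.
have wle : `|w| <= 1.
  have -> : w = eps ^+ 2 * (mass *+ 2 - modulus (g i1) ^+ 2 + modulus (g i2) ^+ 2 - modulus (g j3) ^+ 2).
    by rewrite /w /shift_freq; ring.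
  rewrite normrM ger0_norm ?sqr_ge0//; apply: le_trans eps2_mass.
  rewrite -mulrnAr ler_wpM2l ?sqr_ge0// ler_norml.
  have := ge_mass s1; have := ge_mass s2; have := ge_mass s3.
  have := sqr_ge0 (modulus (g i1)); have := sqr_ge0 (modulus (g i2)); have := sqr_ge0 (modulus (g j3)).
  by move=> *; apply/andP; split; lra.
have int1 : 1 <= `|((k - i1) * (k - j3))%:~R : R|.
  rewrite -intr_norm ler1z -gtz0_ge1 normr_gt0 mulf_neq0// subr_eq0 eq_sym//.
rewrite distrC; apply: le_trans (lerB_dist _ _).
by rewrite normrMn; lra.
Qed.

Definition tosc k t : R[i] :=
  \sum_(q <- triples | (tmode q == k) && ~~ tres k q)
     tprod g q * (Complex 0 (tphase k q)^-1 * (cexp (- tphase k q * t) - 1)).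

Lemma tosc0 k : tosc k 0 = 0.
Proof. by rewrite /tosc big1// => q _; rewrite mulr0 cexp0 subrr !mulr0. Qed.

Lemma is_cderive_tosc k t : is_cderive (tosc k) t
  (\sum_(q <- triples | (tmode q == k) && ~~ tres k q) tprod g q * cexp (- tphase k q * t)).
Proof.
rewrite -big_filter; apply: (@is_cderive_ext _ (fun t => \sum_(q <- [seq q <- triples | (tmode q == k) && ~~ tres k q])
     tprod g q * (Complex 0 (tphase k q)^-1 * (cexp (- tphase k q * t) - 1)))).
  by move=> y; rewrite big_filter.
rewrite (_ : \sum_(q <- _) _ = \sum_(q <- [seq q <- triples | (tmode q == k) && ~~ tres k q])
   tprod g q * (Complex 0 (tphase k q)^-1 * (Complex 0 (- tphase k q) * cexp (- tphase k q * t) - 0))).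
  apply: is_cderive_sum => q; do 2 apply: is_cderiveZ.
  by apply: is_cderiveB; [exact: is_cderive_cexp|exact: is_cderive_cst].
rewrite big_seq [RHS]big_seq; apply: eq_bigr => q; rewrite mem_filter => /andP[/andP[qk qr] qt].
have p0 : tphase k q != 0 by rewrite -normr_gt0 (lt_le_trans ltr01)// tphase_lower.
rewrite subr0; congr (_ * _); rewrite mulrA -[LHS]mul1r; congr (_ * _).
apply: complex_ext; rewrite ?cReM ?cImM/=; field => //.
Qed.

Lemma tosc_bound t (s' : seq int) : uniq s' ->
  \sum_(k <- s') modulus (tosc k t) <= S ^+ 3 *+ 2.
Proof.
move=> us'; have S0 : 0 <= S by apply: le_trans gS; apply: sumr_ge0 => k _; exact: modulus_ge0.
apply: (@le_trans _ _ (\sum_(k <- s') \sum_(q <- triples)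
    (if tmode q == k then modulus (tprod g q) *+ 2 else 0))).
  apply: ler_sum => k _; apply: (le_trans (ler_modulus_sum _ _ _)).
  rewrite big_mkcond big_seq [leRHS]big_seq; apply: ler_sum => q qt.
  case: ifPn => [/andP[qk qr]|_]; last by case: ifP => // _; rewrite mulrn_wge0// modulus_ge0.
  rewrite qk (modulusM (tprod g q)) -[leRHS]mulr_natr ler_wpM2l ?modulus_ge0//.
  have mi (r : R) : modulus (Complex 0 r) = `|r|.
    by rewrite modulusE/= expr0n/= add0r sqrtr_sqr.
  rewrite (modulusM (Complex _ _)) mi -[leRHS]mul1r ler_pM ?modulus_ge0//.
    rewrite normfV invf_le1 ?tphase_lower// ?(lt_le_trans ltr01) ?tphase_lower//.
  by rewrite (le_trans (ler_modulusB _ _))// modulus_cexp modulus1.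
rewrite exchange_big/=; apply: (@le_trans _ _ (\sum_(q <- triples) modulus (tprod g q) *+ 2)).
  apply: ler_sum => q _; rewrite -big_mkcond -big_filter.
  have [qs|qs] := boolP (tmode q \in s').
    rewrite (_ : [seq _ <- _ | _] = [:: tmode q]) ?big_seq1//.
    by rewrite -(filter_pred1_uniq us' qs); apply: eq_filter => k; rewrite /= eq_sym.
  rewrite (@eq_in_filter _ _ pred0) ?filter_pred0 ?big_nil ?mulrn_wge0 ?modulus_ge0// => j js.
  by apply: contraNF qs => /eqP ->.
rewrite sumrMnl lerMn2r/= sum_triples.
rewrite (eq_bigr (fun k1 => modulus (g k1) * (\sum_(k <- s) modulus (g k)) ^+ 2)) => [|k1 _]; last first.
  rewrite expr2 mulr_suml mulr_sumr; apply: eq_bigr => k2 _.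
  by rewrite !mulr_sumr; apply: eq_bigr => k3 _; rewrite /tprod/= !modulusM modulusJ mulrA.
have sg0 : 0 <= \sum_(k <- s) modulus (g k) by apply: sumr_ge0 => k _; exact: modulus_ge0.
by rewrite -mulr_suml [leRHS]exprS ler_pM// ?exprn_ge0// lerXn2r.
Qed.

End ResonantApproximation.

Section CubicDifference.
Context {R : realType}.

Lemma l1le_cubicB (f v : R -> R[i]) (F S W : R) : wiener f F -> wiener v S ->
  l1le (fun k => fourier_coef f k - fourier_coef v k) W ->
  l1le (fun k => fourier_coef (cubic f) k - fourier_coef (cubic v) k)
    (W * (F * F) + S * (W * F) + S * (S * W)).
Proof.
move=> wf wv fvW; pose w x := f x - v x.
have [sf fF] := wf; have [sv vS] := wv.
have bf := smooth_cbm sf; have bv := smooth_cbm sv.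
have wv' := wienerJ wv; have wf' := wienerJ wf.
have ww : wiener w W.
  split; first exact: smoothB.
  by apply: l1le_le fvW => k; rewrite fourier_coefB.
have bw := smooth_cbm (proj1 ww); have ww' := wienerJ ww.
have bff : cbm (fun x => conjc (f x) * f x) by apply: cbmM => //; exact: cbmJ.
have bwf : cbm (fun x => conjc (w x) * f x) by apply: cbmM => //; exact: cbmJ.
have bvw : cbm (fun x => conjc (v x) * w x) by apply: cbmM => //; exact: cbmJ.
have H1 := l1le_fourier_coefM ww bff (l1le_fourier_coefM wf' bf fF).
have H2 := l1le_fourier_coefM wv bwf (l1le_fourier_coefM ww' bf fF).
have H3 := l1le_fourier_coefM wv bvw (l1le_fourier_coefM wv' bw (proj2 ww)).
apply: l1le_le (l1leD (l1leD H1 H2) H3) => k.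
rewrite le_eqVlt; apply/orP; left; apply/eqP; congr modulus.
rewrite -fourier_coefB; [|exact: cbm_cubic|exact: cbm_cubic].
rewrite -!fourier_coefD; do ?[exact: cbmM|apply: cbmD].
apply: eq_fourier_coef => x _; rewrite /cubic /w.
by rewrite !conjcD !(rmorphN (@conjc R)) /=; ring.
Qed.

End CubicDifference.

Section PathwiseEstimate.
Context {R : realType}.
Variables (u : R -> R -> R[i]) (g : int -> R[i]) (N : nat) (eps S : R).
Hypothesis sol : nls_solution eps u.
Hypothesis gS : \sum_(k <- zrange N) modulus (g k) <= S.
Hypothesis small : eps ^+ 2 * S ^+ 2 *+ 4 <= 1.
Variables (e0 A T : R).
Hypothesis init : l1le (fun k => fourier_coef (u 0) k - (if k \in zrange N then g k else 0)) e0.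
Hypothesis A_large : e0 + eps ^+ 2 * (S ^+ 3 *+ 2) < A.
Let L : R := (eps ^+ 2 * S ^+ 2) *+ 7.
Hypothesis A_small : A * expR (L * T) <= S.

Local Notation v := (resonant g N eps).
Local Notation phi := (fun t : R => A * expR (L * t)).

Let e0_ge0 : 0 <= e0. Proof. exact: l1le_ge0 init. Qed.

Let S_ge0 : 0 <= S.
Proof. by apply: le_trans gS; apply: sumr_ge0 => k _; exact: modulus_ge0. Qed.

Let L_ge0 : 0 <= L.
Proof. by rewrite mulrn_wge0// mulr_ge0// sqr_ge0. Qed.

Let A_gt0 : 0 < A.
Proof.
apply: le_lt_trans A_large; rewrite addr_ge0// mulr_ge0 ?sqr_ge0//.
by rewrite mulrn_wge0// exprn_ge0.
Qed.

Let close (t W : R) := l1le (fun k => fourier_coef (u t) k - fourier_coef (v t) k) W.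

Let phi_mono (x y : R) : x <= y -> phi x <= phi y.
Proof. by move=> xy; rewrite ler_wpM2l ?(ltW A_gt0)// ler_expR ler_wpM2l. Qed.

Let step (tau : R) : 0 <= tau -> tau <= T ->
  (forall t, 0 <= t < tau -> close t (phi t)) ->
  close tau (phi tau - (A - (e0 + eps ^+ 2 * (S ^+ 3 *+ 2)))).
Proof.
move=> tau0 tauT ct s us.
pose Phi k t : R[i] := cexp (k%:~R ^+ 2 * t) * fourier_coef (u t) k
  - (if k \in zrange N then g k * cexp (- shift_freq g N eps k * t) else 0)
  + Complex 0 (eps ^+ 2) * tosc g N eps k t.
pose Phi' k t : R[i] := - Complex 0 (eps ^+ 2) * cexp (k%:~R ^+ 2 * t) *
  (fourier_coef (cubic (u t)) k - fourier_coef (cubic (v t)) k).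
have dPhi k t : is_cderive (Phi k) t (Phi' k t).
  have d1 := is_cderiveM (is_cderive_cexp (k%:~R ^+ 2) t) (nls_mode_derivative sol k t).
  have d2 : is_cderive (fun t => if k \in zrange N then g k * cexp (- shift_freq g N eps k * t) else 0) t
      (if k \in zrange N then g k * (Complex 0 (- shift_freq g N eps k) * cexp (- shift_freq g N eps k * t)) else 0).
    case: ifP => _; last exact: is_cderive_cst.
    by apply: is_cderiveZ; exact: is_cderive_cexp.
  have d3 := is_cderiveZ (Complex 0 (eps ^+ 2)) (is_cderive_tosc gS small k t).
  apply: (is_cderive_eq (is_cderiveD (is_cderiveB d1 d2) d3)).
  have cv : cexp (k%:~R ^+ 2 * t) * fourier_coef (cubic (v t)) k =
     (if k \in zrange N then ((mass g N *+ 2 - modulus (g k) ^+ 2))%:C *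
         (g k * cexp (- shift_freq g N eps k * t)) else 0) +
     \sum_(q <- triples N | (tmode q == k) && ~~ tres k q) tprod g q * cexp (- tphase g N eps k q * t).
    rewrite fourier_coef_cubic_resonant (bigID (tres k))/= mulrDr sum_resonant_triples.
    congr (_ + _).
      case: ifP => _; last by rewrite mulr0.
      rewrite modulus_amp (_ : \sum_(j <- zrange N) modulus (amp g N eps t j) ^+ 2 = mass g N).
        rewrite mulrCA; congr (_ * _); rewrite /amp mulrCA -cexpD; congr (_ * cexp _).
        by rewrite /freq; ring.
      by apply: eq_bigr => j _; rewrite modulus_amp.
    rewrite mulr_sumr; apply: eq_bigr => q _; rewrite tprod_amp mulrCA -cexpD.
    by congr (_ * cexp _); rewrite /tphase; ring.
  have e4 : Phi' k t = - Complex 0 (eps ^+ 2) * (cexp (k%:~R ^+ 2 * t) * fourier_coef (cubic (u t)) k)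
      + Complex 0 (eps ^+ 2) * (cexp (k%:~R ^+ 2 * t) * fourier_coef (cubic (v t)) k).
    by rewrite /Phi'; ring.
  rewrite e4 cv mulrDr.
  have eC : Complex 0 (- shift_freq g N eps k) =
      - (Complex 0 (eps ^+ 2) * (mass g N *+ 2 - modulus (g k) ^+ 2)%:C).
    by apply: complex_ext; rewrite ?cReN ?cImN ?cReM ?cImM/= /shift_freq; ring.
  rewrite eC; case: ifP => _; ring.
have dphi t : is_derive t (1 : R) phi (L * phi t).
  by apply: is_derive_eq; rewrite /GRing.scale/=; ring.
have mi (r : R) : modulus (Complex 0 r) = `|r|.
  by rewrite modulusE/= expr0n/= add0r sqrtr_sqr.
have bPhi t : 0 < t < tau -> \sum_(k <- s) modulus (Phi' k t) <= L * phi t.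
  move=> /andP[t0 ttau]; have tT : t <= T by rewrite (le_trans (ltW ttau)).
  have ct1 : close t (phi t) by apply: ct; rewrite (ltW t0).
  have pS : phi t <= S by apply: le_trans A_small; exact: phi_mono.
  have wv : wiener (v t) S by exact: wiener_resonant.
  have wu : wiener (u t) (S *+ 2).
    split; first exact: nls_smooth sol t.
    apply: (l1le_trans (A := phi t + S)); first by rewrite mulr2n lerD2r.
    by apply: l1le_le (l1leD ct1 (proj2 wv)) => k; rewrite subrK.
  have := l1le_cubicB wu wv ct1 us => H.
  rewrite (eq_bigr (fun k => eps ^+ 2 * modulus (fourier_coef (cubic (u t)) k - fourier_coef (cubic (v t)) k))).
    rewrite -mulr_sumr; apply: (le_trans (ler_wpM2l (sqr_ge0 _) H)).
    by rewrite /L le_eqVlt; apply/orP; left; apply/eqP; ring.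
  move=> k _; rewrite /Phi' -mulrA modulusM modulusN mi ger0_norm ?sqr_ge0//.
  by rewrite (modulusM (cexp _)) modulus_cexp mul1r.
have := sum_modulus_mean_value tau0 dPhi dphi bPhi.
rewrite !mulr0 expR0 mulr1 => mv.
have Phi0 k : Phi k 0 = fourier_coef (u 0) k - (if k \in zrange N then g k else 0).
  rewrite /Phi tosc0 !mulr0 !addr0 !cexp0 mul1r; by case: ifP; rewrite ?mulr1.
have fin k : modulus (fourier_coef (u tau) k - fourier_coef (v tau) k) <=
   modulus (Phi k tau - Phi k 0) + modulus (Phi k 0) + eps ^+ 2 * modulus (tosc g N eps k tau).
  have -> : fourier_coef (u tau) k - fourier_coef (v tau) k =
     cexp (- (k%:~R ^+ 2 * tau)) * ((Phi k tau - Phi k 0) + Phi k 0 - Complex 0 (eps ^+ 2) * tosc g N eps k tau).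
    rewrite subrK /Phi addrK mulrBr mulrA cexpNK mul1r; congr (_ - _).
    rewrite fourier_coef_resonant; case: ifP => _; last by rewrite mulr0.
    by rewrite /amp mulrCA -cexpD; congr (_ * cexp _); rewrite /freq; ring.
  rewrite modulusM modulus_cexp mul1r (le_trans (ler_modulusB _ _))//.
  by rewrite (modulusM (Complex _ _)) mi ger0_norm ?sqr_ge0// lerD2r ler_modulusD.
apply: (le_trans (ler_sum _ (fun k _ => fin k))).
rewrite !big_split/= -mulr_sumr.
have i0 : \sum_(k <- s) modulus (Phi k 0) <= e0.
  by rewrite (eq_bigr _ (fun k _ => congr1 _ (Phi0 k))); exact: init.
have i1 := ler_wpM2l (sqr_ge0 eps) (tosc_bound gS small tau us).
move: mv i0 i1 => /=; set X1 := \sum_(_ <- _) _; set X2 := \sum_(_ <- _) _; set X3 := \sum_(_ <- _) _.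
lra.
Qed.

Let continuity (t0 d : R) : 0 < d -> \forall t \near t0, forall W, close t0 W -> close t (W + d).
Proof.
move=> d0; have d20 : 0 < d / 2 by rewrite divr_gt0.
have cu := nls_jap_continuous sol t0 d20.
have cv : \forall t \near t0, \sum_(k <- zrange N) modulus (amp g N eps t k - amp g N eps t0 k) <= d / 2.
  pose K : R := 1 + \sum_(k <- zrange N) modulus (g k) * `|freq g N eps k| *+ 2.
  have K0 : 0 < K.
    rewrite ltr_pwDl// sumr_ge0// => k _; by rewrite mulrn_wge0// mulr_ge0 ?modulus_ge0.
  apply/nbhs_ballP; exists (d / 2 / K); first by rewrite /= divr_gt0.
  move=> t /ltW; rewrite /= distrC => tt.
  apply: (@le_trans _ _ (K * `|t - t0|)); last by rewrite mulrC -ler_pdivlMr.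
  apply: (@le_trans _ _ (\sum_(k <- zrange N) (modulus (g k) * `|freq g N eps k| *+ 2) * `|t - t0|)).
    apply: ler_sum => k _; rewrite /amp -mulrBr modulusM.
    apply: (le_trans (ler_wpM2l (modulus_ge0 _) (cexp_lip _ _))).
    rewrite -mulrBr normrM normrN le_eqVlt; apply/orP; left; apply/eqP; ring.
  by rewrite -mulr_suml ler_wpM2r// /K lerDr.
apply: filterS2 cu cv => t /l1le_jap cu cv W cW.
have vv : l1le (fun k => fourier_coef (v t0) k - fourier_coef (v t) k) (d / 2).
  move=> s us; apply: le_trans cv.
  rewrite (eq_bigr (fun k => if k \in zrange N then modulus (amp g N eps t k - amp g N eps t0 k) else 0)).
    rewrite -big_mkcond -big_filter; apply: le_sum_uniq_subset.
    - exact: filter_uniq.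
    - exact: zrange_uniq.
    - by move=> k; rewrite mem_filter => /andP[].
    - by move=> k; exact: modulus_ge0.
  move=> k _; rewrite !fourier_coef_resonant; case: ifP => _; first by rewrite modulusBC.
  by rewrite subrr modulus0.
have := l1leD (l1leD cW cu) vv; rewrite -addrA -splitr; apply: l1le_le => k.
rewrite (fourier_coef_nlsB sol) le_eqVlt; apply/orP; left; apply/eqP; congr modulus; ring.
Qed.

Lemma resonant_approximation (t : R) : 0 <= t <= T ->
  l1le (fun k => fourier_coef (u t) k - fourier_coef (v t) k) (A * expR (L * t)).
Proof.
move=> /andP[t0 tT]; have T0 : 0 <= T := le_trans t0 tT.
pose gap := A - (e0 + eps ^+ 2 * (S ^+ 3 *+ 2)).
have gap0 : 0 < gap by rewrite subr_gt0.
have step' tau : 0 <= tau -> tau <= T -> (forall t, 0 <= t < tau -> close t (phi t)) ->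
    close tau (phi tau).
  move=> h1 h2 h3; apply: l1le_trans (step h1 h2 h3).
  by rewrite gerBl// ltW.
pose B := [set tau : R | 0 <= tau <= T /\ forall t, 0 <= t <= tau -> close t (phi t)].
have B0 : B 0.
  split; first by rewrite lexx.
  move=> t' /andP[h1 h2]; have -> : t' = 0 by apply/eqP; rewrite eq_le h2.
  apply: step' => // t'' /andP[h3 h4]; by have := le_lt_trans h3 h4; rewrite ltxx.
have supB : has_sup B by split; [exists 0|exists T => tau [/andP[]]].
pose tau := sup B.
have tau0 : 0 <= tau by apply: ub_le_sup => //; case: supB.
have tauT : tau <= T by apply: ge_sup; [exists 0|move=> x [/andP[]]].
have below t' : 0 <= t' < tau -> close t' (phi t').
  move=> /andP[h1 h2]; have h3 : 0 < tau - t' by rewrite subr_gt0.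
  have [b [_ Bb]] := sup_adherent h3 supB; rewrite subKr => tb.
  by apply: Bb; rewrite h1 ltW.
have ctau := step tau0 tauT below.
have [|Tn] := eqVneq tau T.
  move=> e; have [tt|tt] := ltP t tau; first by apply: below; rewrite t0.
  have -> : t = tau by apply/eqP; rewrite eq_le tt e tT.
  exact: step'.
exfalso; have tauT' : tau < T by rewrite lt_neqAle Tn.
have /nbhs_ballP[r /= r0 near_tau] := continuity tau gap0.
pose b := Num.min T (tau + r / 2).
have r20 : 0 < r / 2 by rewrite divr_gt0.
have tb : tau < b by rewrite lt_min tauT' ltrDl.
suff : B b.
  move=> Bb; have : b <= tau by apply: ub_le_sup => //; case: supB.
  by rewrite leNgt tb.
split; first by rewrite (le_trans tau0 (ltW tb)) ge_min lexx.
move=> t' /andP[h1 h2]; have [tt|tt] := ltP t' tau; first by apply: below; rewrite h1.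
have br : ball tau r t'.
  rewrite /ball/= ler0_norm ?subr_le0// opprB ltrBlDl (le_lt_trans h2)//.
  rewrite gt_min; apply/orP; right; rewrite ltrD2l.
  by rewrite ltr_pdivrMr// ltr_pMr// ltr1n.
have := near_tau t' br _ ctau; rewrite subrK; apply: l1le_trans.
exact: phi_mono.
Qed.

End PathwiseEstimate.

(** * Gaussian tails *)

Section NormalMoments.
Context {R : realType} {d : measure_display} {Om : measurableType d}.
Variable P : probability Om R.
Local Notation mR := (measurableTypeR R).
Local Notation mu := (@lebesgue_measure R).

Lemma ge0_integral_normal_prob (m s : R) (f : mR -> \bar R) : measurable_fun setT f ->
  (forall x, 0 <= f x)%E ->
  (\int[normal_prob m s]_x f x = \int[mu]_x (f x * (normal_pdf m s x)%:E))%E.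
Proof.
move=> mf f0.
rewrite -(Radon_Nikodym_SigmaFinite.change_of_variables (normal_prob_dominates m s))//.
apply: ae_eq_integral => //.
- apply: emeasurable_funM => //; apply: (measurable_int mu).
  exact: (Radon_Nikodym_SigmaFinite.f_integrable (normal_prob_dominates m s)).
- apply: emeasurable_funM => //; apply/measurableT_comp => //.
  exact: measurable_normal_pdf.
- apply: ae_eqe_mul2l; apply: integral_ae_eq => //.
  + exact: (Radon_Nikodym_SigmaFinite.f_integrable (normal_prob_dominates m s)).
  + by apply/measurableT_comp => //; exact: measurable_normal_pdf.
  + move=> E _ mE; rewrite -Radon_Nikodym_SigmaFinite.f_integral//.
    exact: normal_prob_dominates.
Qed.

Variables (X : Om -> R) (m s : R).
Hypothesis mX : measurable_fun setT (X : Om -> mR).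
Hypothesis s0 : 0 < s.
Hypothesis lawX : forall A : set mR, measurable A -> P (X @^-1` A) = normal_prob m s A.

Lemma ge0_integral_normal_law (f : R -> R) : measurable_fun setT (f : mR -> R) ->
  (forall x, 0 <= f x) ->
  (\int[P]_w (f (X w))%:E = \int[mu]_x (f x * normal_pdf m s x)%:E)%E.
Proof.
move=> mf f0; have mf' : measurable_fun setT (fun x : mR => (f x)%:E) by exact/measurable_EFinP.
pose Y : {mfun Om >-> mR} := HB.pack (X : Om -> mR) (isMeasurableFun.Build _ _ Om mR X mX).
transitivity (\int[distribution P Y]_y (f y)%:E)%E.
  by rewrite ge0_integral_distribution// => y; rewrite lee_fin.
transitivity (\int[normal_prob m s]_y (f y)%:E)%E.
  by apply: eq_measure_integral => A mA _; exact: lawX.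
by rewrite ge0_integral_normal_prob// => x; rewrite lee_fin.
Qed.

Lemma normal_pdf_gt0 (m' s' x : R) : s' != 0 -> 0 < normal_pdf m' s' x.
Proof. by move=> h; rewrite normal_pdfE// mulr_gt0 ?normal_peak_gt0 ?expR_gt0. Qed.

Lemma normal_likelihood_ratio (m' s' : R) : s' != 0 ->
  (\int[P]_w (normal_pdf m' s' (X w) / normal_pdf m s (X w))%:E = 1)%E.
Proof.
move=> s'0; have s0' : s != 0 by rewrite gt_eqF.
have inv_powR x : (normal_pdf m s x)^-1 = (normal_pdf m s x) `^ (-1).
  by rewrite powR_inv1// normal_pdf_ge0.
rewrite (ge0_integral_normal_law (f := fun x => normal_pdf m' s' x / normal_pdf m s x)).
- rewrite -[RHS](integral_normal_pdf m' s'); apply: eq_integral => x _.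
  by rewrite divfK// gt_eqF ?normal_pdf_gt0.
- apply: measurable_funM; first exact: measurable_normal_pdf.
  under eq_fun do rewrite inv_powR.
  exact: (measurableT_comp (measurable_powR (-1)) (measurable_normal_pdf m s)).
- by move=> x; rewrite divr_ge0// normal_pdf_ge0.
Qed.

Lemma integral_unscale (k : R) (h : Om -> R) : 0 < k -> measurable_fun setT h ->
  (forall w, 0 <= h w) -> (\int[P]_w (k * h w)%:E = 1)%E ->
  (\int[P]_w (h w)%:E = (k^-1)%:E)%E.
Proof.
move=> k0 mh h0; under eq_integral do rewrite EFinM.
rewrite ge0_integralZl//; [|exact/measurable_EFinP|by move=> w _; rewrite lee_fin|by rewrite lee_fin ltW].
move=> e; rewrite -[LHS]mul1e -(_ : (k^-1)%:E * k%:E = 1)%E; first by rewrite -muleA e mule1.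
by rewrite -EFinM mulVf// gt_eqF.
Qed.

Lemma normal_tilt (a : R) :
  (\int[P]_w (expR (a * (X w - m)))%:E = (expR (a ^+ 2 * s ^+ 2 / 2))%:E)%E.
Proof.
have s0' : s != 0 by rewrite gt_eqF.
have lr := @normal_likelihood_ratio (m + a * s ^+ 2) s s0'.
rewrite -[a ^+ 2 * _ / 2]opprK expRN; apply: integral_unscale; first exact: expR_gt0.
- apply: measurableT_comp => //; apply: measurable_funM => //.
  exact: measurable_funB.
- by move=> w; exact: expR_ge0.
rewrite -lr; apply: eq_integral => w _; rewrite !normal_pdfE//; congr EFin.
rewrite -mulf_div divff ?gt_eqF ?normal_peak_gt0// mul1r -expRN /normal_fun -!expRD.
congr expR; field.
exact: s0'.
Qed.

Lemma normal_quadratic_tilt (th : R) : th * s ^+ 2 < 1 ->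
  (\int[P]_w (expR (th * (X w - m) ^+ 2 / 2))%:E = ((Num.sqrt (1 - th * s ^+ 2))^-1)%:E)%E.
Proof.
move=> th1; have s0' : s != 0 by rewrite gt_eqF.
have q0 : 0 < 1 - th * s ^+ 2 by rewrite subr_gt0.
pose q := Num.sqrt (1 - th * s ^+ 2).
have sq0 : 0 < q by rewrite sqrtr_gt0.
have q2 : q ^+ 2 = 1 - th * s ^+ 2 by rewrite sqr_sqrtr// ltW.
pose s' := s / q; have s'0 : s' != 0 by rewrite mulf_neq0// invr_eq0 gt_eqF.
have lr := @normal_likelihood_ratio m s' s'0.
apply: integral_unscale => //.
- apply: measurableT_comp => //; apply: measurable_funM => //.
  by apply: measurable_funM => //; apply: measurable_funX; exact: measurable_funB.
rewrite -lr; apply: eq_integral => w _; rewrite !normal_pdfE//; congr EFin.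
rewrite -mulf_div; congr (_ * _).
  have A0 : 0 < s ^+ 2 * pi *+ 2 by rewrite mulrn_wgt0// mulr_gt0 ?pi_gt0// exprn_gt0.
  rewrite /normal_peak invrK.
  have -> : s' ^+ 2 * pi *+ 2 = (s ^+ 2 * pi *+ 2) * q^-1 ^+ 2 by rewrite /s'; ring.
  rewrite sqrtrM ?(ltW A0)// sqrtr_sqr ger0_norm ?invr_ge0 ?(ltW sq0)//.
  have : Num.sqrt (s ^+ 2 * pi *+ 2) != 0 by rewrite gt_eqF// sqrtr_gt0.
  by move=> h; rewrite invfM invrK mulrAC mulVf// mul1r.
rewrite /normal_fun -expRN -expRD; congr expR; rewrite /s'.
have -> : th = (1 - q ^+ 2) / s ^+ 2 by rewrite q2; field.
by field; rewrite s0' gt_eqF.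
Qed.

End NormalMoments.

Section GaussianMoments.
Context {R : realType} {d : measure_display} {Om : measurableType d}.
Variable P : probability Om R.
Local Notation mR := (measurableTypeR R).
Local Notation "''E' f" := (Rintegral P setT f) (at level 10, f at next level).
Implicit Types X Y : Om -> R.

Definition intg X := P.-integrable setT (EFin \o X).

Lemma intg_cst (c : R) : intg (fun=> c).
Proof. exact: finite_measure_integrable_cst. Qed.

Lemma intgD X Y : intg X -> intg Y -> intg (fun w => X w + Y w).
Proof. by move=> iX iY; apply: (integrableD measurableT iX iY). Qed.

Lemma intgZ (c : R) X : intg X -> intg (fun w => c * X w).
Proof. by move=> iX; apply: (integrableZl measurableT c iX). Qed.

Lemma le_intg X Y : measurable_fun setT X -> (forall w, `|X w| <= Y w) -> intg Y -> intg X.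
Proof.
move=> mX XY iY; apply: (le_integrable measurableT _ _ iY); first exact/measurable_EFinP.
by move=> w _; rewrite /= lee_fin (le_trans (XY w))// ler_norm.
Qed.

Lemma exp_D X Y : intg X -> intg Y -> 'E (fun w => X w + Y w) = 'E X + 'E Y.
Proof. by move=> iX iY; rewrite RintegralD. Qed.

Lemma exp_Z (c : R) X : intg X -> 'E (fun w => c * X w) = c * 'E X.
Proof. by move=> iX; rewrite RintegralZl. Qed.

Lemma exp_cst (c : R) : 'E (fun=> c) = c.
Proof. by rewrite Rintegral_cst// (_ : fine _ = 1) ?mulr1// -[RHS]/(fine 1%E) -(probability_setT P). Qed.

Lemma exp_le X Y : intg X -> intg Y -> (forall w, X w <= Y w) -> 'E X <= 'E Y.
Proof. by move=> iX iY XY; apply: le_Rintegral. Qed.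

Lemma intg_of_exp X (r : R) : measurable_fun setT X -> (forall w, 0 <= X w) ->
  (\int[P]_w (X w)%:E = r%:E)%E -> intg X /\ 'E X = r.
Proof.
move=> mX X0 e; split; last by rewrite /Rintegral e.
apply/integrableP; split; first exact/measurable_EFinP.
rewrite (eq_integral (fun w => (X w)%:E)) ?e ?ltry// => w _ /=.
by rewrite ger0_norm.
Qed.

Section NormalLaw.
Variables (X : Om -> R) (m s : R).
Hypothesis mX : measurable_fun setT (X : Om -> mR).
Hypothesis s0 : 0 < s.
Hypothesis lawX : forall A : set mR, measurable A -> P (X @^-1` A) = normal_prob m s A.

Let Y w := X w - m.

Let mY : measurable_fun setT Y. Proof. exact: measurable_funB. Qed.

Let tilt (a : R) : intg (fun w => expR (a * Y w)) /\
  'E (fun w => expR (a * Y w)) = expR (a ^+ 2 * s ^+ 2 / 2).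
Proof.
apply: intg_of_exp; last exact: (normal_tilt mX s0 lawX).
- by apply: measurableT_comp => //; exact: measurable_funM.
- by move=> w; exact: expR_ge0.
Qed.

Let qtilt (th : R) : th * s ^+ 2 < 1 ->
  intg (fun w => expR (th * Y w ^+ 2 / 2)) /\
  'E (fun w => expR (th * Y w ^+ 2 / 2)) = (Num.sqrt (1 - th * s ^+ 2))^-1.
Proof.
move=> th1; apply: intg_of_exp; last exact: (normal_quadratic_tilt mX s0 lawX).
- apply: measurableT_comp => //; apply: measurable_funM => //.
  by apply: measurable_funM => //; exact: measurable_funX.
- by move=> w; exact: expR_ge0.
Qed.

Lemma normal_intg_centered : intg Y.
Proof.
apply: (@le_intg _ (fun w => expR (1 * Y w) + expR (-1 * Y w))) => //.
  move=> w; rewrite mul1r mulN1r.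
  have h1 := expR_ge1Dx (Y w); have h2 := expR_ge1Dx (- Y w).
  have h3 := expR_ge0 (Y w); have h4 := expR_ge0 (- Y w).
  by rewrite ler_norml; apply/andP; split; lra.
by apply: intgD; case: (tilt 1); case: (tilt (-1)).
Qed.

Lemma normal_intg_centered2 : intg (fun w => Y w ^+ 2).
Proof.
pose th := (s ^+ 2 *+ 2)^-1.
have s20 : 0 < s ^+ 2 by rewrite exprn_gt0.
have th0 : 0 < th by rewrite invr_gt0 mulrn_wgt0.
have th1 : th * s ^+ 2 < 1.
  rewrite /th mulrC -mulr_natr invfM mulrA divff ?gt_eqF// mul1r invf_lt1// ltr1n//.
apply: (@le_intg _ (fun w => (2 / th) * expR (th * Y w ^+ 2 / 2))).
- exact: measurable_funX.
- move=> w; rewrite ger0_norm ?sqr_ge0//.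
  apply: (@le_trans _ _ ((2 / th) * (th * Y w ^+ 2 / 2))).
    by rewrite le_eqVlt; apply/orP; left; apply/eqP; field; lra.
  rewrite ler_wpM2l ?divr_ge0 ?(ltW th0)//.
  by apply: le_trans (expR_ge1Dx _); rewrite lerDr.
- by apply: intgZ; case: (qtilt th1).
Qed.

Lemma normal_mean_centered : 'E Y = 0.
Proof.
have s20 : 0 < s ^+ 2 by rewrite exprn_gt0.
have key (a : R) : a ^+ 2 * s ^+ 2 <= 1 -> a * 'E Y <= a ^+ 2 * s ^+ 2.
  move=> a1; have [ia ea] := tilt a.
  have : 'E (fun w => 1 + a * Y w) <= 'E (fun w => expR (a * Y w)).
    apply: exp_le => // [|w]; last exact: expR_ge1Dx.
    by apply: intgD; [exact: intg_cst|apply: intgZ; exact: normal_intg_centered].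
  rewrite ea exp_D; [|exact: intg_cst|apply: intgZ; exact: normal_intg_centered].
  rewrite exp_cst exp_Z; last exact: normal_intg_centered.
  have q0 : 0 <= a ^+ 2 * s ^+ 2 by rewrite mulr_ge0 ?sqr_ge0.
  move: a1 q0; set q := a ^+ 2 * s ^+ 2; set b := a * 'E Y => a1 q0 le1.
  suff : expR (q / 2) <= 1 + q by lra.
  have h := expR_ge1Dx (- (q / 2)); rewrite expRN in h.
  have e0 : 0 < expR (q / 2) by exact: expR_gt0.
  have : (1 - q / 2) * expR (q / 2) <= 1.
    by rewrite -ler_pdivlMr// div1r.
  nra.
apply/eqP; rewrite eq_le; apply/andP; split; apply/ler_addgt0Pr => e e0.
  pose a := Num.min (e / s ^+ 2) s^-1.
  have a0 : 0 < a by rewrite lt_min divr_gt0//= invr_gt0.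
  have a1 : a * s <= 1 by rewrite -ler_pdivlMr// div1r ge_min lexx orbT.
  have a2 : a * s ^+ 2 <= e by rewrite -ler_pdivlMr// ge_min lexx.
  have h := key a; rewrite add0r.
  have : a * 'E Y <= a * e.
    apply: (le_trans (h _)); first by rewrite -exprMn exprn_ile1// mulr_ge0// ltW.
    by rewrite expr2 -mulrA ler_wpM2l// ltW.
  by rewrite ler_pM2l.
pose a := Num.min (e / s ^+ 2) s^-1.
have a0 : 0 < a by rewrite lt_min divr_gt0//= invr_gt0.
have a1 : a * s <= 1 by rewrite -ler_pdivlMr// div1r ge_min lexx orbT.
have a2 : a * s ^+ 2 <= e by rewrite -ler_pdivlMr// ge_min lexx.
have h := key (- a); rewrite sqrrN mulNr in h.
have : a * - 'E Y <= a * e.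
  rewrite mulrN; apply: (le_trans (h _)); first by rewrite -exprMn exprn_ile1// mulr_ge0// ltW.
  by rewrite expr2 -mulrA ler_wpM2l// ltW.
by rewrite ler_pM2l// => ?; lra.
Qed.

Lemma normal_variance_centered : 'E (fun w => Y w ^+ 2) = s ^+ 2.
Proof.
have s20 : 0 < s ^+ 2 by rewrite exprn_gt0.
set V := 'E _.
have key (th : R) : `|th * s ^+ 2| <= 2^-1 -> th * V <= th * s ^+ 2 + (th * s ^+ 2) ^+ 2 *+ 2.
  move=> hth; have th1 : th * s ^+ 2 < 1.
    by rewrite (le_lt_trans (ler_norm _))// (le_lt_trans hth)// invf_lt1// ltr1n.
  have [ia ea] := qtilt th1.
  have i2 : intg (fun w => th / 2 * Y w ^+ 2) by apply: intgZ; exact: normal_intg_centered2.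
  have : 'E (fun w => 1 + th / 2 * Y w ^+ 2) <= 'E (fun w => expR (th * Y w ^+ 2 / 2)).
    apply: exp_le => // [|w]; first by apply: intgD => //; exact: intg_cst.
    by rewrite mulrAC; exact: expR_ge1Dx.
  rewrite ea exp_D//; last exact: intg_cst.
  rewrite exp_cst exp_Z -/V; last exact: normal_intg_centered2.
  move: hth th1; set y := th * s ^+ 2 => hy y1.
  have q0 : 0 < Num.sqrt (1 - y) by rewrite sqrtr_gt0 subr_gt0.
  have qq : Num.sqrt (1 - y) ^+ 2 = 1 - y by rewrite sqr_sqrtr// subr_ge0 ltW.
  have B0 : 0 < 1 + y / 2 + y ^+ 2 by move: hy; rewrite ler_norml => /andP[? ?]; nra.
  suff : (Num.sqrt (1 - y))^-1 <= 1 + y / 2 + y ^+ 2.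
    by move=> h1 h2; rewrite mulr2n; lra.
  rewrite -[leLHS]mul1r ler_pdivrMr//.
  rewrite -ler_sqr ?nnegrE ?mulr_ge0 ?(ltW B0) ?(ltW q0)// expr1n exprMn qq.
  have -> : (1 + y / 2 + y ^+ 2) ^+ 2 * (1 - y) = 1 + y ^+ 2 * ((1 - y) * (5 / 4) - y ^+ 3) by field.
  rewrite lerDl mulr_ge0 ?sqr_ge0//.
  move: hy; rewrite ler_norml => /andP[? ?].
  have : y ^+ 3 <= 8^-1 by nra.
  lra.
apply/eqP; rewrite eq_le; apply/andP; split; apply/ler_addgt0Pr => e e0.
  pose th := Num.min (e / (s ^+ 4 *+ 2)) (2^-1 / s ^+ 2).
  have s4 : 0 < s ^+ 4 *+ 2 by rewrite mulrn_wgt0// exprn_gt0.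
  have th0 : 0 < th by rewrite lt_min !divr_gt0// invr_gt0.
  have t1 : th * s ^+ 2 <= 2^-1 by rewrite -ler_pdivlMr// ge_min lexx orbT.
  have t2 : th * (s ^+ 4 *+ 2) <= e by rewrite -ler_pdivlMr// ge_min lexx.
  have ts : 0 <= th * s ^+ 2 by exact: mulr_ge0 (ltW th0) (ltW s20).
  have := key th; rewrite ger0_norm// => /(_ t1) h.
  rewrite -(ler_pM2l th0); apply: (le_trans h).
  have -> : th * s ^+ 2 + (th * s ^+ 2) ^+ 2 *+ 2 = th * (s ^+ 2 + th * (s ^+ 4 *+ 2)) by ring.
  by rewrite ler_pM2l// lerD2l.
pose th := Num.min (e / (s ^+ 4 *+ 2)) (2^-1 / s ^+ 2).
have s4 : 0 < s ^+ 4 *+ 2 by rewrite mulrn_wgt0// exprn_gt0.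
have th0 : 0 < th by rewrite lt_min !divr_gt0// invr_gt0.
have t1 : th * s ^+ 2 <= 2^-1 by rewrite -ler_pdivlMr// ge_min lexx orbT.
have t2 : th * (s ^+ 4 *+ 2) <= e by rewrite -ler_pdivlMr// ge_min lexx.
have ts : 0 <= th * s ^+ 2 by exact: mulr_ge0 (ltW th0) (ltW s20).
have := key (- th); rewrite mulNr normrN ger0_norm// => /(_ t1) h.
rewrite -(ler_pM2l th0).
have e1 : th * (V + e) = th * e - (- th * V) by ring.
have e2 : th * s ^+ 2 = th * (th * (s ^+ 4 *+ 2)) - (- (th * s ^+ 2) + (- (th * s ^+ 2)) ^+ 2 *+ 2) by ring.
by rewrite e1 e2 lerB// ler_pM2l.
Qed.

End NormalLaw.

Lemma dirac_law_exp X (m : R) (f : R -> R) :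
  (forall A : set mR, measurable A -> P (X @^-1` A) = \d_m A) ->
  measurable_fun setT (X : Om -> mR) ->
  measurable_fun setT (fun w => f (X w)) ->
  intg (fun w => f (X w)) /\ 'E (fun w => f (X w)) = f m.
Proof.
move=> lawX mX mf.
have mN : measurable (~` [set m] : set mR) by apply: measurableC; exact: measurable_set1.
have PN : P (X @^-1` (~` [set m])) = 0%E.
  by rewrite lawX// diracE memNset//= => /(_ erefl).
have mXN : measurable (X @^-1` (~` [set m])) by rewrite -[X in measurable X]setTI; exact: mX.
have ae (h : R -> R) : ae_eq P setT (fun w => (h (X w))%:E) (fun=> (h m)%:E).
  exists (X @^-1` (~` [set m])); split => // w /=.
  by apply: contra_not => ->.
split.
  apply/integrableP; split; first exact/measurable_EFinP.
  rewrite (ge0_ae_eq_integral _ _ _ _ _ (ae (fun x => `|f x|)))//.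
  - by rewrite integral_cst//= probability_setT mule1 ltry.
  - by apply/measurable_EFinP; exact: measurableT_comp.
have ef : (\int[P]_w (f (X w))%:E = \int[P]_w (f m)%:E)%E.
  by apply: ae_eq_integral => //; exact/measurable_EFinP.
rewrite /Rintegral ef.
by rewrite integral_cst//= probability_setT mule1.
Qed.

Lemma gaussian_rv_intg X : gaussian_rv P X -> intg X /\ intg (fun w => X w ^+ 2).
Proof.
move=> [mX [m [s [s0 lawX]]]].
have [se|sn] := eqVneq s 0.
  have lawX' A : measurable A -> P (X @^-1` A) = \d_m A.
    by move=> mA; rewrite lawX// /gaussian_law se eqxx.
  split; first by case: (dirac_law_exp (f := id) lawX').
  by case: (dirac_law_exp (f := fun x => x ^+ 2) lawX') => //; exact: measurable_funX.
have s1 : 0 < s by rewrite lt_neqAle eq_sym sn.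
have lawX' A : measurable A -> P (X @^-1` A) = normal_prob m s A.
  by move=> mA; rewrite lawX// /gaussian_law (negbTE sn).
have i1 := normal_intg_centered mX s1 lawX'; have i2 := normal_intg_centered2 mX s1 lawX'.
have e1 : X = fun w => (X w - m) + m by apply/funext => w; rewrite subrK.
have e2 : (fun w => X w ^+ 2) = fun w => (X w - m) ^+ 2 + ((m *+ 2) * (X w - m) + m ^+ 2).
  by apply/funext => w; ring.
split; first by rewrite e1; apply: intgD => //; exact: intg_cst.
rewrite e2; apply: intgD => //; apply: intgD; last exact: intg_cst.
exact: intgZ.
Qed.

Lemma gaussian_rv_law X (sigma : R) : gaussian_rv P X -> 'E X = 0 ->
  'E (fun w => X w ^+ 2) = sigma ^+ 2 -> 0 < sigma ->
  forall A : set mR, measurable A -> P (X @^-1` A) = normal_prob 0 sigma A.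
Proof.
move=> gX EX EX2 sig0; have [iX iX2] := gaussian_rv_intg gX.
have [mX [m [s [s0 lawX]]]] := gX.
have [se|sn] := eqVneq s 0.
  have lawX' A : measurable A -> P (X @^-1` A) = \d_m A.
    by move=> mA; rewrite lawX// /gaussian_law se eqxx.
  have [_ e1] := dirac_law_exp (f := id) lawX' mX mX.
  have [_ e2] := dirac_law_exp (f := fun x => x ^+ 2) lawX' mX (measurable_funX 2 mX).
  exfalso; have : 0 < sigma ^+ 2 by rewrite exprn_gt0.
  by rewrite -EX2 e2 -[m]/(id m) -e1 [X in X ^+ 2]EX expr0n ltxx.
have s1 : 0 < s by rewrite lt_neqAle eq_sym sn.
have lawX' A : measurable A -> P (X @^-1` A) = normal_prob m s A.
  by move=> mA; rewrite lawX// /gaussian_law (negbTE sn).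
have := normal_mean_centered mX s1 lawX'; rewrite exp_D//; last exact: intg_cst.
rewrite EX exp_cst add0r => /eqP; rewrite oppr_eq0 => /eqP m0.
have := normal_variance_centered mX s1 lawX'; rewrite m0.
rewrite (_ : (fun w => _) = fun w => X w ^+ 2); last by apply/funext => w; rewrite subr0.
rewrite EX2 => /eqP; rewrite eqf_sqr => /orP[/eqP ->|/eqP e]; first by rewrite -m0.
by exfalso; lra.
Qed.

(* On [x <= y] the density is at most [expR (- x^2 / (2 s^2))] times the
   density translated by [x]. *)
Lemma normal_prob_tail (s x : R) : 0 < s -> 0 <= x ->
  (normal_prob 0 s [set y : R | x <= y]%R <= (expR (- (x ^+ 2 / (s ^+ 2 *+ 2))))%:E)%E.
Proof.
move=> s0 x0; have sn : s != 0 by rewrite gt_eqF.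
have mI : measurable ([set y : R | x <= y] : set mR).
  rewrite (_ : [set _ | _] = `[x, +oo[%classic); first exact: measurable_itv.
  by apply/seteqP; split => y /=; rewrite in_itv/= andbT.
set c := expR _; set I := [set y | _] in mI *.
apply: (@le_trans _ _ (\int[@lebesgue_measure R]_(y in I) (c%:E * (normal_pdf x s y)%:E))%E).
  apply: ge0_le_integral => //.
  - by move=> y _; rewrite lee_fin normal_pdf_ge0.
  - by apply/measurable_funTS/measurable_EFinP; exact: measurable_normal_pdf.
  - by apply: emeasurable_funM => //; apply/measurable_funTS/measurable_EFinP; exact: measurable_normal_pdf.
  - move=> y /= xy; rewrite -EFinM lee_fin !normal_pdfE// mulrCA ler_wpM2l ?normal_peak_ge0//.
    rewrite /normal_fun -expRD ler_expR subr0.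
    have s2 : 0 < (s ^+ 2 *+ 2)^-1 by rewrite invr_gt0 mulrn_wgt0// exprn_gt0.
    have -> : - (x ^+ 2 / (s ^+ 2 *+ 2)) + - (y - x) ^+ 2 / (s ^+ 2 *+ 2) =
      (- (x ^+ 2) - (y - x) ^+ 2) / (s ^+ 2 *+ 2) by ring.
    rewrite ler_pM2r//; have yx : 0 <= y - x by rewrite subr_ge0.
    by have := mulr_ge0 x0 yx; rewrite !expr2; nra.
rewrite ge0_integralZl//; last 3 first.
- by apply/measurable_funTS/measurable_EFinP; exact: measurable_normal_pdf.
- by move=> y _; rewrite lee_fin normal_pdf_ge0.
- by rewrite lee_fin expR_ge0.
rewrite -[leRHS]mule1 lee_wpmul2l ?lee_fin ?expR_ge0//.
exact: (probability_le1 (normal_prob x s) mI).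
Qed.

Lemma normal_prob_interval (s x y : R) : 0 < s -> 0 <= x -> x <= y ->
  (((y - x) * normal_pdf 0 s y)%:E <= normal_prob 0 s `[x, y]%classic)%E.
Proof.
move=> s0 x0 xy; have sn : s != 0 by rewrite gt_eqF.
have -> : ((y - x) * normal_pdf 0 s y)%:E =
   (\int[@lebesgue_measure R]_(z in `[x, y]%classic) (normal_pdf 0 s y)%:E)%E.
  rewrite integral_cst//= lebesgue_measure_itv/= lte_fin.
  case: ifPn => xy'; first by rewrite -EFinB -EFinM mulrC.
  rewrite mule0; congr EFin; have -> : y - x = 0 by move: xy'; rewrite -leNgt; lra.
  by rewrite mul0r.
apply: ge0_le_integral => //.
- by move=> z _; rewrite lee_fin normal_pdf_ge0.
- by apply/measurable_funTS/measurable_EFinP; exact: measurable_normal_pdf.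
- move=> z /=; rewrite in_itv/= => /andP[xz zy]; rewrite lee_fin !normal_pdfE//.
  rewrite ler_wpM2l ?normal_peak_ge0// /normal_fun ler_expR !subr0 !mulNr lerN2.
  have s2 : 0 < (s ^+ 2 *+ 2)^-1 by rewrite invr_gt0 mulrn_wgt0// exprn_gt0.
  by rewrite ler_pM2r// lerXn2r// nnegrE; lra.
Qed.

End GaussianMoments.

Section MeasurableModulus.
Context {R : realType} {d : measure_display} {T : measurableType d}.

Lemma measurable_modulusB (f : T -> R[i]) (z : R[i]) :
  measurable_fun setT (fun w => complex.Re (f w)) ->
  measurable_fun setT (fun w => complex.Im (f w)) ->
  measurable_fun setT (fun w => modulus (f w - z)).
Proof.
move=> mfr mfi; have mr : measurable_fun setT (fun w => complex.Re (f w - z)).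
  by under eq_fun do rewrite cReD; exact: measurable_funD.
have mi : measurable_fun setT (fun w => complex.Im (f w - z)).
  by under eq_fun do rewrite cImD; exact: measurable_funD.
have m2 := measurable_funD (measurable_funX 2 mr) (measurable_funX 2 mi).
have := measurableT_comp (continuous_measurable_fun (@sqrt_continuous R)) m2.
by congr measurable_fun; apply/funext => w; rewrite modulusE.
Qed.

Lemma measurable_ge (f : T -> R) (r : R) : measurable_fun setT f ->
  measurable [set w | r <= f w].
Proof.
move=> mf; rewrite (_ : [set w | r <= f w] = setT `&` f @^-1` `[r, +oo[%classic).
  by apply: mf => //; exact: measurable_itv.
by apply/seteqP; split => w; rewrite /= in_itv/= andbT => // -[].
Qed.

Lemma measurable_le (f : T -> R) (r : R) : measurable_fun setT f ->
  measurable [set w | f w <= r].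
Proof.
move=> mf; rewrite (_ : [set w | f w <= r] = setT `&` f @^-1` `]-oo, r]%classic).
  by apply: mf => //; exact: measurable_itv.
by apply/seteqP; split => w; rewrite /= in_itv//= => -[].
Qed.

Lemma le_measure_bigsetU (mu : {measure set T -> \bar R}) (I : Type) (s : seq I) (p : pred I)
    (A : set T) (F : I -> set T) : measurable A -> (forall i, measurable (F i)) ->
  A `<=` \big[setU/set0]_(i <- s | p i) F i -> (mu A <= \sum_(i <- s | p i) mu (F i))%E.
Proof.
move=> mA mF AF; have mU : measurable (\big[setU/set0]_(i <- s | p i) F i).
  by apply: bigsetU_measurable => i _.
apply: (@le_trans _ _ (mu (\big[setU/set0]_(i <- s | p i) F i))).
  by apply: le_measure; rewrite ?inE.
clear A mA AF mU; elim: s => [|i s IH]; first by rewrite !big_nil measure0.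
rewrite !big_cons; case: ifP => // _; apply: (@le_trans _ _ (mu (F i) + mu (\big[setU/set0]_(j <- s | p j) F j))%E).
  by apply: measureU2 => //; apply: bigsetU_measurable => j _.
by rewrite leeD2l.
Qed.

End MeasurableModulus.

Section StandardComplexGaussian.
Context {R : realType} {d : measure_display} {Om : measurableType d}.
Variable P : probability Om R.
Local Notation mR := (measurableTypeR R).
Local Notation "''E' f" := (Rintegral P setT f) (at level 10, f at next level).

Definition std_gaussian (Z : Om -> R[i]) :=
  [/\ complex_gaussian P Z, cexpectation P Z = 0, cexpectation P (fun w => Z w * Z w) = 0 &
      cexpectation P (fun w => Z w * conjc (Z w)) = 1].

Section OneGaussian.
Variable Z : Om -> R[i].
Hypothesis stdZ : std_gaussian Z.

Lemma std_gaussian_Re : gaussian_rv P (fun w => complex.Re (Z w)).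
Proof.
have [cg _ _ _] := stdZ; have := cg 1 0.
by rewrite (_ : (fun w => _) = fun w => complex.Re (Z w))//; apply/funext => w; ring.
Qed.

Lemma std_gaussian_Im : gaussian_rv P (fun w => complex.Im (Z w)).
Proof.
have [cg _ _ _] := stdZ; have := cg 0 1.
by rewrite (_ : (fun w => _) = fun w => complex.Im (Z w))//; apply/funext => w; ring.
Qed.

Lemma std_gaussian_measurable_Re : measurable_fun setT (fun w => complex.Re (Z w)).
Proof. by case: std_gaussian_Re. Qed.

Lemma std_gaussian_measurable_Im : measurable_fun setT (fun w => complex.Im (Z w)).
Proof. by case: std_gaussian_Im. Qed.

Lemma cexpectation_ReE (f : Om -> R[i]) (z : R[i]) :
  cexpectation P f = z -> 'E (fun w => complex.Re (f w)) = complex.Re z.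
Proof. by move=> <-; rewrite /cexpectation/= unlock. Qed.

Lemma cexpectation_ImE (f : Om -> R[i]) (z : R[i]) :
  cexpectation P f = z -> 'E (fun w => complex.Im (f w)) = complex.Im z.
Proof. by move=> <-; rewrite /cexpectation/= unlock. Qed.

Lemma std_gaussian_law (al be : R) : 0 < al ^+ 2 + be ^+ 2 ->
  forall A : set mR, measurable A ->
  P ((fun w => al * complex.Re (Z w) + be * complex.Im (Z w)) @^-1` A) =
  normal_prob 0 (Num.sqrt ((al ^+ 2 + be ^+ 2) / 2)) A.
Proof.
move=> ab0; have [cg e1 e2 e3] := stdZ.
have [iX iX2] := gaussian_rv_intg std_gaussian_Re.
have [iY iY2] := gaussian_rv_intg std_gaussian_Im.
set X := fun w => complex.Re (Z w) in iX iX2; set Y := fun w => complex.Im (Z w) in iY iY2.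
have mX : measurable_fun setT X := std_gaussian_measurable_Re.
have mY : measurable_fun setT Y := std_gaussian_measurable_Im.
have iXY : intg P (fun w => X w * Y w).
  apply: (@le_intg _ _ _ _ _ (fun w => X w ^+ 2 + Y w ^+ 2)); first exact: measurable_funM.
    move=> w; have := sqr_ge0 (X w - Y w); have := sqr_ge0 (X w + Y w).
    by rewrite !expr2 => h1 h2; rewrite ler_norml; apply/andP; split; nra.
  exact: intgD.
have EX : 'E X = 0 := cexpectation_ReE e1.
have EY : 'E Y = 0 := cexpectation_ImE e1.
have EXY : 'E (fun w => X w * Y w) = 0.
  have := cexpectation_ImE e2; rewrite (_ : (fun w => _) = fun w => 2 * (X w * Y w)).
    by rewrite exp_Z// => /eqP; rewrite mulf_eq0 pnatr_eq0/= => /eqP.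
  by apply/funext => w; rewrite cImM /X /Y; ring.
have E1 : 'E (fun w => X w ^+ 2) - 'E (fun w => Y w ^+ 2) = 0.
  have := cexpectation_ReE e2; rewrite (_ : (fun w => _) = fun w => X w ^+ 2 + (-1) * Y w ^+ 2).
    by rewrite exp_D ?exp_Z//; [rewrite mulN1r|exact: intgZ].
  by apply/funext => w; rewrite cReM /X /Y; ring.
have E2 : 'E (fun w => X w ^+ 2) + 'E (fun w => Y w ^+ 2) = 1.
  have := cexpectation_ReE e3; rewrite (_ : (fun w => _) = fun w => X w ^+ 2 + Y w ^+ 2).
    by rewrite exp_D.
  by apply/funext => w; rewrite cReM cReJ cImJ /X /Y; ring.
have q0 : 0 < (al ^+ 2 + be ^+ 2) / 2 by rewrite divr_gt0.
apply: (gaussian_rv_law (cg al be)) => //; last by rewrite sqrtr_gt0.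
- rewrite exp_D; [|exact: intgZ|exact: intgZ].
  by rewrite !exp_Z// EX EY !mulr0 addr0.
- rewrite sqr_sqrtr ?(ltW q0)//.
  rewrite (_ : (fun w => _) = fun w => al ^+ 2 * X w ^+ 2 + (be ^+ 2 * Y w ^+ 2 + (al * be *+ 2) * (X w * Y w))).
    rewrite exp_D; [|exact: intgZ|by apply: intgD; exact: intgZ].
    rewrite exp_D; [|exact: intgZ|exact: intgZ].
    rewrite !exp_Z// EXY mulr0 addr0.
    have -> : 'E (fun w => Y w ^+ 2) = 2^-1 by lra.
    have -> : 'E (fun w => X w ^+ 2) = 2^-1 by lra.
    ring.
  by apply/funext => w; rewrite /X /Y; ring.
Qed.

Lemma std_gaussian_half_plane (al be x : R) : 0 < al ^+ 2 + be ^+ 2 -> 0 <= x ->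
  (P [set w | x <= al * complex.Re (Z w) + be * complex.Im (Z w)]%R <=
   (expR (- (x ^+ 2 / (al ^+ 2 + be ^+ 2))))%:E)%E.
Proof.
move=> ab0 x0; have mI : measurable ([set y : R | x <= y] : set mR).
  rewrite (_ : [set _ | _] = `[x, +oo[%classic); first exact: measurable_itv.
  by apply/seteqP; split => y /=; rewrite in_itv/= andbT.
rewrite [X in (X <= _)%E](std_gaussian_law ab0 mI).
have q0 : 0 < (al ^+ 2 + be ^+ 2) / 2 by rewrite divr_gt0.
apply: (le_trans (normal_prob_tail _ x0)); first by rewrite sqrtr_gt0.
by rewrite lee_fin ler_expR lerN2 sqr_sqrtr ?(ltW q0)// -mulr_natr divfK.
Qed.

End OneGaussian.

(* Every unit vector is well approximated by a direction of the grid
   [(i / n, j / n)], so that only one-dimensional marginals are needed. *)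
Lemma grid_direction (n : nat) (x y : R) : (0 < n)%N -> x ^+ 2 + y ^+ 2 = 1 ->
  exists i j : int, [/\ i \in zrange n, j \in zrange n,
    1 - 2 / n%:R <= (i%:~R / n%:R) * x + (j%:~R / n%:R) * y,
    (i%:~R / n%:R) ^+ 2 + (j%:~R / n%:R) ^+ 2 <= 1 + 6 / n%:R :> R &
    (2 < n)%N -> 0 < (i%:~R / n%:R) ^+ 2 + (j%:~R / n%:R) ^+ 2 :> R].
Proof.
move=> n0 xy1; have N0 : 0 < n%:R :> R by rewrite ltr0n.
have N1 : 1 <= n%:R :> R by rewrite ler1n.
have bnd (z : R) : z ^+ 2 <= 1 -> -1 <= z /\ z <= 1.
  by move=> z1; rewrite !expr2 in z1 *; split; nra.
have [x1 x2] : -1 <= x /\ x <= 1 by apply: bnd; have := sqr_ge0 y; lra.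
have [y1 y2] : -1 <= y /\ y <= 1 by apply: bnd; have := sqr_ge0 x; lra.
have fl (z : R) : -1 <= z -> z <= 1 -> exists i : int, [/\ i \in zrange n,
    i%:~R / n%:R <= z & z < i%:~R / n%:R + n%:R^-1].
  move=> z1 z2; exists (Num.floor (z * n%:R)).
  have /andP[f1 f2] := floor_itv (z * n%:R).
  split.
  - rewrite mem_zrange.
    have : (Num.floor (z * n%:R) <= Posz n)%R.
      by rewrite -(ler_int R) (le_trans f1)// -[leRHS]mul1r ler_pM2r.
    have : (- Posz n <= Num.floor (z * n%:R))%R.
      by rewrite floor_ge_int mulrNz -mulN1r ler_pM2r.
    lia.
  - by rewrite ler_pdivrMr.
  - have -> : (Num.floor (z * n%:R))%:~R / n%:R + n%:R^-1 = ((Num.floor (z * n%:R))%:~R + 1) / n%:R :> R.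
      by rewrite mulrDl mul1r.
    by rewrite ltr_pdivlMr// -intrD1.
have [i [iz i1 i2]] := fl x x1 x2; have [j [jz j1 j2]] := fl y y1 y2.
exists i, j; move: i1 i2 j1 j2; set a : R := i%:~R / n%:R; set b : R := j%:~R / n%:R.
have n1 : 0 < (n%:R^-1 : R) <= 1 by rewrite invr_gt0 N0/= invf_le1.
move: n1; set q : R := n%:R^-1 => /andP[q0 q1] i1 i2 j1 j2.
have main : 1 - 2 * q <= a * x + b * y.
  have : (x - a) * x <= q by have [] := leP 0 x; nra.
  have : (y - b) * y <= q by have [] := leP 0 y; nra.
  by move: xy1; rewrite !expr2; nra.
split => //.
  have : (a - x) ^+ 2 <= q ^+ 2 by rewrite !expr2; nra.
  have : (b - y) ^+ 2 <= q ^+ 2 by rewrite !expr2; nra.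
  have : a ^+ 2 - x ^+ 2 <= q * 3 by rewrite !expr2; nra.
  have : b ^+ 2 - y ^+ 2 <= q * 3 by rewrite !expr2; nra.
  by move: xy1; rewrite !expr2; lra.
move=> n3; rewrite lt_neqAle addr_ge0 ?sqr_ge0// andbT eq_sym paddr_eq0 ?sqr_ge0//.
rewrite !sqrf_eq0; apply/negP => /andP[/eqP a0 /eqP b0].
move: main; rewrite a0 b0 !mul0r addr0.
have : q < 2^-1 by rewrite /q ltf_pV2 ?posrE// (ltr_nat R 2 n).
lra.
Qed.

Lemma std_gaussian_tail (ga : R) : ga < 1 -> exists J : R, 1 <= J /\
  forall Z, std_gaussian Z -> forall r, 0 <= r ->
  (P [set w | r <= modulus (Z w)]%R <= (J * expR (- (ga * r ^+ 2)))%:E)%E.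
Proof.
move=> ga1; pose n := (3 + Num.truncn (10 / (1 - ga)))%N.
have n10 : 10 / n%:R <= 1 - ga.
  rewrite ler_pdivrMr// mulrC -ler_pdivrMr ?subr_gt0//.
  have := truncnS_gt (10 / (1 - ga)); rewrite /n natrD -(natr1 (Num.truncn _)); lra.
pose grid := [seq (i, j) | i <- zrange n, j <- zrange n].
exists (1 + (size grid)%:R); split; first by rewrite lerDl.
move=> Z stdZ r r0; set c := expR _.
pose H (p : int * int) := [set w | (1 - 2 / n%:R) * r <=
   (p.1%:~R / n%:R) * complex.Re (Z w) + (p.2%:~R / n%:R) * complex.Im (Z w)].
have mRe := std_gaussian_measurable_Re stdZ; have mIm := std_gaussian_measurable_Im stdZ.
have mH p : measurable (H p).
  by apply: measurable_ge; apply: measurable_funD; exact: measurable_funM.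
pose ok (p : int * int) := (p.1%:~R / n%:R) ^+ 2 + (p.2%:~R / n%:R) ^+ 2 <= 1 + 6 / n%:R :> R
  /\ 0 < (p.1%:~R / n%:R) ^+ 2 + (p.2%:~R / n%:R) ^+ 2 :> R.
have n2 : 0 <= 1 - 2 / n%:R :> R.
  by rewrite subr_ge0 ler_pdivrMr// mul1r ler_nat.
have PH p : ok p -> (P (H p) <= c%:E)%E.
  move=> [k1 k2]; apply: (le_trans (std_gaussian_half_plane stdZ k2 _)); first by rewrite mulr_ge0.
  rewrite lee_fin ler_expR lerN2 ler_pdivlMr// [((1 - 2 / n%:R) * r) ^+ 2]exprMn mulrAC ler_wpM2r ?sqr_ge0//.
  have [g0|g0] := leP ga 0; first by rewrite (le_trans _ (sqr_ge0 _))// mulr_le0_ge0// ltW.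
  apply: (@le_trans _ _ (ga * (1 + 6 / n%:R))); first by rewrite ler_pM2l.
  move: n10; set q := n%:R^-1 => n10; rewrite !expr2; nra.
have [r00|rn] := eqVneq r 0.
  have mE : measurable [set w | r <= modulus (Z w)].
    apply: measurable_ge; have := measurable_modulusB 0 mRe mIm.
    by under eq_fun do rewrite subr0.
  apply: (le_trans (probability_le1 P mE)).
  by rewrite lee_fin /c r00 expr0n/= mulr0 oppr0 expR0 mulr1 lerDl.
have {rn} r0 : 0 < r by rewrite lt_neqAle eq_sym rn.
have cover : [set w | r <= modulus (Z w)] `<=` \big[setU/set0]_(p <- grid | `[< ok p >]) H p.
  move=> w /= rZ; have Z0 : 0 < modulus (Z w) by exact: lt_le_trans rZ.
  have xy : (complex.Re (Z w) / modulus (Z w)) ^+ 2 + (complex.Im (Z w) / modulus (Z w)) ^+ 2 = 1.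
    rewrite !expr_div_n -mulrDl -modulus_sqr divff// expf_neq0// gt_eqF//.
  have [i [j [iz jz h1 h2 h3]]] := grid_direction (isT : (0 < n)%N) xy.
  rewrite -bigcup_seq_cond; exists (i, j).
    rewrite /=; apply/andP; split; first by apply/allpairsP; exists (i, j).
    by apply/asboolP; split => //; exact: h3.
  rewrite /H/=; apply: (@le_trans _ _ ((1 - 2 / n%:R) * modulus (Z w))); first by rewrite ler_wpM2l.
  by rewrite -ler_pdivlMr// [leRHS]mulrDl; move: h1; rewrite !mulrA.
have mE : measurable [set w | r <= modulus (Z w)].
  apply: measurable_ge; have := measurable_modulusB 0 mRe mIm.
  by under eq_fun do rewrite subr0.
apply: (@le_trans _ _ (\sum_(p <- grid | `[< ok p >]) P (H p))%E).
  exact: le_measure_bigsetU.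
apply: (@le_trans _ _ (\sum_(p <- grid | `[< ok p >]) c%:E)%E).
  by apply: lee_sum => p /asboolP; exact: PH.
rewrite sumEFin lee_fin big_const_seq iter_addr_0 -[leLHS]mulr_natl.
apply: ler_wpM2r; first exact: expR_ge0.
have : (count (fun p => `[< ok p >]) grid <= size grid)%N by exact: count_size.
by rewrite -(ler_nat R); lra.
Qed.

(* The half-plane bound for [Re (conj sigma * Z)], minus the event that [Z] is
   large, forces [Z] to be close to [kap * rho * sigma]. *)
Lemma std_gaussian_near (rho del e : R) : 0 <= rho -> 0 < del -> 0 < e ->
  exists K : R, 0 < K /\ forall kap, K <= kap ->
  forall Z, std_gaussian Z -> forall sigma, modulus sigma = 1 ->
  ((expR (- ((rho ^+ 2 + e) * kap ^+ 2)))%:E <=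
   P [set w | modulus (Z w - (kap * rho)%:C * sigma) <= kap * del]%R)%E.
Proof.
move=> rho0 del0 e0; pose dd := del / 2; have d0 : 0 < dd by rewrite divr_gt0.
pose m := Num.min e (dd ^+ 2 / 4).
have m0 : 0 < m by rewrite lt_min e0 divr_gt0// exprn_gt0.
have me : m <= e by rewrite ge_min lexx.
have md : m <= dd ^+ 2 / 4 by rewrite ge_min lexx orbT.
pose h := Num.min dd (m / (rho *+ 2 + dd)).
have rd : 0 < rho *+ 2 + dd by rewrite ltr_wpDl// mulrn_wge0.
have h0 : 0 < h by rewrite lt_min d0 divr_gt0.
have hd : h <= dd by rewrite ge_min lexx.
have hm : (rho + h) ^+ 2 <= rho ^+ 2 + m.
  have h1 : h * (rho *+ 2 + dd) <= m by rewrite -ler_pdivlMr// ge_min lexx orbT.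
  have h2 : h * h <= h * dd by rewrite ler_pM2l.
  have -> : (rho + h) ^+ 2 = rho ^+ 2 + (h * (rho *+ 2) + h * h) by ring.
  by rewrite lerD2l; rewrite mulrDr in h1; lra.
pose D := rho ^+ 2 + dd ^+ 2.
have rho2 := sqr_ge0 rho; have d2 : 0 < dd ^+ 2 by rewrite exprn_gt0.
have D0 : 0 < D by rewrite /D ltr_wpDl.
pose ga := (rho ^+ 2 + dd ^+ 2 / 2) / D.
have ga1 : ga < 1 by rewrite ltr_pdivrMr// mul1r /D; lra.
have [J [J1 tail]] := std_gaussian_tail ga1.
have sp0 : 0 < Num.sqrt (pi : R) by rewrite sqrtr_gt0 pi_gt0.
exists ((1 + J) * Num.sqrt pi / h); split.
  by rewrite divr_gt0// mulr_gt0//; lra.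
move=> kap Kk Z stdZ sigma s1.
have k0 : 0 < kap.
  by apply: lt_le_trans Kk; rewrite divr_gt0// mulr_gt0//; lra.
have mRe := std_gaussian_measurable_Re stdZ; have mIm := std_gaussian_measurable_Im stdZ.
pose al := complex.Re sigma; pose be := complex.Im sigma.
have ab1 : al ^+ 2 + be ^+ 2 = 1 by rewrite -modulus_sqr s1 expr1n.
pose X w := al * complex.Re (Z w) + be * complex.Im (Z w).
have mX : measurable_fun setT X by apply: measurable_funD; exact: measurable_funM.
pose B := X @^-1` `[rho * kap, (rho + h) * kap]%classic.
have mB : measurable B by rewrite -[B]setTI; apply: mX => //; exact: measurable_itv.
pose r := kap * Num.sqrt D.
have r0 : 0 <= r by rewrite mulr_ge0 ?sqrtr_ge0 ?(ltW k0).
pose Out := [set w | r <= modulus (Z w)].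
have mOut : measurable Out.
  apply: measurable_ge; have := measurable_modulusB 0 mRe mIm.
  by under eq_fun do rewrite subr0.
pose G := [set w | modulus (Z w - (kap * rho)%:C * sigma) <= kap * del].
have mG : measurable G by apply: measurable_le; exact: measurable_modulusB.
pose g := expR (- ((rho + h) ^+ 2 * kap ^+ 2)).
have g0 : 0 < g by exact: expR_gt0.
have PB : ((h * kap / Num.sqrt pi * g)%:E <= P B)%E.
  have ab0 : 0 < al ^+ 2 + be ^+ 2 by rewrite ab1.
  rewrite /B (std_gaussian_law stdZ ab0); last exact: measurable_itv.
  have s0 : 0 < Num.sqrt ((al ^+ 2 + be ^+ 2) / 2) by rewrite sqrtr_gt0 ab1.
  have x0 : 0 <= rho * kap by rewrite mulr_ge0// ltW.
  have xy : rho * kap <= (rho + h) * kap by rewrite ler_pM2r// lerDl ltW.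
  apply: le_trans (normal_prob_interval s0 x0 xy); rewrite lee_fin.
  rewrite normal_pdfE ?gt_eqF// /normal_peak /normal_fun sqr_sqrtr ?ab1//.
  have -> : 1 / 2 * pi *+ 2 = pi :> R by rewrite mulr2n; lra.
  have -> : - ((rho + h) * kap - 0) ^+ 2 / (1 / 2 *+ 2) = - ((rho + h) ^+ 2 * kap ^+ 2) :> R.
    by rewrite mulr2n subr0 exprMn; field.
  by rewrite le_eqVlt; apply/orP; left; apply/eqP; rewrite /g; ring.
have POut : (P Out <= (J * g)%:E)%E.
  apply: (le_trans (tail Z stdZ r r0)); rewrite lee_fin ler_pM2l ?ler_expR ?lerN2; last by lra.
  rewrite /r exprMn sqr_sqrtr ?(ltW D0)//.
  have -> : ga * (kap ^+ 2 * D) = (ga * D) * kap ^+ 2 by ring.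
  rewrite ler_wpM2r ?sqr_ge0//.
  by rewrite /ga divfK ?gt_eqF//; lra.
have sub : B `<=` G `|` Out.
  move=> w; rewrite /B/= in_itv/= => /andP[B1 B2].
  have [rZ|Zr] := leP r (modulus (Z w)); [by right|left; rewrite /G/=].
  pose Y := al * complex.Im (Z w) - be * complex.Re (Z w).
  have XY : X w ^+ 2 + Y ^+ 2 = modulus (Z w) ^+ 2.
    by rewrite modulus_sqr -[RHS]mul1r -ab1 /X /Y; ring.
  have e1 : modulus (Z w - (kap * rho)%:C * sigma) = modulus ((X w - kap * rho) +i* Y).
    have ss : conjc sigma * sigma = 1 by rewrite mulrC mul_conjc s1 expr1n.
    have -> : (X w - kap * rho) +i* Y = conjc sigma * (Z w - (kap * rho)%:C * sigma) :> R[i].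
      rewrite mulrBr mulrCA ss mulr1; apply: complex_ext.
        by rewrite cReD cReN cReM cReJ cImJ /= /X -/al -/be; ring.
      by rewrite cImD cImN cImM cReJ cImJ /= /Y -/al -/be; ring.
    by rewrite (modulusM (conjc sigma)) modulusJ s1 mul1r.
  rewrite e1; apply: (le_trans (ler_modulus_ReIm _)) => /=.
  have Y2 : Y ^+ 2 <= (kap * dd) ^+ 2.
    have Zr2 : modulus (Z w) ^+ 2 <= r ^+ 2 by rewrite lerXn2r ?nnegrE ?modulus_ge0// ltW.
    have X2 : (rho * kap) ^+ 2 <= X w ^+ 2.
      by rewrite lerXn2r ?nnegrE// ?mulr_ge0 ?(ltW k0)// (le_trans _ B1)// mulr_ge0// ltW.
    move: Zr2; rewrite /r exprMn sqr_sqrtr ?(ltW D0)// -XY /D mulrDr.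
    by move: X2; rewrite !exprMn (mulrC (rho ^+ 2)); lra.
  have Ya : `|Y| <= kap * dd.
    have kd : 0 <= kap * dd by rewrite mulr_ge0// ltW.
    by rewrite -[leRHS]ger0_norm// -ler_sqr ?nnegrE// !real_normK ?num_real.
  have Xa : `|X w - kap * rho| <= kap * dd.
    rewrite ger0_norm ?subr_ge0 1?mulrC// lerBlDl (le_trans B2)//.
    by rewrite mulrDl lerD2l mulrC ler_pM2l.
  have -> : kap * del = kap * dd + kap * dd by rewrite /dd; field.
  by rewrite lerD.
have PBG : (P B <= P G + P Out)%E.
  apply: (@le_trans _ _ (P (G `|` Out))).
    by apply: le_measure; rewrite ?inE//; exact: measurableU.
  exact: measureU2.
have : ((h * kap / Num.sqrt pi * g)%:E <= P G + (J * g)%:E)%E.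
  by apply: (le_trans PB); apply: (le_trans PBG); rewrite leeD2l.
rewrite -leeBlDr// -EFinB => PG; apply: le_trans PG; rewrite lee_fin.
have main : 1 + J <= h * kap / Num.sqrt pi.
  by rewrite ler_pdivlMr// [leRHS]mulrC -ler_pdivrMr.
apply: (@le_trans _ _ g).
  rewrite /g ler_expR lerN2 ler_wpM2r ?sqr_ge0//; lra.
by rewrite -mulrBl ler_peMl ?(ltW g0)//; lra.
Qed.

End StandardComplexGaussian.

Section ScaledApproximation.
Context {R : realType}.
Variables (u : R -> R -> R[i]) (g : int -> R[i]) (N : nat) (eps kap K C delta t : R).
Hypothesis sol : nls_solution eps u.
Hypothesis u0 : forall x, zsum_to (fun k => g k * ek k x) (u 0 x).
Hypothesis eps_gt0 : 0 < eps.
Hypothesis kap_gt0 : 0 < kap.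
Hypothesis kap2 : kap ^+ 2 * eps = 1.
Hypothesis delta_gt0 : 0 < delta.
Hypothesis g_head : \sum_(k <- zrange N) modulus (g k) <= K * kap.
Hypothesis g_tail : forall s, uniq s -> (forall k, k \in s -> k \notin zrange N) ->
  \sum_(k <- s) modulus (g k) <= delta * kap.
Hypothesis t_range : 0 <= t <= C / eps.
Local Notation E := (expR (K ^+ 2 * C *+ 7)).
Hypothesis eps_small1 : eps * K ^+ 2 *+ 4 <= 1.
Hypothesis eps_small2 : eps * K ^+ 3 *+ 2 <= delta.
Hypothesis delta_small : delta * E *+ 3 <= K.

Let init : l1le (fun k => fourier_coef (u 0) k - (if k \in zrange N then g k else 0)) (delta * kap).
Proof.
have gl : l1le g (K * kap + delta * kap).
  move=> s us; rewrite (bigID (mem (zrange N)))/=; apply: lerD.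
    rewrite -big_filter; apply: le_trans g_head; apply: le_sum_uniq_subset.
    - exact: filter_uniq.
    - exact: zrange_uniq.
    - by move=> k; rewrite mem_filter => /andP[].
    - by move=> k; exact: modulus_ge0.
  rewrite -big_filter; apply: g_tail; first exact: filter_uniq.
  by move=> k; rewrite mem_filter => /andP[].
have bu : cbm (u 0) by apply: smooth_cbm; exact: (nls_smooth sol).
have fu k : fourier_coef (u 0) k = g k.
  by apply: (fourier_coef_of_zsum k bu gl) => x _; exact: u0.
move=> s us; rewrite (eq_bigr (fun k => if k \notin zrange N then modulus (g k) else 0)) => [|k _].
  rewrite -big_mkcond -big_filter; apply: g_tail; first exact: filter_uniq.
  by move=> k; rewrite mem_filter => /andP[].
by rewrite fu; case: ifP => _; rewrite ?subrr ?subr0 ?modulus0.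
Qed.

Lemma scaled_approximation x : modulus (u t x - resonant g N eps t x) <= delta * E *+ 3 * kap.
Proof.
have e2 (S : R) : eps ^+ 2 * (S * kap) ^+ 2 = eps * S ^+ 2.
  by rewrite -[RHS]mul1r -kap2; ring.
have small : eps ^+ 2 * (K * kap) ^+ 2 *+ 4 <= 1 by rewrite e2.
have large : delta * kap + eps ^+ 2 * ((K * kap) ^+ 3 *+ 2) < delta * kap *+ 3.
  have -> : eps ^+ 2 * ((K * kap) ^+ 3 *+ 2) = (eps * K ^+ 3 *+ 2) * kap.
    rewrite -[RHS]mul1r -kap2; ring.
  have dk : 0 < delta * kap by rewrite mulr_gt0.
  have : (eps * K ^+ 3 *+ 2) * kap <= delta * kap by rewrite ler_pM2r.
  by rewrite -[delta * kap *+ 3]mulr_natl; lra.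
pose L : R := (eps ^+ 2 * (K * kap) ^+ 2) *+ 7.
have LT : L * (C / eps) = K ^+ 2 * C *+ 7.
  by rewrite /L e2; field; rewrite gt_eqF.
have As : delta * kap *+ 3 * expR (L * (C / eps)) <= K * kap.
  rewrite LT; have -> : delta * kap *+ 3 * E = delta * E *+ 3 * kap by ring.
  by rewrite ler_pM2r.
have := resonant_approximation sol g_head small init large As t_range => cl.
have sw : wiener (fun x => u t x - resonant g N eps t x) (delta * E *+ 3 * kap).
  split; first by apply: smoothB; [exact: (nls_smooth sol)|exact: smooth_resonant].
  apply: (l1le_trans (A := delta * kap *+ 3 * expR (L * t))).
    have -> : delta * E *+ 3 * kap = delta * kap *+ 3 * E by ring.
    rewrite ler_wpM2l//; first by rewrite mulrn_wge0// mulr_ge0// ltW.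
    rewrite ler_expR -LT ler_wpM2l//; last by case/andP: t_range.
    by rewrite mulrn_wge0// mulr_ge0 ?sqr_ge0.
  apply: l1le_le cl => k; rewrite fourier_coefB//; apply: smooth_cbm.
    exact: (nls_smooth sol).
  exact: smooth_resonant.
exact: (wiener_sup x sw).
Qed.

Lemma sup_circle_le :
  (sup_circle (u t) <= (\sum_(k <- zrange N) modulus (g k) + delta * E *+ 3 * kap)%:E)%E.
Proof.
apply: ge_ereal_sup => _ [x _ <-]; rewrite lee_fin.
rewrite -[u t x](subrK (resonant g N eps t x)) addrC.
apply: (le_trans (ler_modulusD _ _)); rewrite lerD ?scaled_approximation//.
apply: (le_trans (ler_modulus_sum _ _ _)); apply: ler_sum => k _.
by rewrite modulus_mul_unit ?modulus_ek// modulus_amp.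
Qed.

Lemma sup_circle_ge :
  ((modulus (\sum_(k <- zrange N) amp g N eps t k) - delta * E *+ 3 * kap)%:E <= sup_circle (u t))%E.
Proof.
apply: (@le_trans _ _ (modulus (u t 0))%:E); last first.
  by apply: ereal_sup_ubound; exists 0 => //; rewrite /circle/= in_itv/= lexx ltW// pi2_gt0.
rewrite lee_fin lerBlDr -lerBlDl.
have -> : \sum_(k <- zrange N) amp g N eps t k = resonant g N eps t 0.
  by apply: eq_bigr => k _; rewrite ek_at0 mulr1.
apply: le_trans (scaled_approximation 0); rewrite modulusBC.
exact: ler_dist_modulus.
Qed.

End ScaledApproximation.

Section LowerPhases.
Context {R : realType}.
Variables (g : int -> R[i]) (N : nat) (eps kap K C delta t lam : R) (c : int -> R).
Local Notation s := (zrange N).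
Hypothesis c_ge0 : forall k, 0 <= c k.
Hypothesis eps_gt0 : 0 < eps.
Hypothesis kap_gt0 : 0 < kap.
Hypothesis kap2 : kap ^+ 2 * eps = 1.
Hypothesis delta_ge0 : 0 <= delta.
Hypothesis lam_ge0 : 0 <= lam.
Hypothesis t_range : 0 <= t <= C / eps.
Let gy (k : int) : R[i] := (kap * (lam * c k ^+ 2))%:C.
Hypothesis near_gy : forall k, k \in s ->
  modulus (g k - gy k * cexp (freq gy N eps k * t)) <= c k * (kap * delta).
Let Sc := \sum_(k <- s) c k.
Let S2 := \sum_(k <- s) c k ^+ 2.
Hypothesis K_large : lam * S2 + delta * Sc <= K.

Let gy_mod k : modulus (gy k) = kap * (lam * c k ^+ 2).
Proof. by rewrite modulusR ger0_norm// mulr_ge0 ?(ltW kap_gt0)// mulr_ge0 ?sqr_ge0. Qed.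

Let mod_close k : k \in s -> `|modulus (g k) - modulus (gy k)| <= c k * (kap * delta).
Proof.
move=> ks; have e : modulus (gy k) = modulus (gy k * cexp (freq gy N eps k * t)).
  by rewrite modulus_mul_unit// modulus_cexp.
rewrite e ler_norml; have h := near_gy ks; apply/andP; split.
  have := ler_dist_modulus (gy k * cexp (freq gy N eps k * t)) (g k).
  by rewrite modulusBC; lra.
by have := ler_dist_modulus (g k) (gy k * cexp (freq gy N eps k * t)); lra.
Qed.

Lemma lower_head : \sum_(k <- s) modulus (g k) <= K * kap.
Proof.
apply: (@le_trans _ _ ((lam * S2 + delta * Sc) * kap)); last by rewrite ler_pM2r.
apply: (@le_trans _ _ (\sum_(k <- s) (kap * (lam * c k ^+ 2) + c k * (kap * delta)))).
  rewrite big_seq [leRHS]big_seq; apply: ler_sum => k ks.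
  have := mod_close ks; rewrite ler_norml gy_mod => /andP[_]; lra.
rewrite big_split/= -!mulr_sumr -mulr_suml -/Sc -/S2.
by rewrite le_eqVlt; apply/orP; left; apply/eqP; ring.
Qed.

Let freq_close k : k \in s ->
  `|freq gy N eps k - freq g N eps k| * t <= K * delta * Sc * C *+ 6.
Proof.
move=> ks; case/andP: t_range => t0 tC.
have kap0 := ltW kap_gt0.
have each j : j \in s -> `|modulus (gy j) ^+ 2 - modulus (g j) ^+ 2| <= c j * (kap * delta) * (K * kap *+ 2).
  move=> js; rewrite subr_sqr normrM distrC; apply: ler_pM => //; first exact: mod_close.
  rewrite ger0_norm ?addr_ge0 ?modulus_ge0// mulr2n lerD//.
    rewrite gy_mod; apply: (@le_trans _ _ ((lam * S2 + delta * Sc) * kap)); last by rewrite ler_pM2r.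
    rewrite mulrC ler_pM2r//; apply: (@le_trans _ _ (lam * S2)).
      rewrite ler_wpM2l// /S2 (big_rem j)//= lerDl; apply: sumr_ge0 => i _; exact: sqr_ge0.
    by rewrite lerDl mulr_ge0// sumr_ge0.
  apply: le_trans lower_head; rewrite (big_rem j)//= lerDl.
  by apply: sumr_ge0 => i _; exact: modulus_ge0.
have mass_close : `|mass gy N - mass g N| <= Sc * (kap * delta) * (K * kap *+ 2).
  rewrite /mass -sumrB; apply: (le_trans (ler_norm_sum _ _ _)).
  rewrite /Sc 2!mulr_suml big_seq [leRHS]big_seq; apply: ler_sum => j js; exact: each.
have ckSc : c k <= Sc by rewrite /Sc (big_rem k)//= lerDl sumr_ge0.
have one : `|modulus (gy k) ^+ 2 - modulus (g k) ^+ 2| <= Sc * (kap * delta) * (K * kap *+ 2).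
  apply: (le_trans (each k ks)); apply: ler_wpM2r.
    rewrite mulrn_wge0// mulr_ge0// (le_trans _ K_large)// addr_ge0 ?mulr_ge0 ?sumr_ge0// => i _.
    exact: sqr_ge0.
  by apply: ler_wpM2r => //; rewrite mulr_ge0.
pose B := Sc * (kap * delta) * (K * kap *+ 2).
have fr : `|freq gy N eps k - freq g N eps k| <= eps ^+ 2 * (B *+ 3).
  have -> : freq gy N eps k - freq g N eps k = eps ^+ 2 *
     ((mass gy N - mass g N) *+ 2 - (modulus (gy k) ^+ 2 - modulus (g k) ^+ 2)).
    by rewrite /freq /shift_freq; ring.
  rewrite normrM ger0_norm ?sqr_ge0// ler_wpM2l ?sqr_ge0//.
  apply: (le_trans (ler_normB _ _)); rewrite normrMn (_ : B *+ 3 = B *+ 2 + B); last by rewrite -mulrSr.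
  by rewrite lerD// lerMn2r.
apply: (@le_trans _ _ (eps ^+ 2 * (B *+ 3) * (C / eps))).
  by apply: ler_pM.
have -> : eps ^+ 2 * (B *+ 3) * (C / eps) = (kap ^+ 2 * eps) * (K * delta * Sc * C *+ 6).
  by rewrite /B; field; rewrite gt_eqF.
by rewrite kap2 mul1r.
Qed.

Lemma lower_amplitude :
  kap * (lam * S2 - delta * Sc - lam * S2 * (K * delta * Sc * C *+ 12)) <=
  modulus (\sum_(k <- s) amp g N eps t k).
Proof.
have kap0 := ltW kap_gt0.
pose D := K * delta * Sc * C *+ 12.
have each k : k \in s -> kap * (lam * c k ^+ 2) - (c k * (kap * delta) + kap * (lam * c k ^+ 2) * D) <=
    complex.Re (amp g N eps t k).
  move=> ks; set y := kap * (lam * c k ^+ 2).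
  have y0 : 0 <= y by rewrite mulr_ge0// mulr_ge0// sqr_ge0.
  have : modulus (amp g N eps t k - y%:C) <= c k * (kap * delta) + y * D.
    have -> : amp g N eps t k - y%:C =
       (g k - gy k * cexp (freq gy N eps k * t)) * cexp (- freq g N eps k * t) +
       gy k * (cexp ((freq gy N eps k - freq g N eps k) * t) - cexp 0).
      have -> : cexp ((freq gy N eps k - freq g N eps k) * t) =
          cexp (freq gy N eps k * t) * cexp (- freq g N eps k * t).
        by rewrite mulrBl cexpD mulNr.
      by rewrite cexp0 /amp -[gy k]/(y%:C); ring.
    apply: (le_trans (ler_modulusD _ _)).
    rewrite (modulus_mul_unit _ (modulus_cexp _)) (modulusM (gy k)) gy_mod -/y.
    rewrite lerD ?near_gy// ler_wpM2l//; apply: (le_trans (cexp_lip _ _)).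
    have t0 : 0 <= t by case/andP: t_range.
    rewrite subr0 normrM (ger0_norm t0).
    have := freq_close ks; rewrite /D mulr2n; lra.
  have := ler_Re_modulus (amp g N eps t k - y%:C).
  by rewrite cReD cReN/= ler_norml => /andP[h1 h2] h3; lra.
apply: le_trans (ler_Re_modulus _); apply: le_trans (ler_norm _).
rewrite cRe_sum; apply: (@le_trans _ _ (\sum_(k <- s) (kap * (lam * c k ^+ 2) -
   (c k * (kap * delta) + kap * (lam * c k ^+ 2) * D)))).
  rewrite sumrB big_split/= -mulr_suml -!mulr_sumr -!mulr_suml -!mulr_sumr -/Sc -/S2.
  by rewrite le_eqVlt; apply/orP; left; apply/eqP; rewrite /D; ring.
by rewrite big_seq [leRHS]big_seq; apply: ler_sum => k; exact: each.
Qed.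

End LowerPhases.

(** * Probability of the extreme events *)

Section Weights.
Context {R : realType}.
Implicit Types (k : int) (s : seq int).

Lemma exp_weight_summable (be : R) : 0 < be ->
  exists2 H : R, 0 < H & forall s, uniq s -> \sum_(k <- s) expR (- (be * `|k%:~R|)) <= H.
Proof.
move=> be0; pose q := expR (- be).
have q0 : 0 < q by exact: expR_gt0.
have q1 : q < 1 by rewrite -expR0 ltr_expR oppr_lt0.
have q10 : 0 < 1 - q by rewrite subr_gt0.
have wE (n : nat) : expR (- (be * `|(Posz n)%:~R : R|)) = q ^+ n.
  by rewrite ger0_norm// -expRM_natr mulNr.
exists ((1 + q) / (1 - q)); first by rewrite divr_gt0// addr_gt0.
move=> s us; have [N sN] := seq_int_bounded s.
apply: (@le_trans _ _ (\sum_(k <- zrange N) expR (- (be * `|k%:~R|)))).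
  by apply: le_sum_uniq_subset => //; exact: zrange_uniq.
suff -> : \sum_(k <- zrange N) expR (- (be * `|k%:~R : R|)) = (1 + q - q ^+ N.+1 *+ 2) / (1 - q).
  by rewrite ler_wpM2r ?invr_ge0 ?(ltW q10)// gerBl mulrn_wge0// exprn_ge0// ltW.
elim: N {sN} => [|N IH].
  rewrite /zrange/= big_seq1 subrr normr0 mulr0 oppr0 expR0 expr1; field.
  by rewrite gt_eqF.
rewrite big_zrangeS IH mulrNz normrN wE [q ^+ N.+2]exprS; field.
by rewrite gt_eqF.
Qed.

Variables (a b : R) (c : int -> R).
Hypothesis a_gt0 : 0 < a.
Hypothesis b_gt0 : 0 < b.
Hypothesis c_adm : admissible_coef a b c.

Lemma coef_gt0 k : 0 < c k.
Proof. by case: c_adm => ->; rewrite mulr_gt0// expR_gt0. Qed.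

Lemma coef_le k : c k <= a * expR (- (b * `|k%:~R|)).
Proof.
case: c_adm => ->//; rewrite ler_wpM2l ?(ltW a_gt0)// ler_expR lerN2 ler_wpM2l ?(ltW b_gt0)//.
have [->|k0] := eqVneq k 0; first by rewrite normr0 expr0n.
rewrite expr2 ler_peMl// -intr_norm ler1z -gtz0_ge1 normr_gt0//.
Qed.

Definition growth k : R := expR (b / 2 * `|k%:~R|).

Lemma growth_gt0 k : 0 < growth k. Proof. exact: expR_gt0. Qed.

Definition weight k : R := c k * growth k.

Lemma weight_ge0 k : 0 <= weight k.
Proof. by rewrite mulr_ge0// ltW// ?coef_gt0 ?growth_gt0. Qed.

Lemma weight_l1 : exists2 H : R, 0 < H & l1le (fun k => (weight k)%:C) H.
Proof.
have b20 : 0 < b / 2 by rewrite divr_gt0.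
have [H H0 sH] := exp_weight_summable b20.
exists (a * H); first by rewrite mulr_gt0.
move=> s us; apply: (@le_trans _ _ (\sum_(k <- s) a * expR (- (b / 2 * `|k%:~R|)))).
  apply: ler_sum => k _; rewrite modulusR (ger0_norm (weight_ge0 k)) /weight.
  apply: (le_trans (ler_wpM2r (ltW (growth_gt0 k)) (coef_le k))).
  rewrite /growth -(mulrA a) -expRD le_eqVlt; apply/orP; left; apply/eqP.
  by congr (_ * expR _); field.
by rewrite -mulr_sumr ler_wpM2l ?(ltW a_gt0)// sH.
Qed.

Lemma coef_sqr_summable : exists2 H : R, 0 < H & forall s, uniq s -> \sum_(k <- s) c k ^+ 2 <= H.
Proof.
have [H H0 sH] := exp_weight_summable b_gt0.
exists (a ^+ 2 * H); first by rewrite mulr_gt0// exprn_gt0.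
move=> s us; apply: (@le_trans _ _ (\sum_(k <- s) a ^+ 2 * expR (- (b * `|k%:~R|)))).
  apply: ler_sum => k _; apply: (@le_trans _ _ ((a * expR (- (b * `|k%:~R|))) ^+ 2)).
    by rewrite lerXn2r ?coef_le// nnegrE ?(ltW (coef_gt0 k))// mulr_ge0 ?expR_ge0 ?ltW.
  rewrite exprMn ler_wpM2l ?sqr_ge0// expr2 ler_piMl ?expR_ge0//.
  by rewrite -expR0 ler_expR oppr_le0 mulr_ge0// ltW.
by rewrite -mulr_sumr ler_wpM2l ?sqr_ge0// sH.
Qed.

Lemma coef_esum : \esum_(k in [set: int]) (c k ^+ 2)%:E = (coef_sum2 c)%:E.
Proof.
rewrite /coef_sum2 fineK// ge0_fin_numE; last by apply: esum_ge0 => k _; rewrite lee_fin sqr_ge0.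
have [H H0 sH] := coef_sqr_summable; apply: (@le_lt_trans _ _ H%:E); last exact: ltry.
apply: ge_ereal_sup => _ [A [finA _] <-].
by rewrite fsbig_finite// sumEFin lee_fin; apply: sH; exact: finmap.fset_uniq.
Qed.

Lemma coef_sum2_ge s : uniq s -> \sum_(k <- s) c k ^+ 2 <= coef_sum2 c.
Proof.
move=> us; rewrite -lee_fin -coef_esum; apply: esum_ge; exists [set` s].
  by split => //; exact: finite_seq.
by rewrite -fsbig_seq// sumEFin.
Qed.

Lemma coef_sum2_gt0 : 0 < coef_sum2 c.
Proof.
apply: lt_le_trans (coef_sum2_ge (s := [:: 0]) isT).
by rewrite big_seq1 exprn_gt0// coef_gt0.
Qed.

Lemma coef_sum2_approx (e : R) : 0 < e -> exists N : nat,
  coef_sum2 c - e < \sum_(k <- zrange N) c k ^+ 2.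
Proof.
move=> e0; have fin : \esum_(k in [set: int]) (c k ^+ 2)%:E \is a fin_num by rewrite coef_esum.
have [_ [A [finA _] <-]] := ub_ereal_sup_adherent e0 fin.
have -> : ereal_sup [set \sum_(x \in X) (c x ^+ 2)%:E | X in fsets [set: int]] = (coef_sum2 c)%:E.
  by rewrite -coef_esum.
rewrite fsbig_finite// sumEFin -EFinB lte_fin => eA.
have [N sN] := seq_int_bounded (finmap.enum_fset (fset_set A)); exists N; apply: (lt_le_trans eA).
apply: le_sum_uniq_subset => // [| |k]; [exact: finmap.fset_uniq|exact: zrange_uniq|exact: sqr_ge0].
Qed.

End Weights.

Section FiniteProducts.
Context {R : realType}.

Lemma prode_le (I : Type) (s : seq I) (F : I -> \bar R) (r : I -> R) :
  (forall k, 0 <= F k)%E -> (forall k, F k <= (r k)%:E)%E ->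
  (\prod_(k <- s) F k <= (\prod_(k <- s) r k)%:E)%E.
Proof.
move=> F0 Fr; elim: s => [|k s IH]; first by rewrite !big_nil.
rewrite !big_cons EFinM lee_pmul// prode_ge0// => i _.
Qed.

Lemma prode_ge (I : eqType) (s : seq I) (F : I -> \bar R) (r : I -> R) :
  (forall k, 0 <= r k) -> (forall k, k \in s -> (r k)%:E <= F k)%E ->
  ((\prod_(k <- s) r k)%:E <= \prod_(k <- s) F k)%E.
Proof.
move=> r0; elim: s => [|k s IH] Fr; first by rewrite !big_nil.
rewrite !big_cons EFinM lee_pmul ?lee_fin ?prodr_ge0// ?Fr ?mem_head//.
by apply: IH => i si; rewrite Fr// in_cons si orbT.
Qed.

Lemma prod_expR (I : Type) (s : seq I) (J : R) (x : I -> R) :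
  \prod_(k <- s) (J * expR (- x k)) = J ^+ size s * expR (- \sum_(k <- s) x k).
Proof.
elim: s => [|k s IH]; first by rewrite !big_nil oppr0 expR0 mulr1.
by rewrite !big_cons IH opprD expRD /= exprS; ring.
Qed.

Lemma cauchy_schwarz_sum (I : Type) (s : seq I) (c y : I -> R) :
  0 < \sum_(k <- s) c k ^+ 2 ->
  (\sum_(k <- s) c k * y k) ^+ 2 <= (\sum_(k <- s) c k ^+ 2) * (\sum_(k <- s) y k ^+ 2).
Proof.
set A := \sum_(_ <- _) _; set B := \sum_(_ <- _) _; set D := \sum_(_ <- _) y _ ^+ 2 => A0.
have : 0 <= \sum_(k <- s) (A * y k - B * c k) ^+ 2 by apply: sumr_ge0 => k _; exact: sqr_ge0.
have -> : \sum_(k <- s) (A * y k - B * c k) ^+ 2 = A * (A * D - B ^+ 2).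
  rewrite (eq_bigr (fun k => A ^+ 2 * y k ^+ 2 + (B ^+ 2 * c k ^+ 2 - (A * B *+ 2) * (c k * y k)))).
    by rewrite big_split/= sumrB -!mulr_sumr -/A -/B -/D; ring.
  by move=> k _; ring.
by rewrite pmulr_rge0// subr_ge0.
Qed.

End FiniteProducts.

Section Events.
Context {R : realType} {d : measure_display} {Om : measurableType d}.
Variable P : probability Om R.
Local Notation mR := (measurableTypeR R).

Lemma measure_int_subadditive (A : set Om) (B : int -> set Om) (r : R) :
  measurable A -> (forall k, measurable (B k)) -> A `<=` \bigcup_k B k ->
  (forall s, uniq s -> \sum_(k <- s) P (B k) <= r%:E)%E -> (P A <= r%:E)%E.
Proof.
move=> mA mB AB sB; pose F n := B (Posz n) `|` B (Negz n).
have mF n : measurable (F n) by exact: measurableU.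
have AF : A `<=` \bigcup_n F n.
  by move=> w /AB[[n|n] _ Bw]; exists n => //; [left|right].
apply: (le_trans (measure_sigma_subadditive _ mF mA AF)).
apply: lime_le; first by apply: is_cvg_nneseries.
apply: nearW => M.
apply: (@le_trans _ _ (\sum_(k <- [seq Posz n | n <- index_iota 0 M] ++ [seq Negz n | n <- index_iota 0 M]) P (B k))%E).
  rewrite big_cat/= !big_map -big_split/=; apply: lee_sum => n _; exact: measureU2.
apply: sB; rewrite cat_uniq; apply/and3P; split.
- by rewrite map_inj_uniq ?iota_uniq// => i j [].
- by apply/hasPn => k /mapP[n _ ->]; apply/negP => /mapP[].
- by rewrite map_inj_uniq ?iota_uniq// => i j [].
Qed.

Variable eta : int -> Om -> R[i].
Hypothesis iid : iid_complex_gaussians P eta.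

Lemma iid_std_gaussian k : std_gaussian P (eta k).
Proof.
have [[cg _ _] [e1 e2 e3]] := iid; split => //.
by rewrite e3 eqxx.
Qed.

Definition ev k (z : R[i]) (B : set R) : set Om := [set w | B (modulus (eta k w - z))].

Lemma measurable_ev k z (B : set mR) : measurable B -> measurable (ev k z B).
Proof.
move=> mB; have sg := iid_std_gaussian k.
have := measurable_modulusB z (std_gaussian_measurable_Re sg) (std_gaussian_measurable_Im sg).
by move=> /(_ measurableT B mB); rewrite setTI.
Qed.

Lemma ev_independent (s : seq int) (z : int -> R[i]) (B : int -> set mR) : uniq s ->
  (forall k, measurable (B k)) ->
  P (\big[setI/setT]_(k <- s) ev k (z k) (B k)) = (\prod_(k <- s) P (ev k (z k) (B k)))%E.
Proof.
move=> us mB; have [[_ ind _] _] := iid.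
pose A k : set (mR * mR) := [set p : mR * mR | B k (modulus ((p.1 +i* p.2) - z k))].
have mA k : measurable (A k).
  have := @measurable_modulusB R _ (mR * mR)%type (fun p : mR * mR => p.1 +i* p.2) (z k)
     measurable_fst measurable_snd measurableT (B k) (mB k).
  by rewrite setTI.
have eA k : cpair (eta k) @^-1` A k = ev k (z k) (B k).
  by apply/seteqP; split => w; rewrite /A /ev /cpair/=; case: (eta k w).
have := ind s A us mA.
rewrite (eq_bigr _ (fun k _ => eA k)) => ->.
by apply: eq_bigr => k _; rewrite eA.
Qed.

Definition far k (r : R) : set Om := ev k 0 `[r, +oo[%classic.
Definition near_pt k (z : R[i]) (r : R) : set Om := ev k z `]-oo, r]%classic.

Lemma farE k r w : far k r w <-> r <= modulus (eta k w).
Proof. by rewrite /far /ev/= in_itv/= andbT subr0. Qed.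

Lemma near_ptE k z r w : near_pt k z r w <-> modulus (eta k w - z) <= r.
Proof. by rewrite /near_pt /ev/= in_itv. Qed.

Lemma measurable_far k r : measurable (far k r).
Proof. by apply: measurable_ev; exact: measurable_itv. Qed.

Lemma measurable_near k z r : measurable (near_pt k z r).
Proof. by apply: measurable_ev; exact: measurable_itv. Qed.

Lemma far_set k r : far k r = [set w | r <= modulus (eta k w)].
Proof. by apply/seteqP; split => w /farE. Qed.

Lemma near_set k z r : near_pt k z r = [set w | modulus (eta k w - z) <= r].
Proof. by apply/seteqP; split => w /near_ptE. Qed.

Lemma far_sum (b : R) : 0 < b -> exists2 D : R, 0 < D & forall (x : R) (s : seq int),
  1 <= x ^+ 2 / 2 -> 0 <= x -> uniq s ->
  (\sum_(k <- s) P (far k (x * growth b k)) <= (D * expR (- (x ^+ 2 / 2)))%:E)%E.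
Proof.
move=> b0; have h1 : 2^-1 < 1 :> R by rewrite invf_lt1// ltr1n.
have [J [J1 tail]] := std_gaussian_tail P h1.
have [H H0 sH] := exp_weight_summable b0.
exists (J * H); first by rewrite mulr_gt0// (lt_le_trans ltr01).
move=> x s x1 x0 us.
apply: (@le_trans _ _ (\sum_(k <- s) (J * (expR (- (x ^+ 2 / 2)) * expR (- (b * `|k%:~R|))))%:E)%E).
  apply: lee_sum => k _; rewrite far_set.
  have xg : 0 <= x * growth b k by rewrite mulr_ge0// ltW// growth_gt0.
  apply: (le_trans (tail _ (iid_std_gaussian k) _ xg)).
  rewrite lee_fin ler_pM2l ?(lt_le_trans ltr01 J1)// -expRD ler_expR -opprD lerN2.
  have g2 : 1 + b * `|k%:~R| <= growth b k ^+ 2.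
    rewrite /growth -expRM_natr; apply: le_trans (expR_ge1Dx _).
    by rewrite lerD2l le_eqVlt; apply/orP; left; apply/eqP; field.
  rewrite exprMn mulrA.
  have y0 : 0 <= b * `|k%:~R| by rewrite mulr_ge0// ltW.
  have q1 : 0 <= x ^+ 2 / 2 by rewrite (le_trans ler01).
  rewrite [2^-1 * _]mulrC; apply: le_trans (ler_wpM2l q1 g2).
  by rewrite mulrDr mulr1 lerD2l ler_peMl.
rewrite sumEFin lee_fin -!mulr_sumr -mulrA ler_wpM2l ?(le_trans ler01)//.
by rewrite mulrC ler_wpM2r ?sH// expR_ge0.
Qed.

End Events.

Lemma zrange_index (N : nat) (k : int) : k \in zrange N ->
  Posz (nat_of_ord (inord (absz (k + Posz N)) : 'I_(N.*2.+1))) - Posz N = k.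
Proof. by rewrite mem_zrange => kN; rewrite inordK; lia. Qed.

Section LargeDeviationEvents.
Context {R : realType} {d : measure_display} {Om : measurableType d}.
Variable P : probability Om R.
Variable eta : int -> Om -> R[i].
Hypothesis iid : iid_complex_gaussians P eta.
Local Notation far := (far eta).
Local Notation near_pt := (near_pt eta).

(* The moduli are discretised on a grid of fixed mesh, so that the event is
   covered by boxes whose number does not depend on [kap]. *)
Lemma box_upper (c : int -> R) (N : nat) (S2 z Lam tau : R) :
  (forall k, 0 < c k) -> \sum_(k <- zrange N) c k ^+ 2 <= S2 ->
  0 < z -> 0 < tau -> tau < 1 -> 0 < Lam ->
  exists2 D : R, 0 <= D & forall kap, 0 < kap -> exists2 B, measurable B &
    (forall w, (forall k, k \in zrange N -> modulus (eta k w) <= kap * Lam) ->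
      z * kap <= \sum_(k <- zrange N) c k * modulus (eta k w) -> B w) /\
    (P B <= (D * expR (- ((1 - tau) ^+ 3 * (z ^+ 2 / S2) * kap ^+ 2)))%:E)%E.
Proof.
move=> c0 cS2 z0 tau0 tau1 Lam0.
pose s := zrange N; pose Sc := \sum_(k <- s) c k; pose A2 := \sum_(k <- s) c k ^+ 2.
have s0 : 0 \in s by rewrite mem_zrange.
have Sc0 : 0 < Sc.
  by rewrite /Sc (big_rem 0)//= ltr_pwDl// sumr_ge0// => k _; exact: ltW.
have A20 : 0 < A2.
  by rewrite /A2 (big_rem 0)//= ltr_pwDl ?exprn_gt0// sumr_ge0// => k _; exact: sqr_ge0.
have S20 : 0 < S2 := lt_le_trans A20 cS2.
pose h := tau * z / Sc; have h0 : 0 < h by rewrite divr_gt0// mulr_gt0.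
pose Mx := Num.truncn (Lam / h).
have tau' : 1 - tau < 1 by rewrite gtrBl.
have [J [J1 tail]] := std_gaussian_tail P tau'.
pose I := {ffun 'I_(N.*2.+1) -> 'I_Mx.+1}.
pose idx (k : int) : 'I_(N.*2.+1) := inord (absz (k + Posz N)).
pose mv (m : I) k : R := h * (nat_of_ord (m (idx k)))%:R.
have mv0 m k : 0 <= mv m k by rewrite mulr_ge0// ltW.
pose adm (m : I) := ((1 - tau) * z) ^+ 2 <= S2 * \sum_(k <- s) mv m k ^+ 2.
pose bnd kap := expR (- ((1 - tau) ^+ 3 * (z ^+ 2 / S2) * kap ^+ 2)).
exists (#|{: I}|%:R * J ^+ size s); first by rewrite mulr_ge0// exprn_ge0// (le_trans ler01).
move=> kap kap0; pose box m := \big[setI/setT]_(k <- s) far k (kap * mv m k).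
have mbox m : measurable (box m).
  by apply: bigsetI_measurable => k _; exact: (measurable_far iid).
exists (\big[setU/set0]_(m <- enum {: I} | adm m) box m).
  by apply: bigsetU_measurable => m _; exact: mbox.
split.
  move=> w small big_w; pose f k := Num.truncn (modulus (eta k w) / (kap * h)).
  have kh0 : 0 < kap * h by rewrite mulr_gt0.
  have fle k : k \in s -> (f k <= Mx)%N.
    move=> ks; apply: le_truncn; rewrite ler_pdivrMr//.
    by rewrite mulrCA divfK ?gt_eqF// small.
  pose m : I := [ffun i : 'I_(N.*2.+1) => inord (f (Posz (nat_of_ord i) - Posz N)%R)].
  have mE k : k \in s -> mv m k = h * (f k)%:R.
    move=> ks; have idxE := zrange_index ks.
    have mI : m (idx k) = inord (f k) by rewrite ffunE idxE.
    by rewrite /mv mI inordK// ltnS fle.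
  have flow k : kap * (h * (f k)%:R) <= modulus (eta k w).
    rewrite mulrA mulrC -ler_pdivlMr// truncn_le//.
    by rewrite divr_ge0 ?modulus_ge0// ltW.
  have fup k : modulus (eta k w) <= kap * (h * (f k)%:R + h).
    have := truncnS_gt (modulus (eta k w) / (kap * h)); rewrite -/(f k) => /ltW.
    rewrite ler_pdivrMr// -natr1 => /le_trans; apply.
    by rewrite le_eqVlt; apply/orP; left; apply/eqP; ring.
  have cs : (1 - tau) * z <= \sum_(k <- s) c k * mv m k.
    have : z * kap <= (\sum_(k <- s) c k * mv m k + h * Sc) * kap.
      apply: (le_trans big_w); rewrite mulr_sumr -big_split/= mulr_suml.
      rewrite big_seq [leRHS]big_seq; apply: ler_sum => k ks.
      rewrite mE//; apply: (le_trans (ler_wpM2l (ltW (c0 k)) (fup k))).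
      by rewrite le_eqVlt; apply/orP; left; apply/eqP; ring.
    rewrite ler_pM2r// /h divfK ?gt_eqF//; lra.
  rewrite -bigcup_seq_cond; exists m.
    rewrite /= mem_enum/=; rewrite /adm.
    apply: (@le_trans _ _ ((\sum_(k <- s) c k * mv m k) ^+ 2)).
      rewrite lerXn2r// nnegrE; first by rewrite mulr_ge0 ?subr_ge0// ltW.
      by apply: sumr_ge0 => k _; rewrite mulr_ge0// ltW.
    apply: (le_trans (cauchy_schwarz_sum _ A20)); rewrite ler_wpM2r//.
    by apply: sumr_ge0 => k _; exact: sqr_ge0.
  rewrite /box -bigcap_seq => k /= ks; apply/farE; rewrite mE//; exact: flow.
have Pbox m : adm m -> (P (box m) <= (J ^+ size s * bnd kap)%:E)%E.
  move=> am; rewrite /box (ev_independent iid); [|exact: zrange_uniq|by move=> k; exact: measurable_itv].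
  apply: (@le_trans _ _ (\prod_(k <- s) (J * expR (- ((1 - tau) * (kap * mv m k) ^+ 2))))%:E).
    apply: prode_le => k; first exact: measure_ge0.
    rewrite -/(far k (kap * mv m k)) far_set.
    by apply: tail; [exact: iid_std_gaussian|rewrite mulr_ge0// ltW].
  rewrite prod_expR lee_fin ler_wpM2l ?exprn_ge0 ?(le_trans ler01)//.
  rewrite /bnd ler_expR lerN2 -mulr_sumr.
  have -> : \sum_(k <- s) (kap * mv m k) ^+ 2 = kap ^+ 2 * \sum_(k <- s) mv m k ^+ 2.
    by rewrite mulr_sumr; apply: eq_bigr => k _; rewrite exprMn.
  have -> : (1 - tau) ^+ 3 * (z ^+ 2 / S2) * kap ^+ 2 =
     (1 - tau) * (kap ^+ 2 * (((1 - tau) * z) ^+ 2 / S2)) by ring.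
  rewrite ler_wpM2l ?subr_ge0 ?(ltW tau1)// ler_wpM2l ?sqr_ge0//.
  by rewrite ler_pdivrMr// [leRHS]mulrC.
apply: (@le_trans _ _ (\sum_(m <- enum {: I} | adm m) P (box m))%E).
  by apply: le_measure_bigsetU => //; apply: bigsetU_measurable => m _; exact: mbox.
apply: (@le_trans _ _ (\sum_(m <- enum {: I} | adm m) (J ^+ size s * bnd kap)%:E)%E).
  by apply: lee_sum => m; exact: Pbox.
rewrite sumEFin lee_fin big_const_seq iter_addr_0 -[leLHS]mulr_natl -mulrA ler_wpM2r//.
  by rewrite mulr_ge0 ?expR_ge0// exprn_ge0// (le_trans ler01).
rewrite ler_nat cardE; exact: count_size.
Qed.

Lemma near_lower (N : nat) (rho : int -> R) (b del e Lam : R) :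
  (forall k, 0 <= rho k) -> 0 < b -> 0 < del -> 0 < e -> 0 < Lam ->
  exists K : R, forall kap, K <= kap -> forall sigma : int -> R[i],
  (forall k, modulus (sigma k) = 1) ->
  exists2 A, measurable A &
    (forall w, A w -> (forall k, k \in zrange N ->
        modulus (eta k w - (kap * rho k)%:C * sigma k) <= kap * del) /\
      (forall k, k \notin zrange N -> modulus (eta k w) <= kap * Lam * growth b k)) /\
    ((2^-1 * expR (- (\sum_(k <- zrange N) (rho k ^+ 2 + e) * kap ^+ 2)))%:E <= P A)%E.
Proof.
move=> rho0 b0 del0 e0 Lam0; pose s := zrange N.
have [D D0 fs] := far_sum iid b0.
have ex k : {K : R | 0 < K /\ forall kap, K <= kap -> forall sigma, modulus sigma = 1 ->
   ((expR (- ((rho k ^+ 2 + e) * kap ^+ 2)))%:E <=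
    P (near_pt k ((kap * rho k)%:C * sigma)%R (kap * del)%R))%E}.
  apply: cid; have [K [K0 H]] := std_gaussian_near P (rho0 k) del0 e0.
  exists K; split => // kap Kk sigma s1; rewrite near_set.
  by apply: H => //; exact: iid_std_gaussian.
have ex0 k : 0 <= sval (ex k) by case: (ex k) => K [K0 H]; exact: ltW.
pose K0 := \sum_(k <- s) sval (ex k).
have exK k : k \in s -> sval (ex k) <= K0.
  move=> ks; rewrite /K0 (big_rem k)//= lerDl; exact: sumr_ge0.
pose K1 := (1 + D) * 2 / Lam.
have K10 : 0 < K1 by rewrite divr_gt0// mulr_gt0// addr_gt0.
exists (K0 + K1) => kap Kk sigma s1.
have K00 : 0 <= K0 by exact: sumr_ge0.
pose E0 := \big[setI/setT]_(k <- s) near_pt k ((kap * rho k)%:C * sigma k) (kap * del).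
have mE0 : measurable E0 by apply: bigsetI_measurable => k _; exact: (measurable_near iid).
pose bad k := if k \in s then set0 else far k (kap * Lam * growth b k).
have mbad k : measurable (bad k) by rewrite /bad; case: ifP => // _; exact: (measurable_far iid).
have mU : measurable (\bigcup_k bad k).
  rewrite (_ : \bigcup_k bad k = \bigcup_n (bad (Posz n) `|` bad (Negz n))).
    by apply: bigcupT_measurable => n; exact: measurableU.
  apply/seteqP; split => w; first by move=> [[n|n] _ ?]; exists n => //; [left|right].
  by move=> [n _ [?|?]]; [exists (Posz n)|exists (Negz n)].
exists (E0 `\` \bigcup_k bad k); first exact: measurableD.
split.
  move=> w [E0w nbad]; split => k ks.
    apply/near_ptE; move: E0w; rewrite /E0 -bigcap_seq => /(_ k); exact.
  have [//|/ltW lt] := leP (modulus (eta k w)) (kap * Lam * growth b k).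
  by exfalso; apply: nbad; exists k => //; rewrite /bad (negbTE ks); apply/farE.
pose p := expR (- (\sum_(k <- s) (rho k ^+ 2 + e) * kap ^+ 2)).
have PE0 : (p%:E <= P E0)%E.
  rewrite /E0 (ev_independent iid); [|exact: zrange_uniq|by move=> k; exact: measurable_itv].
  have -> : p = \prod_(k <- s) (1 * expR (- ((rho k ^+ 2 + e) * kap ^+ 2))).
    by rewrite prod_expR expr1n mul1r.
  apply: prode_ge => [k|k ks]; first by rewrite mul1r expR_ge0.
  rewrite mul1r; have := exK k ks; case: (ex k) => K [_ H] /= KK0; apply: H => //.
  by rewrite (le_trans KK0)// (le_trans _ Kk)// lerDl ltW.
have PE1 : P E0 \is a fin_num by exact: fin_num_measure.
have indep k : P (E0 `&` bad k) = (P E0 * P (bad k))%E.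
  rewrite /bad; case: ifPn => ks; first by rewrite setI0 !measure0 mule0.
  pose z j := if j \in s then (kap * rho j)%:C * sigma j else 0.
  pose B j : set (measurableTypeR R) := if j \in s then `]-oo, kap * del]%classic
     else `[kap * Lam * growth b j, +oo[%classic.
  have mB j : measurable (B j) by rewrite /B; case: ifP => _; exact: measurable_itv.
  have us : uniq (k :: s) by rewrite cons_uniq ks zrange_uniq.
  have := ev_independent iid z us mB; rewrite big_cons [X in _ = X -> _]big_cons.
  have eE : \big[setI/setT]_(j <- s) ev eta j (z j) (B j) = E0.
    by rewrite /E0 big_seq [RHS]big_seq; apply: eq_bigr => j js; rewrite /z /B js.
  have e2 : (\prod_(j <- s) P (ev eta j (z j) (B j)) = P E0)%E.
    by rewrite -eE (ev_independent iid)//; exact: zrange_uniq.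
  have ek : ev eta k (z k) (B k) = far k (kap * Lam * growth b k) by rewrite /z /B (negbTE ks).
  by rewrite eE e2 ek setIC => ->; rewrite muleC.
have q2 : forall r, uniq r -> (\sum_(k <- r) P (bad k) <= (2^-1)%:E)%E.
  move=> r ur; rewrite (eq_bigr (fun k => if k \notin s then P (far k (kap * Lam * growth b k)%R) else 0%E)).
    rewrite -big_mkcond -big_filter.
    have kL : (1 + D) * 2 <= kap * Lam.
      by rewrite -ler_pdivrMr// (le_trans _ Kk)// lerDr.
    set x := kap * Lam in kL *.
    have x2 : (1 + D) * 2 <= x ^+ 2 / 2.
      by rewrite ler_pdivlMr//; move: kL D0; rewrite expr2 => *; nra.
    apply: (le_trans (fs x _ _ _ _)).
    - by move: x2 D0; lra.
    - by move: kL D0; lra.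
    - exact: filter_uniq.
    rewrite lee_fin expRN ler_pdivrMr ?expR_gt0//.
    have := expR_ge1Dx (x ^+ 2 / 2); move: x2 D0; lra.
  by move=> k _; rewrite /bad; case: ifP => //; rewrite measure0.
have PU : (P (E0 `&` \bigcup_k bad k) <= (fine (P E0) / 2)%:E)%E.
  apply: (measure_int_subadditive (B := fun k => E0 `&` bad k)).
  - exact: measurableI.
  - by move=> k; exact: measurableI.
  - by move=> w [Ew [k _ bw]]; exists k.
  move=> r ur; rewrite (eq_bigr _ (fun k _ => indep k)) -ge0_sume_distrr.
    by rewrite EFinM fineK// lee_wpmul2l// q2.
  by move=> k _; exact: measure_ge0.
have split_E : (P E0 = P (E0 `\` \bigcup_k bad k) + P (E0 `&` \bigcup_k bad k))%E.
  exact: measureDI.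
have fA : P (E0 `\` \bigcup_k bad k) \is a fin_num by apply: fin_num_measure; exact: measurableD.
have fI : P (E0 `&` \bigcup_k bad k) \is a fin_num by apply: fin_num_measure; exact: measurableI.
rewrite -(fineK fA) lee_fin -/p.
have := PE0; rewrite -(fineK PE1) lee_fin => pE.
have := PU; rewrite -(fineK fI) lee_fin => uE.
have := congr1 fine split_E; rewrite fineD// => se; lra.
Qed.

End LargeDeviationEvents.

Section OuterProbability.
Context {R : realType} {d : measure_display} {Om : measurableType d}.
Variable P : probability Om R.

Lemma prob_le (A B Nl : set Om) : measurable B -> measurable Nl -> P Nl = 0%E ->
  A `<=` Nl `|` B -> (prob P A <= P B)%E.
Proof.
move=> mB mN PN AB; have mU : measurable (Nl `|` B) by exact: measurableU.
apply: (le_trans (le_mu_ext P AB)).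
rewrite [leLHS](measurable_mu_extE P mU).
have := measureU2 P mN mB.
rewrite [X in (_ <= X + _)%E -> _]PN add0e.
exact.
Qed.

Lemma prob_ge (A B Nl : set Om) : measurable B -> measurable Nl -> P Nl = 0%E ->
  B `\` Nl `<=` A -> (P B <= prob P A)%E.
Proof.
move=> mB mN PN BA; have mD : measurable (B `\` Nl) by exact: measurableD.
apply: le_trans (le_mu_ext P BA).
rewrite [leRHS](measurable_mu_extE P mD).
have mI : measurable (B `&` Nl) by exact: measurableI.
have PI : (P (B `&` Nl) <= 0)%E by rewrite -PN; apply: le_measure; rewrite ?inE.
by rewrite [leLHS](measureDI P mB mN) -[leRHS]adde0 leeD2l.
Qed.

End OuterProbability.

Section Scaling.
Context {R : realType}.

Definition height (eps : R) : R := eps `^ (- 2^-1).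

Lemma height_gt0 (eps : R) : 0 < eps -> 0 < height eps.
Proof. exact: powR_gt0. Qed.

Lemma height_sqr (eps : R) : 0 < eps -> height eps ^+ 2 = eps^-1.
Proof.
move=> e0; rewrite /height -powR_mulrn ?powR_ge0// -powRrM.
by rewrite (_ : - 2^-1 * 2 = -1 :> R) ?powR_inv1 ?ltW//; field.
Qed.

Lemma height_sqrM (eps : R) : 0 < eps -> height eps ^+ 2 * eps = 1.
Proof. by move=> e0; rewrite height_sqr// mulVf// gt_eqF. Qed.

Lemma near_right0_le (e0 : R) : 0 < e0 -> \forall eps \near 0^'+, 0 < eps <= e0.
Proof.
move=> e00; near=> eps; apply/andP; split; near: eps; first exact: nbhs_right_gt.
exact: nbhs_right_le.
Unshelve. all: by end_near. Qed.

Lemma bernoulli_ge (x : R) n : 0 <= x -> x <= 1 -> 1 - x *+ n <= (1 - x) ^+ n.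
Proof.
move=> x0 x1; elim: n => [|n IH]; first by rewrite mulr0n expr0 subr0.
have h : (1 - x) * (1 - x *+ n) <= (1 - x) * (1 - x) ^+ n by rewrite ler_wpM2l ?subr_ge0.
rewrite exprS; apply: le_trans h.
have : 0 <= x * (x *+ n) by rewrite mulr_ge0// mulrn_wge0.
by rewrite mulrS; lra.
Qed.

Lemma growth_zrange (b : R) N k : 0 < b -> k \in zrange N -> growth b k <= growth b (Posz N).
Proof.
move=> b0; rewrite mem_zrange => kN; rewrite ler_expR ler_wpM2l ?divr_ge0 ?(ltW b0)//.
by rewrite -!intr_norm ler_int; lia.
Qed.

End Scaling.

Section LargeDeviation.
Context {R : realType} {d : measure_display} {Om : measurableType d}.
Variables (P : probability Om R) (a b : R) (c : int -> R) (eta : int -> Om -> R[i]).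
Variables (z0 C : R) (t : R -> R) (u : R -> Om -> R -> R -> R[i]).
Hypotheses (a_gt0 : 0 < a) (b_gt0 : 0 < b) (c_adm : admissible_coef a b c).
Hypothesis eta_iid : iid_complex_gaussians P eta.
Hypotheses (z0_gt0 : 0 < z0) (C_gt0 : 0 < C).
Hypothesis t_gt0 : forall eps : R, 0 < eps -> 0 < t eps.
Hypothesis t_le : \forall eps \near (0 : R)^'+, t eps <= C * eps^-1.
Hypothesis u_sol : forall eps : R, 0 < eps ->
  {ae P, forall w, nls_solution eps (u eps w) /\
     (forall x : R,
        zsum_to (fun k : int => (c k)%:C * eta k w * cexp (k%:~R * x)) (u eps w 0 x))}.

Let event eps : set Om :=
  [set w | ((z0 * height eps)%:E < sup_circle (u eps w (t eps)))%E].
Let sigma2 : R := coef_sum2 c.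
Let rate : R := z0 ^+ 2 / sigma2.

Let sigma2_gt0 : 0 < sigma2. Proof. exact: (coef_sum2_gt0 a_gt0 b_gt0 c_adm). Qed.
Let rate_gt0 : 0 < rate. Proof. by rewrite divr_gt0// exprn_gt0. Qed.
Let c_gt0 k : 0 < c k. Proof. exact: (coef_gt0 a_gt0 c_adm). Qed.

Let mode k w : R[i] := (c k)%:C * eta k w.

Let modulus_mode k w : modulus (mode k w) = c k * modulus (eta k w).
Proof. by rewrite modulusM modulusR gtr0_norm. Qed.

Let mode_sum_le (Lam kap r : R) (s : seq int) w : 0 <= kap ->
  (forall k, k \in s -> modulus (eta k w) <= kap * Lam * growth b k) ->
  Lam * \sum_(k <- s) modulus (weight b c k)%:C <= r ->
  \sum_(k <- s) modulus (mode k w) <= r * kap.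
Proof.
move=> kap0 small sr; apply: (@le_trans _ _ (kap * (Lam * \sum_(k <- s) modulus (weight b c k)%:C))).
  rewrite mulrA mulr_sumr big_seq [leRHS]big_seq; apply: ler_sum => k ks.
  rewrite modulus_mode modulusR ger0_norm; last exact: (weight_ge0 a_gt0 c_adm).
  apply: (le_trans (ler_wpM2l (ltW (c_gt0 k)) (small k ks))).
  by rewrite /weight le_eqVlt; apply/orP; left; apply/eqP; ring.
by rewrite [leRHS]mulrC ler_wpM2l.
Qed.

Lemma upper_bound (r : R) : 0 < r -> exists2 D : R, 1 <= D &
  \forall eps \near 0^'+, (prob P (event eps) <= (D * expR (- ((rate - r) / eps)))%:E)%E.
Proof.
move=> r0; pose tau := Num.min 2^-1 (r / (rate *+ 5)).
have rate5 : 0 < rate *+ 5 by rewrite mulrn_wgt0.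
have tau0 : 0 < tau by rewrite lt_min invr_gt0 ltr0n divr_gt0.
have tau12 : tau <= 2^-1 by rewrite ge_min lexx.
have tau1 : tau < 1 by rewrite (le_lt_trans tau12)// invf_lt1// ltr1n.
have tau_r : tau * (rate *+ 5) <= r by rewrite -ler_pdivlMr// ge_min lexx orbT.
pose Lam := (rate + 1) *+ 2.
have Lam0 : 0 < Lam by rewrite mulrn_wgt0// addr_gt0.
have Lam2 : rate + 1 <= Lam ^+ 2 / 2.
  have : 1 <= rate + 1 by rewrite lerDr ltW.
  by rewrite /Lam mulr2n expr2; set q := rate + 1 => ?; nra.
have [H H0 WH] := weight_l1 a_gt0 b_gt0 c_adm.
pose K := Lam * H; have K0 : 0 < K by rewrite mulr_gt0.
pose E := expR (K ^+ 2 * C *+ 7); have E0 : 0 < E by exact: expR_gt0.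
have E3 : 0 < E *+ 3 by rewrite mulrn_wgt0.
pose delta := Num.min K (tau * z0) / (E *+ 3).
have delta0 : 0 < delta by rewrite divr_gt0// lt_min K0 mulr_gt0.
have deltaE : delta * E *+ 3 = Num.min K (tau * z0).
  by rewrite -mulrnAr /delta divfK// gt_eqF.
have dL : 0 < delta / Lam by rewrite divr_gt0.
have [N tailN] := l1le_tail WH dL.
have z10 : 0 < (1 - tau) * z0 by rewrite mulr_gt0// subr_gt0.
have LamN : 0 < Lam * growth b (Posz N) by rewrite mulr_gt0// growth_gt0.
have S2N : \sum_(k <- zrange N) c k ^+ 2 <= sigma2.
  by apply: (coef_sum2_ge a_gt0 b_gt0 c_adm); exact: zrange_uniq.
have [D1 D10 box] := box_upper eta_iid c_gt0 S2N z10 tau0 tau1 LamN.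
have [D2 D20 fs] := far_sum eta_iid b_gt0.
exists (1 + (D1 + D2)); first by rewrite lerDl addr_ge0// ltW.
pose e0 := Num.min 1 (Num.min (K ^+ 2 *+ 4)^-1 (delta / (K ^+ 3 *+ 2))).
have e00 : 0 < e0.
  by rewrite !lt_min ltr01 invr_gt0 divr_gt0// mulrn_wgt0// exprn_gt0.
have nearE := near_right0_le e00.
near=> eps.
have /andP[eps0 eps_le] : 0 < eps <= e0 by near: eps.
have tC : t eps <= C / eps by near: eps.
move: eps_le; rewrite !le_min => /and3P[eps1 epsK2 epsK3].
have kap0 := height_gt0 eps0; have kap2 := height_sqr eps0.
set kap := height eps in kap0 kap2.
have kap_eps : kap ^+ 2 * eps = 1 by exact: height_sqrM.
have ie : 1 <= eps^-1 by rewrite -invr1 lef_pV2 ?posrE.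
have [Nl [mN PN solN]] := u_sol eps0.
have [B mB [Bcover PB]] := box kap kap0.
pose x := kap * Lam; have x0 : 0 <= x by rewrite mulr_ge0// ltW.
have x2 : x ^+ 2 / 2 = (Lam ^+ 2 / 2) / eps by rewrite /x exprMn kap2; ring.
have x1 : 1 <= x ^+ 2 / 2.
  rewrite x2 -[leLHS]mulr1 ler_pM// (le_trans _ Lam2)// lerDr ltW//.
pose U := \bigcup_k far eta k (x * growth b k).
have mfar k : measurable (far eta k (x * growth b k)) by exact: (measurable_far eta_iid).
have mU : measurable U.
  rewrite (_ : U = \bigcup_n (far eta (Posz n) (x * growth b (Posz n)) `|`
                              far eta (Negz n) (x * growth b (Negz n)))).
    by apply: bigcupT_measurable => n; exact: measurableU.
  apply/seteqP; split => w; first by move=> [[n|n] _ ?]; exists n => //; [left|right].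
  by move=> [n _ [?|?]]; [exists (Posz n)|exists (Negz n)].
have PU : (P U <= (D2 * expR (- (x ^+ 2 / 2)))%:E)%E.
  by apply: (measure_int_subadditive mU mfar) => // s us; exact: fs.
have cover : event eps `<=` Nl `|` (U `|` B).
  move=> w Aw; have [Nw|Nw] := pselect (Nl w); [by left|right].
  have [Uw|Uw] := pselect (U w); [by left|right].
  have [sol ini] : nls_solution eps (u eps w) /\ (forall x : R,
        zsum_to (fun k : int => (c k)%:C * eta k w * cexp (k%:~R * x)) (u eps w 0 x)).
    by apply: contra_notP Nw => bad; exact: solN.
  have small k : modulus (eta k w) <= kap * Lam * growth b k.
    have [/ltW//|far_k] := ltP (modulus (eta k w)) (kap * Lam * growth b k).
    by exfalso; apply: Uw; exists k => //; apply/farE.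
  have head : \sum_(k <- zrange N) modulus (mode k w) <= K * kap.
    apply: (mode_sum_le (Lam := Lam) (ltW kap0)) => //; rewrite ler_wpM2l ?(ltW Lam0)//.
    by apply: WH; exact: zrange_uniq.
  have tail s : uniq s -> (forall k, k \in s -> k \notin zrange N) ->
      \sum_(k <- s) modulus (mode k w) <= delta * kap.
    move=> us sN; apply: (mode_sum_le (Lam := Lam) (ltW kap0)) => //.
    by rewrite mulrC -ler_pdivlMr// tailN.
  have tr : 0 <= t eps <= C / eps by rewrite tC ltW// t_gt0.
  have k1 : eps * K ^+ 2 *+ 4 <= 1.
    by rewrite -mulrnAr -ler_pdivlMr ?mulrn_wgt0 ?exprn_gt0// div1r.
  have k2 : eps * K ^+ 3 *+ 2 <= delta.
    by rewrite -mulrnAr -ler_pdivlMr// mulrn_wgt0// exprn_gt0.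
  have k3 : delta * E *+ 3 <= K by rewrite deltaE ge_min lexx.
  have sup_le := sup_circle_le sol ini eps0 kap0 kap_eps delta0 head tail tr k1 k2 k3.
  apply: Bcover.
    move=> k kN; apply: (le_trans (small k)); rewrite -mulrA.
    by rewrite ler_wpM2l ?(ltW kap0)// ler_wpM2l ?(ltW Lam0)// growth_zrange.
  have := lt_le_trans Aw sup_le; rewrite lte_fin -/kap.
  rewrite (eq_bigr _ (fun k _ => modulus_mode k w)).
  have : delta * expR (K ^+ 2 * C *+ 7) *+ 3 <= tau * z0 by rewrite deltaE ge_min lexx orbT.
  by move=> h1 h2; have := ler_wpM2r (ltW kap0) h1; lra.
apply: (le_trans (prob_le (measurableU _ _ mU mB) mN PN cover)).
apply: (le_trans (measureU2 _ mU mB)).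
apply: (le_trans (leeD PU PB)); rewrite -EFinD lee_fin.
set g := expR _; set g1 := expR _; set g2 := expR _.
have g0 : 0 < g2 by exact: expR_gt0.
have le1 : g <= g2.
  rewrite ler_expR lerN2 x2 ler_wpM2r ?invr_ge0 ?(ltW eps0)// (le_trans _ Lam2)//.
  by move: r0 rate_gt0; lra.
have le2 : g1 <= g2.
  rewrite ler_expR lerN2 kap2 ler_wpM2r ?invr_ge0 ?(ltW eps0)//.
  have -> : (1 - tau) ^+ 3 * (((1 - tau) * z0) ^+ 2 / sigma2) = (1 - tau) ^+ 5 * rate.
    by rewrite /rate; ring.
  apply: le_trans (ler_wpM2r (ltW rate_gt0) (bernoulli_ge 5 (ltW tau0) (ltW tau1))).
  have -> : (1 - tau *+ 5) * rate = rate - tau * (rate *+ 5) by ring.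
  by rewrite lerD2l lerN2.
have h1 : D2 * g <= D2 * g2 by rewrite ler_wpM2l// ltW.
have h2 : D1 * g1 <= D1 * g2 by rewrite ler_wpM2l.
by rewrite mulrDl mulrDl mul1r; lra.
Unshelve. all: by end_near. Qed.

Lemma lower_bound (r : R) : 0 < r -> \forall eps \near 0^'+,
  ((2^-1 * expR (- ((rate + r) / eps)))%:E <= prob P (event eps))%E.
Proof.
move=> r0; have r20 : 0 < r / 2 by rewrite divr_gt0.
pose th := Num.min 1 (r * sigma2 / 4 / (z0 *+ 2 + 1)).
have z21 : 0 < z0 *+ 2 + 1 by rewrite addr_gt0// mulrn_wgt0.
have rs0 : 0 < r * sigma2 / 4 by rewrite divr_gt0// mulr_gt0.
have th0 : 0 < th by rewrite lt_min ltr01 divr_gt0.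
have th1 : th <= 1 by rewrite ge_min lexx.
have thr : th * (z0 *+ 2 + 1) <= r * sigma2 / 4 by rewrite -ler_pdivlMr// ge_min lexx orbT.
have rr0 : 0 < rate + r / 2 by rewrite addr_gt0.
have gap0 : 0 < r * sigma2 / 4 / (rate + r / 2) by rewrite divr_gt0.
have [N HN] := coef_sum2_approx a_gt0 b_gt0 c_adm gap0.
pose S2 := \sum_(k <- zrange N) c k ^+ 2; pose Sc := \sum_(k <- zrange N) c k.
have s0 : 0 \in zrange N by rewrite mem_zrange.
have Sc0 : 0 < Sc.
  by rewrite /Sc (big_rem 0)//= ltr_pwDl// sumr_ge0// => k _; exact: ltW.
have S20 : 0 < S2.
  by rewrite /S2 (big_rem 0)//= ltr_pwDl ?exprn_gt0// sumr_ge0// => k _; exact: sqr_ge0.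
have cost : (z0 + th) ^+ 2 / S2 <= rate + r / 2.
  rewrite ler_pdivrMr//.
  have : (rate + r / 2) * (sigma2 - r * sigma2 / 4 / (rate + r / 2)) <= (rate + r / 2) * S2.
    by rewrite ler_wpM2l ?(ltW rr0)// ltW.
  have -> : (rate + r / 2) * (sigma2 - r * sigma2 / 4 / (rate + r / 2)) = z0 ^+ 2 + r * sigma2 / 4.
    rewrite mulrBr [X in _ - X]mulrC divfK ?gt_eqF// mulrDl /rate divfK ?gt_eqF//; lra.
  apply: le_trans; rewrite sqrrD -addrA lerD2l.
  have : th ^+ 2 <= th by rewrite expr2 ler_piMl// ltW.
  move: thr; rewrite mulrDr mulr1 mulrnAr [th * z0]mulrC; lra.
pose lam := (z0 + th) / S2; have zt0 : 0 < z0 + th by rewrite addr_gt0.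
have lam0 : 0 < lam by rewrite divr_gt0.
have lamS2 : lam * S2 = z0 + th by rewrite /lam divfK// gt_eqF.
pose K := z0 + th + Sc; have K0 : 0 < K by rewrite addr_gt0.
pose E := expR (K ^+ 2 * C *+ 7); have E0 : 0 < E by exact: expR_gt0.
have E3 : 0 < E *+ 3 by rewrite mulrn_wgt0.
pose M := Sc * (1 + (z0 + th) * (K * C *+ 12)).
have M0 : 0 < M.
  by rewrite mulr_gt0// addr_gt0// mulr_gt0// mulrn_wgt0// mulr_gt0.
pose del := Num.min 1 (th / 2 / M).
have del0 : 0 < del by rewrite lt_min ltr01 !divr_gt0.
have del1 : del <= 1 by rewrite ge_min lexx.
have delM : del * M <= th / 2 by rewrite -ler_pdivlMr// ge_min lexx orbT.
pose delta := Num.min K (th / 4) / (E *+ 3).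
have delta0 : 0 < delta by rewrite divr_gt0// lt_min K0 divr_gt0.
have deltaE : delta * E *+ 3 = Num.min K (th / 4).
  by rewrite -mulrnAr /delta divfK// gt_eqF.
have [H H0 WH] := weight_l1 a_gt0 b_gt0 c_adm.
pose Lam := delta / H; have Lam0 : 0 < Lam by rewrite divr_gt0.
pose n : R := (size (zrange N))%:R + 1.
have n0 : 0 < n by rewrite ltr_wpDl.
pose e := r / 2 / n; have ee0 : 0 < e by rewrite divr_gt0.
have rho0 k : 0 <= lam * c k by rewrite mulr_ge0// ltW.
have [K1 near_low] := near_lower eta_iid N rho0 b_gt0 del0 ee0 Lam0.
pose e1 := Num.min (1 + K1 ^+ 2)^-1 (Num.min (K ^+ 2 *+ 4)^-1 (delta / (K ^+ 3 *+ 2))).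
have K11 : 0 < 1 + K1 ^+ 2 by rewrite ltr_pwDl// sqr_ge0.
have e10 : 0 < e1.
  by rewrite !lt_min !invr_gt0 K11 divr_gt0 ?mulrn_wgt0 ?exprn_gt0.
have nearE := near_right0_le e10.
near=> eps.
have /andP[eps0 eps_le] : 0 < eps <= e1 by near: eps.
have tC : t eps <= C / eps by near: eps.
move: eps_le; rewrite !le_min => /and3P[epsK1 epsK2 epsK3].
have kap0 := height_gt0 eps0; have kap2 := height_sqr eps0.
set kap := height eps in kap0 kap2.
have kap_eps : kap ^+ 2 * eps = 1 by exact: height_sqrM.
have kapK1 : K1 <= kap.
  apply: (le_trans (ler_norm _)); rewrite -(ger0_norm (ltW kap0)) -ler_sqr ?nnegrE//.
  rewrite !real_normK ?num_real// kap2 (@le_trans _ _ (1 + K1 ^+ 2)) ?lerDr//.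
  by rewrite -[leLHS]invrK lef_pV2 ?posrE// invr_gt0.
pose gy k : R[i] := (kap * (lam * c k ^+ 2))%:C.
pose sigma k := cexp (freq gy N eps k * t eps).
have sigma1 k : modulus (sigma k) = 1 by exact: modulus_cexp.
have [A mA [Aprop PA]] := near_low kap kapK1 sigma sigma1.
have [Nl [mN PN solN]] := u_sol eps0.
have tr : 0 <= t eps <= C / eps by rewrite tC ltW// t_gt0.
have sub : A `\` Nl `<=` event eps.
  move=> w [Aw Nw]; have [near_w far_w] := Aprop w Aw.
  have [sol ini] : nls_solution eps (u eps w) /\ (forall x : R,
        zsum_to (fun k : int => (c k)%:C * eta k w * cexp (k%:~R * x)) (u eps w 0 x)).
    by apply: contra_notP Nw => bad; exact: solN.
  have near_g k : k \in zrange N ->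
      modulus (mode k w - gy k * cexp (freq gy N eps k * t eps)) <= c k * (kap * del).
    move=> kN; have -> : mode k w - gy k * cexp (freq gy N eps k * t eps) =
       (c k)%:C * (eta k w - (kap * (lam * c k))%:C * sigma k).
      have -> : gy k = (c k)%:C * (kap * (lam * c k))%:C.
        by rewrite -rmorphM/= /gy; congr (_%:C); ring.
      by rewrite /mode /sigma; ring.
    rewrite modulusM modulusR (gtr0_norm (c_gt0 k)) ler_wpM2l ?(ltW (c_gt0 k))//.
    exact: near_w.
  have K_large : lam * S2 + del * Sc <= K.
    by rewrite lamS2 /K lerD2l ler_piMl// ltW.
  have c0 k : 0 <= c k by exact: ltW.
  have head := lower_head kap0 (ltW lam0) near_g K_large.
  have amp_ge := lower_amplitude c0 eps0 kap0 kap_eps (ltW del0) (ltW lam0) tr near_g K_large.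
  have tail s : uniq s -> (forall k, k \in s -> k \notin zrange N) ->
      \sum_(k <- s) modulus (mode k w) <= delta * kap.
    move=> us sN; apply: (mode_sum_le (Lam := Lam) (ltW kap0)).
      by move=> k /sN; exact: far_w.
    by rewrite /Lam mulrAC ler_pdivrMr// ler_wpM2l ?(ltW delta0)// WH.
  have k1 : eps * K ^+ 2 *+ 4 <= 1.
    by rewrite -mulrnAr -ler_pdivlMr ?mulrn_wgt0 ?exprn_gt0// div1r.
  have k2 : eps * K ^+ 3 *+ 2 <= delta.
    by rewrite -mulrnAr -ler_pdivlMr// mulrn_wgt0// exprn_gt0.
  have k3 : delta * E *+ 3 <= K by rewrite deltaE ge_min lexx.
  have sup_ge := sup_circle_ge sol ini eps0 kap0 kap_eps delta0 head tail tr k1 k2 k3.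
  apply: lt_le_trans sup_ge; rewrite lte_fin -/kap.
  have h1 : delta * expR (K ^+ 2 * C *+ 7) *+ 3 * kap <= th / 4 * kap.
    by rewrite ler_wpM2r ?(ltW kap0)// deltaE ge_min lexx orbT.
  have h2 : kap * (z0 + th / 2) <= kap * (lam * S2 - del * Sc - lam * S2 * (K * del * Sc * C *+ 12)).
    rewrite ler_wpM2l ?(ltW kap0)// lamS2.
    have -> : z0 + th - del * Sc - (z0 + th) * (K * del * Sc * C *+ 12) = z0 + th - del * M.
      by rewrite /M; ring.
    by move: delM; lra.
  have h3 : 0 < th * kap by rewrite mulr_gt0.
  by move: amp_ge h1 h2 h3; rewrite -/S2 -/Sc; lra.
apply: le_trans (prob_ge mA mN PN sub); apply: le_trans PA; rewrite lee_fin ler_wpM2l// ler_expR lerN2.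
rewrite -mulr_suml kap2 ler_wpM2r ?invr_ge0 ?(ltW eps0)// big_split/=.
rewrite (eq_bigr (fun k => lam ^+ 2 * c k ^+ 2)) => [|k _]; last by rewrite exprMn.
rewrite -mulr_sumr -/S2 big_const_seq count_predT iter_addr_0.
have -> : lam ^+ 2 * S2 = (z0 + th) ^+ 2 / S2.
  by rewrite /lam; field; rewrite gt_eqF.
have : e *+ size (zrange N) <= r / 2.
  by rewrite /e -mulr_natr mulrAC ler_pdivrMr// ler_wpM2l ?(ltW r20)// /n lerDl.
by move: cost; lra.
Unshelve. all: by end_near. Qed.

End LargeDeviation.

Theorem theorem1p1 (R : realType) (d : measure_display) (Om : measurableType d)
    (P : probability Om R) (a b : R) (c : int -> R) (eta : int -> Om -> R[i])
    (z0 C : R) (t : R -> R) (u : R -> Om -> R -> R -> R[i])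
    (a_gt0 : 0 < a) (b_gt0 : 0 < b) (c_adm : admissible_coef a b c)
    (eta_iid : iid_complex_gaussians P eta)
    (z0_gt0 : 0 < z0) (C_gt0 : 0 < C)
    (t_gt0 : forall eps : R, 0 < eps -> 0 < t eps)
    (t_le : \forall eps \near (0 : R)^'+, t eps <= C * eps^-1)
    (u_sol : forall eps : R, 0 < eps ->
       {ae P, forall w, nls_solution eps (u eps w) /\
          (forall x : R,
             zsum_to (fun k : int => (c k)%:C * eta k w * cexp (k%:~R * x))
                     (u eps w 0 x))}) :
  (eps%:E * lne (prob P [set w |
      ((z0 * eps `^ (- 2^-1))%:E < sup_circle (u eps w (t eps)))%E]))%E
    @[eps --> (0 : R)^'+]
  --> (- (z0 ^+ 2 / coef_sum2 c))%:E.
Proof.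
have ub := upper_bound a_gt0 b_gt0 c_adm eta_iid z0_gt0 t_gt0 t_le u_sol.
have lb := lower_bound a_gt0 b_gt0 c_adm eta_iid z0_gt0 C_gt0 t_gt0 t_le u_sol.
set rate := z0 ^+ 2 / coef_sum2 c in ub lb *.
set F := fun eps : R => (_ * lne _)%E.
have close rho : 0 < rho -> \forall eps \near 0^'+, exists2 v : R, F eps = v%:E & `|- rate - v| <= rho.
  move=> rho0; have r0 : 0 < rho / 2 by rewrite divr_gt0.
  have [D D1 ubD] := ub _ r0; have {}lb := lb _ r0.
  have lnD : 0 <= ln D by exact: ln_ge0.
  have l0 : 0 < 1 + (ln D + ln 2) by rewrite ltr_pwDl// addr_ge0// ln_ge0// ler1n.
  have e00 : 0 < rho / 2 / (1 + (ln D + ln 2)) by rewrite divr_gt0.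
  have nearE := near_right0_le e00.
  near=> eps.
  have /andP[eps0] : 0 < eps <= rho / 2 / (1 + (ln D + ln 2)) by near: eps.
  rewrite ler_pdivlMr// => eps_le.
  rewrite /F -/(height eps).
  have : (prob P [set w | ((z0 * height eps)%:E < sup_circle (u eps w (t eps)))%E] <=
     (D * expR (- ((rate - rho / 2) / eps)))%:E)%E by near: eps.
  have : ((2^-1 * expR (- ((rate + rho / 2) / eps)))%:E <=
     prob P [set w | ((z0 * height eps)%:E < sup_circle (u eps w (t eps)))%E])%E by near: eps.
  case: (prob P _) => [p| |]; [|by rewrite [(+oo <= _)%E]leye_eq|by rewrite leeNy_eq].
  rewrite !lee_fin => pl pu.
  have p0 : 0 < p by apply: lt_le_trans pl; rewrite mulr_gt0// expR_gt0.
  exists (eps * ln p); first by rewrite lne_EFin// EFinM.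
  have D0 : 0 < D by exact: lt_le_trans D1.
  have up : eps * ln p <= eps * ln D - (rate - rho / 2).
    have -> : eps * ln D - (rate - rho / 2) = eps * ln (D * expR (- ((rate - rho / 2) / eps))).
      by rewrite lnM ?posrE ?expR_gt0// expRK; field; rewrite gt_eqF.
    by rewrite ler_wpM2l ?(ltW eps0)// ler_ln ?posrE// mulr_gt0// expR_gt0.
  have lo : - (eps * ln 2) - (rate + rho / 2) <= eps * ln p.
    have -> : - (eps * ln 2) - (rate + rho / 2) = eps * ln (2^-1 * expR (- ((rate + rho / 2) / eps))).
      by rewrite lnM ?posrE ?expR_gt0// expRK lnV ?posrE//; field; rewrite gt_eqF.
    by rewrite ler_wpM2l ?(ltW eps0)// ler_ln ?posrE// mulr_gt0// expR_gt0.
  have e1 : 0 <= eps * ln D by rewrite mulr_ge0// ltW.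
  have e2 : 0 <= eps * ln 2 by rewrite mulr_ge0 ?(ltW eps0)// ln_ge0// ler1n.
  by rewrite ler_norml; move: eps_le up lo; rewrite mulrDr mulrDr mulr1; lra.
apply/fine_cvgP; split.
  by apply: filterS (close 1 ltr01) => eps [v -> _].
apply/cvgrPdist_le => rho rho0; apply: filterS (close rho rho0) => eps [v Fv].
by rewrite /= Fv.
Unshelve. all: by end_near. Qed.
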